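(* Let $\mathfrak p\in\mathcal H_3$ be such that $|\mathrm{Aut}(\mathfrak p)|>4$. Then the field of moduli of $\mathfrak p$ is a field of definition.
   Context: All curves are defined over $\mathbb C$. $\mathcal H_3$ is the moduli space (set of isomorphism classes) of genus $3$ hyperelliptic curves over $\mathbb C$; $\mathrm{Aut}(\mathfrak p)$ is the automorphism group (over $\mathbb C$) of a curve representing $\mathfrak p$. A field $F\subset\mathbb C$ is a field of definition of a curve $\mathcal X$ (or of its moduli point) if there is a curve $\mathcal X'$ defined over $F$ which is isomorphic to $\mathcal X$ over $\mathbb C$. The field of moduli of $\mathcal X$ (or of its moduli point) is the subfield $F\subset\mathbb C$ such that for every $\sigma\in\mathrm{Aut}(\mathbb C)$: $\mathcal X\cong\mathcal X^\sigma$ if and only if $\sigma|_F=\mathrm{id}$. *)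

(* Defs.v *)
(* The complex numbers are R[i] for an arbitrary R : realType. *)
From HB Require Import structures.
From mathcomp Require Import all_boot all_order all_algebra all_field.
From mathcomp Require Import complex reals mpoly.

Set Implicit Arguments.
Unset Strict Implicit.
Unset Printing Implicit Defensive.

Import GRing.Theory.

Local Open Scope ring_scope.

(* Points of P^n are represented by nonzero vectors of homogeneous coordinates
   ('rV_n.+1), up to proj_eq.  A projective algebraic set in P^n is given by a
   finite list of homogeneous polynomials in n + 1 variables. *)
Section ProjectiveCurves.

Variable C : closedFieldType.

Definition proj_eq (n : nat) (u v : 'rV[C]_n.+1) : Prop :=
  exists2 c : C, c != 0 & u = c *: v.

Definition on_locus (n : nat) (X : seq {mpoly C[n.+1]}) (v : 'rV[C]_n.+1) :
    bool :=
  (v != 0) && all (fun p => p.@[v 0] == 0) X.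

Definition homogeneous (n : nat) (X : seq {mpoly C[n.+1]}) : bool :=
  all (fun p => p \is homog mdeg) X.

Definition locus_irreducible (n : nat) (X : seq {mpoly C[n.+1]}) : Prop :=
  (exists v, on_locus X v) /\
  forall Z1 Z2 : seq {mpoly C[n.+1]}, homogeneous Z1 -> homogeneous Z2 ->
    (forall v, on_locus X v -> on_locus Z1 v \/ on_locus Z2 v) ->
    (forall v, on_locus X v -> on_locus Z1 v) \/
    (forall v, on_locus X v -> on_locus Z2 v).

Definition jacobian (n : nat) (X : seq {mpoly C[n.+1]}) (v : 'rV[C]_n.+1) :
    'M[C]_(size X, n.+1) :=
  \matrix_(i < size X, j < n.+1) (X`_i^`M(j)).@[v 0].

(* Jacobian criterion for smoothness of dimension 1: the rank is n - 1 at every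
   point (written additively, so that n = 0 is excluded). *)
Definition smooth_projective_curve (n : nat) (X : seq {mpoly C[n.+1]}) : Prop :=
  [/\ homogeneous X,
      locus_irreducible X
    & forall v, on_locus X v -> (\rank (jacobian X v) + 1 = n)%N].

Definition eval_forms (n m : nat) (P : 'I_m.+1 -> {mpoly C[n.+1]})
    (v : 'rV[C]_n.+1) : 'rV[C]_m.+1 :=
  \row_i (P i).@[v 0].

(* phi acts on representatives; the local expression by forms of a common
   degree forces it to be compatible with proj_eq on X. *)
Definition morphism (n m : nat) (X : seq {mpoly C[n.+1]})
    (Y : seq {mpoly C[m.+1]}) (phi : 'rV[C]_n.+1 -> 'rV[C]_m.+1) : Prop :=
  (forall v, on_locus X v -> on_locus Y (phi v)) /\
  (forall v, on_locus X v ->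
     exists (d : nat) (P : 'I_m.+1 -> {mpoly C[n.+1]}),
       [/\ forall i, P i \is d.-homog,
           eval_forms P v != 0
         & forall w, on_locus X w -> eval_forms P w != 0 ->
             proj_eq (phi w) (eval_forms P w)]).

Definition isomorphism (n m : nat) (X : seq {mpoly C[n.+1]})
    (Y : seq {mpoly C[m.+1]}) (phi : 'rV[C]_n.+1 -> 'rV[C]_m.+1) : Prop :=
  morphism X Y phi /\
  exists psi : 'rV[C]_m.+1 -> 'rV[C]_n.+1,
    [/\ morphism Y X psi,
        forall v, on_locus X v -> proj_eq (psi (phi v)) v
      & forall w, on_locus Y w -> proj_eq (phi (psi w)) w].

Definition isomorphic (n m : nat) (X : seq {mpoly C[n.+1]})
    (Y : seq {mpoly C[m.+1]}) : Prop :=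
  exists phi, isomorphism X Y phi.

(* |Aut X| > k: there are k + 1 automorphisms of X which are pairwise distinct
   as maps on the points of X. *)
Definition card_Aut_gt (n : nat) (X : seq {mpoly C[n.+1]}) (k : nat) : Prop :=
  exists a : 'I_k.+1 -> 'rV[C]_n.+1 -> 'rV[C]_n.+1,
    (forall i, isomorphism X X (a i)) /\
    (forall i j, i != j ->
       ~ forall v, on_locus X v -> proj_eq (a i v) (a j v)).

(* The smooth projective model in P^(g+2) of the affine curve y^2 = f(x), where
   deg f is 2g+1 or 2g+2: the closure of the image of
   (x, y) |-> [1 : x : ... : x^(g+1) : y].  It is cut out by the quadrics of the
   rational normal curve of degree g+1 (a cone over it, with vertex the last
   coordinate point) and by y^2 = \sum_k f_k x^(floor(k/2)) x^(ceil(k/2)). *)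
Definition hyperelliptic_model (g : nat) (f : {poly C}) :
    seq {mpoly C[g.+3]} :=
  ('X_ord_max ^+ 2
     - \sum_(k < g.*2.+3) f`_k *: ('X_(inord k./2) * 'X_(inord (uphalf k))))
  :: [seq 'X_(inord i) * 'X_(inord j.+1) - 'X_(inord i.+1) * 'X_(inord j)
     | i <- iota 0 g.+1, j <- iota 0 g.+1].

Definition hyperelliptic_curve (g : nat) (n : nat) (X : seq {mpoly C[n.+1]}) :
    Prop :=
  smooth_projective_curve X /\
  exists f : {poly C},
    [/\ separable_poly f,
        size f = g.*2.+2 \/ size f = g.*2.+3
      & isomorphic X (hyperelliptic_model g f)].

Definition conj_curve (sigma : {rmorphism C -> C}) (n : nat)
    (X : seq {mpoly C[n.+1]}) : seq {mpoly C[n.+1]} :=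
  [seq map_mpoly sigma p | p <- X].

(* Subfields of C are predicates F : divringClosed C. *)
Definition defined_over (F : divringClosed C) (n : nat)
    (X : seq {mpoly C[n.+1]}) : bool :=
  all (fun p => p \is a mpolyOver n.+1 F) X.

Definition field_of_definition (F : divringClosed C) (n : nat)
    (X : seq {mpoly C[n.+1]}) : Prop :=
  exists (m : nat) (Y : seq {mpoly C[m.+1]}),
    [/\ smooth_projective_curve Y, defined_over F Y & isomorphic Y X].

Definition field_of_moduli (F : divringClosed C) (n : nat)
    (X : seq {mpoly C[n.+1]}) : Prop :=
  forall sigma : {rmorphism C -> C}, bijective sigma ->
    (isomorphic X (conj_curve sigma X) <-> {in F, forall x, sigma x = x}).

End ProjectiveCurves.

(* Main.v *)
(* An isomorphism between models of [y^2 = f(x)] and [y^2 = f'(x)] is induced by a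
   Moebius transformation carrying one binary octic to a multiple of the other: a
   function [A + B y] taking each value at most twice has [B = 0]. Hence five
   automorphisms yield two non-scalar, non-proportional matrices stabilising [f], and
   [f] is equivalent to its conjugates by the automorphisms of the complex numbers
   fixing the field of moduli [F], whose fixed field is [F]. An octic over [F]
   equivalent to [f] is then found explicitly.
   If some stabilising matrix is not an involution of the projective line, [f] becomes
   a binomial, [t x^8 + x^4 + 1] or [t x^7 + x^4 + x]; the quadratic covariant
   (f,f)_6 shows that [t] is fixed by conjugation or rational.
   Otherwise the stabiliser is a Klein four-group and [f] becomes either
   [x^8 + a x^6 - a x^2 - 1], where [a^2] lies in [F], or a combination with
   coefficients [c_i] of the fourth powers of the three quadratic forms vanishing at
   the fixed points of the involutions. Conjugation permutes the [c_i] up to a common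
   factor; replacing the involutions by the translations by 2-torsion points on
   [y^2 = (x - c_0)(x - c_1)(x - c_2)] makes the combination symmetric in the [c_i]. *)
From HB Require Import structures.
Require Import Defs.
From mathcomp Require Import all_boot all_order all_algebra all_field.
From mathcomp Require Import complex reals mpoly.
From mathcomp Require Import separable ring.
From mathcomp Require boolp classical_sets.

Set Implicit Arguments.
Unset Strict Implicit.
Unset Printing Implicit Defensive.

Import GRing.Theory Num.Theory.

Local Open Scope ring_scope.

(** * Fibres of rational functions on the line and on y^2 = f(x) *)

Section PolynomialFibres.

Variable C : numClosedFieldType.
Implicit Types (a b c f g p q r A B D E W Z : {poly C}) (l x y : C).

(** The isomorphisms between the curve and its conjugates are chosen separately and need not form a
    cocycle, so there is no descent datum. Each case instead produces a normal form whose
    coefficients are invariants, and an invariant lies in F once all automorphisms of C over F fix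
    it. This asks that F be a full fixed field, although C is far from algebraic over it: a subfield
    L containing F and maximal among those avoiding a given z makes C algebraic over L, and a
    conjugation of z over L extends to C by Zorn's lemma. The covariant (f,f)_6 is quadratic in the
    coefficients and of order 4. On the two trinomials it is a multiple of s^2 t^2, so an
    equivalence between them preserves the pair 0, infinity; the multiple is zero for a single
    rational t in each family. In the last Klein case the three involutions stay fixed while
    conjugation permutes the c_i, so the combination is not symmetric. Involutions written in terms
    of the c_i are permuted along with them, and the common factor disappears when the c_i are
    divided by a symmetric quantity of degree one. *)

Lemma poly_eq0_generic Z p :
  Z != 0 -> (forall x, Z.[x] != 0 -> p.[x] = 0) -> p = 0.
Proof.
move=> Z0 H; have: Z * p = 0.
  have hv x : (Z * p).[x] = 0.
    rewrite hornerM; have [->|/H ->] := eqVneq Z.[x] 0; first by rewrite mul0r.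
    by rewrite mulr0.
  apply: (@roots_geq_poly_eq0 _ _ [seq i%:R | i <- iota 0 (size (Z * p))]).
  - by apply/allP => x _; apply/rootP.
  - by rewrite map_inj_uniq ?iota_uniq // => i j /eqP; rewrite eqr_nat => /eqP.
  - by rewrite size_map size_iota.
by move/eqP; rewrite mulf_eq0 (negPf Z0) => /eqP.
Qed.

Lemma generic_point Z : Z != 0 -> exists x, Z.[x] != 0.
Proof.
move=> Z0; case: (boolp.pselect (exists x, Z.[x] != 0)) => // H.
case/eqP: Z0; apply: (@poly_eq0_generic 1) => [|x _]; first exact: oner_neq0.
by apply/eqP/negPn/negP => Hx; apply: H; exists x.
Qed.

Lemma lead_coef_deriv p : lead_coef p^`() = lead_coef p *+ (size p).-1.
Proof.
have [p1|p1] := leqP (size p) 1.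
  by rewrite [p]size1_polyC // derivC lead_coef0 size_polyC; case: eqP.
have h : lead_coef p *+ (size p).-1 != 0.
  by rewrite mulrn_eq0 lead_coef_eq0 -size_poly_eq0; case: (size p) p1 => [|[|n]].
have c : p^`()`_(size p).-2 = lead_coef p *+ (size p).-1.
  by rewrite coef_deriv lead_coefE; case: (size p) p1 => [|[|n]].
suff e : size p^`() = (size p).-1 by rewrite lead_coefE e c.
have p0 : p != 0 by rewrite -size_poly_gt0 ltnW.
apply/eqP; rewrite eqn_leq -ltnS prednK ?size_poly_gt0 // lt_size_deriv //=.
have -> : (size p).-1 = (size p).-2.+1 by case: (size p) p1 => [|[|n]].
by rewrite ltnNge; apply/negP => l; rewrite -c nth_default ?eqxx in h.
Qed.

(** The leading coefficients of the two sides differ by the factors deg p and deg q only, so the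
    degrees agree in characteristic zero. *)
Lemma wronskian_size p q : p != 0 -> q != 0 -> p^`() * q = p * q^`() -> size p = size q.
Proof.
move=> p0 q0 /(congr1 lead_coef).
have h : lead_coef p * lead_coef q != 0 by rewrite mulf_neq0 // lead_coef_eq0.
rewrite !lead_coefM !lead_coef_deriv mulrnAl mulrnAr => /(mulrIn h).
by move: p0 q0; rewrite -!size_poly_gt0; case: (size p) => // n; case: (size q) => // m _ _ /= ->.
Qed.

(** Subtracting the multiple of q that cancels the top coefficient keeps the relation, so by
    [wronskian_size] a nonzero difference would still have the size of q. *)
Lemma wronskian_eq0 p q : q != 0 -> p^`() * q = p * q^`() -> exists k, p = k *: q.
Proof.
move=> q0 H; have [->|p0] := eqVneq p 0; first by exists 0; rewrite scale0r.
have spq := wronskian_size p0 q0 H.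
pose k := lead_coef p / lead_coef q.
exists k; apply/eqP; rewrite -subr_eq0; apply/negPn/negP => r0.
have er: size (p - k *: q) = size q.
  apply: wronskian_size => //; rewrite derivB derivZ mulrBl mulrBl H.
  by rewrite -!scalerAl [q^`() * q]mulrC.
have := lead_coef_eq0 (p - k *: q); rewrite (negPf r0) lead_coefE er coefB coefZ.
by rewrite -lead_coefE -{1}spq -lead_coefE /k divfK ?subrr ?eqxx // lead_coef_eq0.
Qed.

Lemma uniq_roots_generic p (rs : seq C) : p = lead_coef p *: \prod_(z <- rs) ('X - z%:P) ->
  (forall x, p.[x] = 0 -> p^`().[x] != 0) -> p != 0 -> uniq rs.
Proof.
move=> ep H p0; have lp : lead_coef p != 0 by rewrite lead_coef_eq0.
rewrite -separable_prod_XsubC -(eqp_separable (eqp_scale _ lp)) -ep unlock.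
by apply: Pdiv.ClosedField.root_coprimep => x /rootP; exact: H.
Qed.

Lemma separable_roots f : separable_poly f -> exists rs : seq C,
  [/\ uniq rs, size f = (size rs).+1 & forall x, x \in rs -> root f x].
Proof.
move=> sf; have f0 := separable_poly_neq0 sf; have [rs ers] := closed_field_poly_normal f.
exists rs; split.
- apply: (uniq_roots_generic ers) => // x /rootP rx.
  by move: sf; rewrite unlock => /coprimep_root ->.
- by rewrite {1}ers size_scale ?lead_coef_eq0 // size_prod_XsubC.
- by move=> x; rewrite ers rootZ ?lead_coef_eq0 // root_prod_XsubC.
Qed.

(** The common factor is split off one root at a time, which yields coprimality directly as a
    statement about points. *)
Lemma common_zeros p q r : p != 0 -> exists E a b c,
  [/\ E != 0, p = E * a, q = E * b, r = E * c &
      forall x, [|| a.[x] != 0, b.[x] != 0 | c.[x] != 0]].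
Proof.
move: {2}(size p) (leqnn (size p)) => n; elim: n p q r => [|n IH] p q r sp p0.
  by case/negP: p0; rewrite -size_poly_leq0.
case: (boolp.pselect (forall x, [|| p.[x] != 0, q.[x] != 0 | r.[x] != 0])) => [H|].
  by exists 1, p, q, r; rewrite !mul1r oner_neq0.
move/boolp.existsNP => [x /negP]; rewrite !negb_or !negbK => /and3P[].
rewrite -!rootE => /factor_theorem[p' ep] /factor_theorem[q' eq] /factor_theorem[r' er].
have p'0 : p' != 0 by apply: contraNneq p0 => e; rewrite ep e mul0r.
have [|E [a [b [c [E0 ea eb ec H]]]]] := IH p' q' r' _ p'0.
  by move: sp; rewrite ep size_Mmonic ?monicXsubC // size_XsubC addn2.
exists (E * ('X - x%:P)), a, b, c; split => //.
- by rewrite mulf_neq0 // polyXsubC_eq0.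
- by rewrite ep ea mulrAC.
- by rewrite eq eb mulrAC.
- by rewrite er ec mulrAC.
Qed.

Lemma mup_sqr e p : p != 0 -> odd (mup e (p ^+ 2)) = false.
Proof. by move=> p0; rewrite expr2 mupM // addnn odd_double. Qed.

Lemma mupZ e k p : k != 0 -> mup e (k *: p) = mup e p.
Proof.
by move=> k0; rewrite -mul_polyC mupMr // /root hornerC.
Qed.

Lemma mup_separable e f : separable_poly f -> root f e -> mup e f = 1%N.
Proof.
move=> sf re; have f0 : f != 0 := separable_poly_neq0 sf.
have h : ~~ root f^`() e.
  by move: sf; rewrite unlock => /coprimep_root h; rewrite rootE h.
apply/eqP; rewrite eqn_leq; apply/andP; split.
  rewrite mup_leq //; apply/negP => /dvdpP[g eg].
  case/negP: h; rewrite eg expr2 mulrA derivM derivXsubC mulr1 rootE hornerD !hornerM hornerXsubC.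
  by rewrite subrr !mulr0 addr0.
by rewrite mup_geq // expr1 dvdp_XsubCl.
Qed.

(* A generic member [l^2 a + l b + c] of the pencil has simple roots, none of them a zero of [Z]. *)
Lemma pencil_size n a b c Z R :
    Z != 0 -> R != 0 -> (forall x, [|| a.[x] != 0, b.[x] != 0 | c.[x] != 0]) ->
    (forall l x, l ^+ 2 * a.[x] + l * b.[x] + c.[x] = 0 ->
       l ^+ 2 * a^`().[x] + l * b^`().[x] + c^`().[x] = 0 -> R.[x] = 0) ->
    (forall l ss, uniq ss ->
       (forall x, x \in ss -> Z.[x] != 0 /\ l ^+ 2 * a.[x] + l * b.[x] + c.[x] = 0) ->
       (size ss <= n)%N) ->
  [/\ (size a <= n.+1)%N, (size b <= n.+1)%N & (size c <= n.+1)%N].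
Proof.
(* The factor ['X] excludes 0 as a root of a generic member, so that such a member is not the zero
   polynomial. *)
move=> Z0 R0 nz HR H; pose Z' := 'X * Z * R.
have Z'0 : Z' != 0 by rewrite !mulf_neq0 // polyX_eq0.
have [rs ers] := closed_field_poly_normal Z'.
pose q x := Poly [:: c.[x]; b.[x]; a.[x]].
have qE x l : (q x).[l] = l ^+ 2 * a.[x] + l * b.[x] + c.[x].
  by rewrite /q horner_Poly /=; ring.
have q0 x : q x != 0.
  apply/negP => /eqP q0; have qk k := congr1 (fun p : {poly C} => p`_k) q0.
  by move: (qk 0%N) (qk 1%N) (qk 2%N) (nz x); rewrite !coef_Poly !coef0 /= => -> -> ->; rewrite eqxx.
(* [L.[l]] is nonzero exactly when no root of [Z'] is a zero of the member at l. *)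
pose L := \prod_(x <- rs) q x.
have L0 : L != 0 by rewrite prodf_seq_neq0; apply/allP => x _; rewrite q0.
pose Phi l := l ^+ 2 *: a + l *: b + c.
have PhiE l x : (Phi l).[x] = l ^+ 2 * a.[x] + l * b.[x] + c.[x].
  by rewrite /Phi !(hornerD, hornerZ).
have sPhi l : L.[l] != 0 -> (size (Phi l) <= n.+1)%N.
  move=> Ll.
  have gen x : (Phi l).[x] = 0 -> Z'.[x] != 0.
    move=> px; apply: contraNneq Ll => zx; rewrite /L horner_prod.
    have xrs : x \in rs.
      by move/rootP: zx; rewrite ers rootZ ?lead_coef_eq0 // root_prod_XsubC.
    by rewrite (big_rem x) //= qE -PhiE px mul0r.
  have Phi0 : Phi l != 0.
    apply/eqP => P0; have := gen 0; rewrite P0 horner0 => /(_ erefl).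
    by rewrite /Z' !hornerM hornerX !mul0r eqxx.
  have [ss ess] := closed_field_poly_normal (Phi l).
  have lP : lead_coef (Phi l) != 0 by rewrite lead_coef_eq0.
  have nZ' x : (Phi l).[x] = 0 -> Z.[x] != 0 /\ R.[x] != 0.
    by move/gen; rewrite /Z' !hornerM !mulf_eq0 !negb_or => /andP[/andP[_ ->] ->].
  rewrite ess size_scale // size_prod_XsubC ltnS; apply: (H l) => [|x xs].
    apply: (uniq_roots_generic ess) => // x px; have [_] := nZ' _ px.
    apply: contraNneq => dx; apply/eqP/(HR l x); first by rewrite -PhiE.
    by rewrite -dx /Phi !derivD !derivZ !(hornerD, hornerZ).
  have px : (Phi l).[x] = 0 by apply/rootP; rewrite ess rootZ // root_prod_XsubC.
  by rewrite -PhiE px; split=> //; case: (nZ' _ px).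
(* A coefficient of the member beyond degree n is quadratic in l and vanishes for generic l, hence
   identically in l. *)
have hk k : (n < k)%N -> [/\ a`_k = 0, b`_k = 0 & c`_k = 0].
  move=> nk; have /polyP P0 : Poly [:: c`_k; b`_k; a`_k] = 0.
    apply: (poly_eq0_generic L0) => l /sPhi sl; rewrite horner_Poly /=.
    have := nth_default 0 (leq_trans sl nk); rewrite /Phi !coefD !coefZ => e0; rewrite -[RHS]e0; ring.
  by split; [have := P0 2%N|have := P0 1%N|have := P0 0%N]; rewrite coef_Poly coef0.
by split; apply/leq_sizeP => k /hk[].
Qed.

(* If the resultant [Res] of [a l^2 + b l + c] and its derivative in [x] vanished,
   [N = a Del' - 2 a' Del] would satisfy [N^2 = 4 Del w^2], and the discriminant
   [Del] would have even multiplicity at [e]. *)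
Lemma quadratic_pencil_size a b c Z e :
    Z != 0 -> (forall x, [|| a.[x] != 0, b.[x] != 0 | c.[x] != 0]) ->
    b ^+ 2 - (a * c) *+ 4 != 0 -> odd (mup e (b ^+ 2 - (a * c) *+ 4)) ->
    (forall l ss, uniq ss ->
       (forall x, x \in ss -> Z.[x] != 0 /\ l ^+ 2 * a.[x] + l * b.[x] + c.[x] = 0) ->
       (size ss <= 2)%N) ->
  [/\ (size a <= 3)%N, (size b <= 3)%N & (size c <= 3)%N].
Proof.
set Del := b ^+ 2 - _ => Z0 nz D0 oD H.
pose w := a * b^`() - a^`() * b; pose z := a * c^`() - a^`() * c.
pose Res := z ^+ 2 - w * (b * c^`() - b^`() * c).
have n40 : (4 : C) != 0 by rewrite pnatr_eq0.
have a0 : a != 0.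
  apply: contraL oD => /eqP a0; rewrite /Del a0 mul0r mul0rn subr0 mup_sqr //.
  by move: D0; rewrite /Del a0 mul0r mul0rn subr0 expf_eq0.
have Res0 : Res != 0.
  apply/negP => /eqP R0; pose N := a * Del^`() - (a^`() * Del) *+ 2.
  have eN : N ^+ 2 = (Del * w ^+ 2) *+ 4.
    rewrite -[RHS]addr0 -(mulr0 (a ^+ 2 *+ 16)) -R0 /N /Res /z /w /Del.
    by rewrite derivB derivMn expr2 !derivM; ring.
  have w0 : w = 0.
    apply/eqP; apply: contraLR oD => w0.
    have N0 : N != 0.
      apply: contraNneq w0 => N0; move/eqP: eN; rewrite N0 expr0n /= eq_sym -scaler_nat scaler_eq0 (negPf n40) /=.
      by rewrite mulf_eq0 (negPf D0) expf_eq0.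
    have := mup_sqr e N0; rewrite eN -scaler_nat mupZ // mupM ?expf_neq0 // oddD mup_sqr // addbF.
    by move=> ->.
  move: eN; rewrite w0 expr0n mulr0 mul0rn => /eqP; rewrite expf_eq0 /= subr_eq0 => /eqP eN.
  have [||k ek] := @wronskian_eq0 Del (a ^+ 2); first by rewrite expf_neq0.
    by rewrite expr2 derivM mulrA [Del^`() * a]mulrC eN; ring.
  have k0 : k != 0 by apply: contraNneq D0 => k0; rewrite ek k0 scale0r.
  by move: oD; rewrite ek mupZ // mup_sqr.
apply: (pencil_size Z0 Res0 nz _ H) => l x px dx.
have ec : c.[x] = - (l ^+ 2 * a.[x] + l * b.[x]) by apply/eqP; rewrite -addr_eq0 addrC px.
have ec' : c^`().[x] = - (l ^+ 2 * a^`().[x] + l * b^`().[x]).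
  by apply/eqP; rewrite -addr_eq0 addrC dx.
by rewrite /Res /z /w !(hornerD, hornerN, hornerM, horner_exp) ec ec'; ring.
Qed.

(** Eliminating y from A + B y = l D gives the pencil D^2 l^2 - 2 A D l + A^2 - B^2 f, of
    discriminant 4 f (D B)^2. Freed of its common factor it has coefficients of degree at most 2,
    hence a discriminant of degree at most 4. But each root of f, being simple, has odd multiplicity
    in that discriminant, and f has at least five roots. *)
Lemma curve_function_even f A B D Z :
    separable_poly f -> (5 < size f)%N -> D != 0 -> Z != 0 ->
    (forall l (s : seq (C * C)), uniq s ->
       (forall P, P \in s -> [/\ Z.[P.1] != 0, P.2 ^+ 2 = f.[P.1] &
          A.[P.1] + B.[P.1] * P.2 = l * D.[P.1]]) -> (size s <= 2)%N) ->
  B = 0.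
Proof.
move=> sf f5 D0 Z0 H; apply/eqP; apply/negPn/negP => B0.
have f0 : f != 0 := separable_poly_neq0 sf.
have [|E [a [b [c [E0 ea eb ec nz]]]]] :=
  @common_zeros (D ^+ 2) (- (A * D) *+ 2) (A ^+ 2 - B ^+ 2 * f).
  by rewrite expf_neq0.
have eD : E ^+ 2 * (b ^+ 2 - (a * c) *+ 4) = 4 *: (f * (D * B) ^+ 2).
  have -> : E ^+ 2 * (b ^+ 2 - (a * c) *+ 4) = (E * b) ^+ 2 - ((E * a) * (E * c)) *+ 4 by ring.
  by rewrite -ea -eb -ec scaler_nat; ring.
have n4 : (4 : C) != 0 by rewrite pnatr_eq0.
have rhs0 : 4 *: (f * (D * B) ^+ 2) != 0.
  by rewrite scaler_eq0 negb_or n4 mulf_neq0 ?expf_neq0 ?mulf_neq0.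
have Del0 : b ^+ 2 - (a * c) *+ 4 != 0.
  by apply: contraNneq rhs0 => e; rewrite -eD e mulr0.
have oD e : root f e -> odd (mup e (b ^+ 2 - (a * c) *+ 4)).
  move=> re; have := congr1 (fun p => odd (mup e p)) eD.
  rewrite mupM ?expf_neq0 // oddD mup_sqr // addFb mupZ // => ->.
  rewrite mupM ?expf_neq0 ?mulf_neq0 // oddD mup_sqr ?mulf_neq0 //.
  by rewrite (mup_separable sf re).
have [rs [urs srs rsf]] := separable_roots sf.
have [e re] : exists e, root f e.
  by case: rs srs rsf {urs} => [|e rs] srs rsf; [rewrite srs in f5|exists e; apply: rsf; rewrite inE eqxx].
have [||sa sb sc] := @quadratic_pencil_size a b c (Z * (D * B)) e _ nz Del0 (oD e re).
- by rewrite !mulf_neq0.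
(* A root of the member lifts to the point of the curve found by solving A + B y = l D for y. *)
- move=> l ss us hx; pose g x := (x, (l * D.[x] - A.[x]) / B.[x]).
  rewrite -(size_map g); apply: (H l); first by rewrite map_inj_uniq // => x x' [].
  move=> P /mapP[x xs ->] /=; have [+ h] := hx x xs.
  rewrite !hornerM !mulf_eq0 !negb_or => /and3P[-> Dx Bx]; split=> //.
    have := congr1 (fun t => E.[x] * t) h; rewrite mulr0 !mulrDr ![E.[x] * (_ * _)]mulrCA -!hornerM -ea -eb -ec.
    rewrite !(hornerD, hornerN, hornerM, horner_exp, hornerMn) => e0.
    apply/eqP; rewrite exprMn exprVn -subr_eq0 -(mulfK (expf_neq0 2 Bx) f.[x]) -mulrBl mulf_eq0.
    apply/orP; left; apply/eqP; rewrite -e0; ring.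
  by rewrite mulrC divfK // addrC subrK.
have := max_poly_roots Del0 _ urs.
have -> : all (root (b ^+ 2 - (a * c) *+ 4)) rs.
  apply/allP => e' /rsf/oD; apply: contraTT => h; by rewrite mupNroot.
move=> /(_ isT) h; move: f5; rewrite srs ltnS ltnNge => /negP; apply.
rewrite -ltnS; apply: leq_trans h _.
rewrite (leq_trans (size_polyD _ _)) // geq_max size_polyN -scaler_nat size_scale //.
have sM (p q : {poly C}) : (size p <= 3)%N -> (size q <= 3)%N -> (size (p * q)%R <= 5)%N.
  move=> hp hq; apply: leq_trans (size_polyMleq _ _) _.
  by rewrite -[5%N]/(3 + 3).-1 -!subn1 leq_sub2r // leq_add.
by rewrite expr2 !sM.
Qed.

(** Let p / q be A / D in lowest terms. The pencil p - l q generically has at most one root, and it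
    is simple, so p and q have degree at most 1. The Wronskian takes the place of the resultant;
    were it zero, A / D would be constant. *)
Lemma mobius_of_injective A D Z :
    D != 0 -> Z != 0 ->
    (forall x1 x2, Z.[x1] != 0 -> Z.[x2] != 0 ->
       A.[x1] * D.[x2] = A.[x2] * D.[x1] -> x1 = x2) ->
  exists E (a b c d : C), [/\ E != 0, a * d - b * c != 0,
    A = E * (a *: 'X + b%:P) & D = E * (c *: 'X + d%:P)].
Proof.
move=> D0 Z0 H.
have [E [q [p [r [E0 eD eA er nz]]]]] := @common_zeros D A 0 D0.
have {er} r0 : r = 0 by move/eqP: er; rewrite eq_sym mulf_eq0 (negPf E0) => /eqP.
have q0 : q != 0 by apply: contraNneq D0 => e; rewrite eD e mulr0.
pose W := p^`() * q - p * q^`().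
have W0 : W != 0.
  rewrite subr_eq0; apply/negP => /eqP /(wronskian_eq0 q0)[k ep].
  have [x1 h1] := generic_point Z0.
  have [|x2] := @generic_point (Z * ('X - x1%:P)); first by rewrite mulf_neq0 ?polyXsubC_eq0.
  rewrite hornerM hornerXsubC mulf_eq0 negb_or subr_eq0 => /andP[h2 /eqP]; case.
  by apply: H => //; rewrite eA eD ep !hornerM !hornerZ; ring.
have [||||_ sq sp] := @pencil_size 1 0 (- q) p (Z * E) W _ W0.
- by rewrite mulf_neq0.
- by move=> x; have := nz x; rewrite r0 horner0 hornerN oppr_eq0 eqxx orbF.
- move=> l x; rewrite deriv0 derivN !hornerN horner0 !mulr0 !add0r !mulrN ![- _ + _]addrC.
  move=> /eqP; rewrite subr_eq0 => /eqP ep /eqP; rewrite subr_eq0 => /eqP ep'.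
  by rewrite /W hornerD hornerN !hornerM ep ep'; ring.
- move=> l [|x1 [|x2 ss]] // us hs.
  have h x : x \in [:: x1, x2 & ss] -> Z.[x] != 0 /\ p.[x] = l * q.[x].
    move=> /hs[]; rewrite hornerM mulf_eq0 negb_or => /andP[-> _].
    by rewrite horner0 hornerN mulr0 add0r mulrN addrC => /eqP; rewrite subr_eq0 => /eqP ->.
  have [|z1 e1] := h x1; first by rewrite inE eqxx.
  have [|z2 e2] := h x2; first by rewrite !inE eqxx orbT.
  suff e12 : x1 = x2 by move: us; rewrite /= inE e12 eqxx.
  by apply: H => //; rewrite eA eD !hornerM e1 e2; ring.
have {}sp := leq_sizeP _ _ sp; have {}sq : forall k, (1 < k)%N -> q`_k = 0.
  by move=> k k1; apply/eqP; rewrite -oppr_eq0 -coefN (leq_sizeP _ _ sq).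
have lin (g : {poly C}) : (forall k, (1 < k)%N -> g`_k = 0) -> g = g`_1 *: 'X + (g`_0)%:P.
  move=> hg; apply/polyP => -[|[|k]]; rewrite !(coefD, coefZ, coefX, coefC) /= ?mulr0 ?mulr1 ?add0r ?addr0 //.
  by rewrite hg.
have ep := lin p sp; have eq := lin q sq.
exists E, p`_1, p`_0, q`_1, q`_0; rewrite -ep -eq; split => //.
apply: contraNneq W0 => e; rewrite /W ep eq !derivD !derivZ !derivX !derivC.
rewrite -!mul_polyC !addr0 !mulr1.
have -> : (p`_1)%:P * ((q`_1)%:P * 'X + (q`_0)%:P) - ((p`_1)%:P * 'X + (p`_0)%:P) * (q`_1)%:P
  = (p`_1)%:P * (q`_0)%:P - (p`_0)%:P * (q`_1)%:P by ring.
by rewrite -!polyCM -polyCB e.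
Qed.

End PolynomialFibres.

(** * Binary octic forms under linear substitutions *)

Section OcticForms.

Variable C : numClosedFieldType.
Implicit Types (f g : {poly C}) (M N : 'M[C]_2) (s t x : C).

(* A polynomial of degree at most 8 stands for the binary octic form
   [hev f s t = t^8 f(s/t)]; a polynomial of degree 7 has a root at infinity. *)
Definition hev f s t := \sum_(k < 9) f`_k * s ^+ k * t ^+ (8 - k).

Definition lin (a b : C) : {poly C} := a *: 'X + b%:P.

Definition act M f : {poly C} :=
  \sum_(k < 9) f`_k *: (lin (M 0 0) (M 0 1) ^+ k * lin (M 1 0) (M 1 1) ^+ (8 - k)).

Lemma horner_lin a b x : (lin a b).[x] = a * x + b.
Proof. by rewrite !hornerE. Qed.

Lemma size_lin a b : (size (lin a b) <= 2)%N.
Proof.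
rewrite (leq_trans (size_polyD _ _)) // geq_max (leq_trans (size_scale_leq _ _)) ?size_polyX //.
by rewrite (leq_trans (size_polyC_leq1 _)).
Qed.

Lemma size_lin_exp a b k : (size (lin a b ^+ k) <= k.+1)%N.
Proof.
apply: leq_trans (size_poly_exp_leq _ _) _; rewrite ltnS -{2}[k]mul1n leq_mul2r.
by have := size_lin a b; case: size => [|[|[|n]]] //= _; rewrite orbT.
Qed.

Lemma size_act M f : (size (act M f) <= 9)%N.
Proof.
apply/(leq_trans (size_sum _ _ _))/bigmax_leqP => k _.
apply: leq_trans (size_scale_leq _ _) _; apply: leq_trans (size_polyMleq _ _) _.
rewrite -subn1 leq_subLR; apply: leq_trans (leq_add (size_lin_exp _ _ _) (size_lin_exp _ _ _)) _.
by rewrite addSn addnS subnKC // -ltnS.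
Qed.

Lemma horner_hev f x : (size f <= 9)%N -> f.[x] = hev f x 1.
Proof.
move=> f9; rewrite (horner_coef_wide _ f9); apply: eq_bigr => k _.
by rewrite expr1n mulr1.
Qed.

Lemma hevZ f s t c : hev f (c * s) (c * t) = c ^+ 8 * hev f s t.
Proof.
rewrite mulr_sumr; apply: eq_bigr => k _.
have -> : c ^+ 8 = c ^+ k * c ^+ (8 - k) by rewrite -exprD subnKC // -ltnS.
by rewrite !exprMn; ring.
Qed.

Lemma hev_dehom f s t : (size f <= 9)%N -> t != 0 -> hev f s t = t ^+ 8 * f.[s / t].
Proof. by move=> f9 t0; rewrite horner_hev // -hevZ mulr1 mulrCA divff // mulr1. Qed.

(** For t nonzero, homogeneity reduces this to the affine identity; both sides are polynomials in t,
    so it extends to t = 0. *)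
Lemma hev_act M f s t :
  hev (act M f) s t = hev f (M 0 0 * s + M 0 1 * t) (M 1 0 * s + M 1 1 * t).
Proof.
have gen x : (act M f).[x] = hev f (M 0 0 * x + M 0 1) (M 1 0 * x + M 1 1).
  rewrite horner_sum; apply: eq_bigr => k _.
  by rewrite hornerZ hornerM !horner_exp !horner_lin mulrA.
pose p : {poly C} := \sum_(k < 9) ((act M f)`_k * s ^+ k) *: 'X ^+ (8 - k).
pose q : {poly C} := \sum_(k < 9) f`_k *: (lin (M 0 1) (M 0 0 * s) ^+ k * lin (M 1 1) (M 1 0 * s) ^+ (8 - k)).
have pE y : p.[y] = hev (act M f) s y.
  by rewrite horner_sum; apply: eq_bigr => k _; rewrite hornerZ hornerXn.
have qE y : q.[y] = hev f (M 0 0 * s + M 0 1 * y) (M 1 0 * s + M 1 1 * y).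
  rewrite horner_sum; apply: eq_bigr => k _.
  by rewrite hornerZ hornerM !horner_exp !horner_lin mulrA ![_ * y + _]addrC.
rewrite -pE -qE; congr (_.[_]); apply/eqP; rewrite -subr_eq0; apply/eqP.
apply: (@poly_eq0_generic _ 'X) => [|y]; rewrite ?polyX_eq0 // hornerX => y0.
rewrite hornerD hornerN pE qE hev_dehom ?size_act // gen -hevZ.
by rewrite !mulrDr !(mulrCA y) divff // !mulr1 [y * _]mulrC [y * _]mulrC subrr.
Qed.

Lemma hev_inj f g : (size f <= 9)%N -> (size g <= 9)%N ->
  (forall x, hev f x 1 = hev g x 1) -> f = g.
Proof.
move=> f9 g9 H; apply/eqP; rewrite -subr_eq0; apply/eqP.
apply: (@poly_eq0_generic _ 1) => [|x _]; first exact: oner_neq0.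
by rewrite hornerD hornerN !horner_hev // H subrr.
Qed.

Lemma mul2E M N i j : (M *m N) i j = M i 0 * N 0 j + M i 1 * N 1 j.
Proof. by rewrite mxE big_ord_recl big_ord1; congr (_ + M i _ * N _ j); apply/val_inj. Qed.

Lemma act_comp M N f : act M (act N f) = act (N *m M) f.
Proof.
apply: hev_inj; rewrite ?size_act // => x; rewrite !hev_act !mul2E.
by congr (hev f _ _); ring.
Qed.

Lemma act1 f : (size f <= 9)%N -> act 1%:M f = f.
Proof.
move=> f9; apply: hev_inj; rewrite ?size_act // => x.
by rewrite hev_act !mxE /= !mul1r !mul0r addr0 add0r.
Qed.

Lemma hev_scale c f s t : hev (c *: f) s t = c * hev f s t.
Proof. by rewrite mulr_sumr; apply: eq_bigr => k _; rewrite coefZ !mulrA. Qed.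

Lemma actZ M c f : act M (c *: f) = c *: act M f.
Proof.
by rewrite scaler_sumr; apply: eq_bigr => k _; rewrite coefZ scalerA.
Qed.

Lemma act_scale M c f : act (c *: M) f = c ^+ 8 *: act M f.
Proof.
apply: hev_inj; rewrite ?size_act ?(leq_trans (size_scale_leq _ _)) ?size_act // => x.
by rewrite hev_scale !hev_act -hevZ !mxE; congr (hev f _ _); ring.
Qed.

End OcticForms.

(** * Injective rational maps between curves y^2 = f(x) *)

Section CurveMaps.

Variable C : numClosedFieldType.
Implicit Types (f g : {poly C}) (x y : C).

Definition octic f := separable_poly f && (7 < size f <= 9)%N.

Lemma size_sqr_eq (c : C) (s : seq C) :
  uniq s -> (forall y, y \in s -> y ^+ 2 = c) -> (size s <= 2)%N.
Proof.
move=> us hs; pose p : {poly C} := 'X ^+ 2 - c%:P.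
have sp : size p = 3%N by rewrite size_XnsubC.
rewrite -ltnS -sp max_poly_roots // -?size_poly_eq0 ?sp //.
by apply/allP => y /hs e; rewrite rootE hornerD hornerN hornerC hornerXn e subrr.
Qed.

(** The first coordinate takes each value at most twice, because over it the second coordinate is
    one of two square roots and the map is injective. So B = 0 and the first coordinate is a Moebius
    map of x. Changing the sign of y then gives A' = 0, and multiplicities of roots show that
    [act M f'] is a constant multiple of f. *)
Lemma curve_map_mobius f f' (A B A' B' D Z : {poly C}) :
    octic f -> D != 0 -> Z != 0 ->
    (forall x y, Z.[x] != 0 -> D.[x] != 0 -> y ^+ 2 = f.[x] ->
       ((A'.[x] + B'.[x] * y) / D.[x]) ^+ 2 = f'.[(A.[x] + B.[x] * y) / D.[x]]) ->
    (size f' <= 9)%N ->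
    (forall x1 y1 x2 y2, Z.[x1] != 0 -> D.[x1] != 0 -> y1 ^+ 2 = f.[x1] ->
       Z.[x2] != 0 -> D.[x2] != 0 -> y2 ^+ 2 = f.[x2] ->
       (A.[x1] + B.[x1] * y1) / D.[x1] = (A.[x2] + B.[x2] * y2) / D.[x2] ->
       (A'.[x1] + B'.[x1] * y1) / D.[x1] = (A'.[x2] + B'.[x2] * y2) / D.[x2] ->
       x1 = x2 /\ y1 = y2) ->
  exists (M : 'M[C]_2) (e : C), [/\ M 0 0 * M 1 1 - M 0 1 * M 1 0 != 0, e != 0,
    act M f' = e ^+ 2 *: f &
    exists2 W : {poly C}, W != 0 & forall x y, W.[x] != 0 -> y ^+ 2 = f.[x] ->
      [/\ M 1 0 * x + M 1 1 != 0,
        (A.[x] + B.[x] * y) / D.[x] = (M 0 0 * x + M 0 1) / (M 1 0 * x + M 1 1) &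
        (A'.[x] + B'.[x] * y) / D.[x] = e * y / (M 1 0 * x + M 1 1) ^+ 4]].
Proof.
move=> /andP[sf /andP[f7 f9]] D0 Z0 Hc f'9 Hi.
have f0 : f != 0 := separable_poly_neq0 sf.
have fib l (s : seq (C * C)) : uniq s ->
   (forall P : C * C, P \in s -> [/\ (Z * D).[P.1] != 0, P.2 ^+ 2 = f.[P.1] &
          A.[P.1] + B.[P.1] * P.2 = l * D.[P.1]]) -> (size s <= 2)%N.
  move=> us hs; pose v (P : C * C) := (A'.[P.1] + B'.[P.1] * P.2) / D.[P.1].
  have hu P : P \in s -> [/\ Z.[P.1] != 0, D.[P.1] != 0, P.2 ^+ 2 = f.[P.1] &
     (A.[P.1] + B.[P.1] * P.2) / D.[P.1] = l].
    case/hs; rewrite hornerM mulf_eq0 negb_or => /andP[z d] e ->; split => //.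
    by rewrite mulfK.
  rewrite -(size_map v); apply: (@size_sqr_eq f'.[l]).
    rewrite map_inj_in_uniq // => -[x1 y1] [x2 y2] /hu /= [z1 d1 e1 u1] /hu /= [z2 d2 e2 u2] ev.
    by case: (Hi x1 y1 x2 y2) => //; [rewrite u1 u2|move=> -> ->].
  move=> w /mapP[[x y] /hu /= [z d e u] ->].
  by rewrite /v /= Hc // u.
have ZD0 : Z * D != 0 by rewrite mulf_neq0.
have [B0 [E [a [b [c [d [E0 det0 eA eD]]]]]]] : B = 0 /\
    exists E (a b c d : C), [/\ E != 0, a * d - b * c != 0,
    A = E * (a *: 'X + b%:P) & D = E * (c *: 'X + d%:P)].
  have B0 : B = 0 by apply: (curve_function_even sf _ D0 ZD0 fib); apply: leq_trans f7.
  split=> //; apply: (@mobius_of_injective _ _ _ (Z * D * f)) => //; first by rewrite mulf_neq0.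
  move=> x1 x2; rewrite ![(_ * f).[_]]hornerM !mulf_eq0 !negb_or => /andP[z1 n1] /andP[z2 n2] e.
  apply/eqP/negP => /negP ne.
  (* If x1 and x2 had the same image, the two points over x1 and one over x2 would make a fibre of
     three points. *)
  pose y1 := sqrtC f.[x1]; have y10 : y1 != 0 by rewrite sqrtC_eq0.
  have := fib (A.[x1] / D.[x1]) [:: (x1, y1); (x1, - y1); (x2, sqrtC f.[x2])].
  rewrite /= !inE !xpair_eqE eqxx (negPf ne) /= orbF eq_sym eqNr (negPf y10) => /(_ isT).
  suff h : forall P : C * C, P \in [:: (x1, y1); (x1, - y1); (x2, sqrtC f.[x2])] ->
    [/\ (Z * D).[P.1] != 0, P.2 ^+ 2 = f.[P.1] & A.[P.1] + B.[P.1] * P.2 = A.[x1] / D.[x1] * D.[P.1]] by move/(_ h).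
  move: (z1) (z2); rewrite !hornerM !mulf_eq0 !negb_or => /andP[_ d1] /andP[_ d2].
  move=> P; rewrite !inE => /or3P[] /eqP -> /=; rewrite ?z1 ?z2 ?sqrrN ?sqrtCK B0 horner0 mul0r addr0 ?divfK //.
  by split=> //; rewrite mulrAC e mulfK.
pose M : 'M[C]_2 := \matrix_(i, j) (if i == 0 then if j == 0 then a else b else if j == 0 then c else d).
have [M00 M01 M10 M11] : [/\ M 0 0 = a, M 0 1 = b, M 1 0 = c & M 1 1 = d] by rewrite !mxE.
pose q := lin c d; pose G := act M f'.
have qE x : q.[x] = c * x + d by rewrite horner_lin.
have q0 : q != 0.
  apply: contraNneq D0 => q0; rewrite eD; apply/eqP.
  by rewrite -[_ + _]/q q0 mulr0.
pose W := Z * D * f.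
have W0 : W != 0 by rewrite mulf_neq0.
have WP x : W.[x] != 0 -> [/\ Z.[x] != 0, D.[x] != 0, f.[x] != 0, E.[x] != 0 & c * x + d != 0].
  rewrite !hornerM !mulf_eq0 !negb_or => /andP[/andP[-> hD] ->]; rewrite hD.
  by move: hD; rewrite eD hornerM !hornerE mulf_eq0 negb_or => /andP[].
have uE x y : W.[x] != 0 -> (A.[x] + B.[x] * y) / D.[x] = (a * x + b) / (c * x + d).
  move/WP => [_ hD _ hE hq]; rewrite B0 horner0 mul0r addr0 eA eD !hornerM !hornerE.
  by rewrite invfM mulrACA divff // mul1r.
have GE x : c * x + d != 0 -> G.[x] = (c * x + d) ^+ 8 * f'.[(a * x + b) / (c * x + d)].
  move=> hq; rewrite horner_hev ?size_act // hev_act M00 M01 M10 M11 !mulr1.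
  by rewrite hev_dehom.
have key x y : W.[x] != 0 -> y ^+ 2 = f.[x] ->
    (A'.[x] + B'.[x] * y) ^+ 2 * (c * x + d) ^+ 8 = D.[x] ^+ 2 * G.[x].
  move=> hW hy; have [hZ hD hf hE hq] := WP _ hW.
  rewrite GE // -(uE x y hW) -Hc // expr_div_n; field; exact: hD.
(* The right-hand side of [key] does not involve y; the difference of the left-hand sides at y and
   -y is a multiple of A' B' y. *)
have AB x : W.[x] != 0 -> (A' * B').[x] = 0.
  move=> hW; have [hZ hD hf hE hq] := WP _ hW.
  have yf := sqrtCK f.[x]; have := key x _ hW yf; rewrite -sqrrN in yf.
  rewrite -(key x _ hW yf) => /(mulIf (expf_neq0 8 hq)) /eqP; rewrite -subr_eq0.
  have -> : (A'.[x] + B'.[x] * sqrtC f.[x]) ^+ 2 - (A'.[x] + B'.[x] * - sqrtC f.[x]) ^+ 2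
    = 4 * (A'.[x] * B'.[x] * sqrtC f.[x]) by ring.
  by rewrite !mulf_eq0 pnatr_eq0 sqrtC_eq0 (negPf hf) orbF /= -mulf_eq0 -hornerM => /eqP.
have B'0 : B' != 0.
  apply/negP => /eqP B'0; have [x hW] := generic_point W0.
  have [hZ hD hf hE hq] := WP _ hW.
  have yf := sqrtCK f.[x]; have yf' := yf; rewrite -sqrrN in yf'.
  case: (Hi x _ x _ hZ hD yf hZ hD yf').
  - by rewrite B0 !horner0 !mul0r.
  - by rewrite B'0 !horner0 !mul0r.
  by move=> _ /eqP; rewrite eq_sym eqNr sqrtC_eq0 (negPf hf).
have A'0 : A' = 0.
  by have /eqP := poly_eq0_generic W0 AB; rewrite mulf_eq0 (negPf B'0) orbF => /eqP.
have eG : f * (B' * q ^+ 4) ^+ 2 = D ^+ 2 * G.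
  apply/eqP; rewrite -subr_eq0; apply/eqP; apply: (poly_eq0_generic W0) => x hW.
  have := key x _ hW (sqrtCK _); rewrite A'0 horner0 add0r exprMn sqrtCK => e.
  rewrite !(hornerD, hornerN, hornerM, horner_exp) -e !(hornerZ, hornerX, hornerC); ring.
have G0 : G != 0.
  have : f * (B' * q ^+ 4) ^+ 2 != 0 by rewrite mulf_neq0 // expf_neq0 // mulf_neq0 ?expf_neq0.
  by apply: contraNneq => G0; rewrite eG G0 mulr0.
have Bq0 : B' * q ^+ 4 != 0 by rewrite mulf_neq0 ?expf_neq0.
(* The other factors in [eG] are squares, so a simple root of f has odd multiplicity in G. Hence f
   divides G. *)
have oddG e : root f e -> odd (mup e G).
  move=> re; have := congr1 (fun p => odd (mup e p)) eG.
  by rewrite mupM ?expf_neq0 // [in RHS]mupM ?expf_neq0 // !oddD !mup_sqr // (mup_separable sf re) addbF addFb => <-.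
have [l el] : exists l, G = l * f.
  apply/dvdpP; have [rs [urs srs hrs]] := separable_roots sf; have rrs := introT allP hrs.
  rewrite (all_roots_prod_XsubC srs rrs) ?uniq_rootsE // dvdpZl ?lead_coef_eq0 //.
  apply: uniq_roots_dvdp; rewrite ?uniq_rootsE //; apply/allP => e /hrs re.
  by apply: contraTT (oddG e re) => h; rewrite mupNroot.
have l0 : l != 0 by apply: contraNneq G0 => l0; rewrite el l0 mul0r.
have el2 : (B' * q ^+ 4) ^+ 2 = D ^+ 2 * l.
  by apply: (mulfI f0); rewrite eG el; ring.
have sl : (size l <= 2)%N.
  have := size_act M f'; rewrite -/G el size_mul // -(ltn_predK f7) addnS /= => h.
  by rewrite -(leq_add2r 7) (leq_trans _ h) // leq_add2l -ltnS (ltn_predK f7).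
(* By [el2] every root of l has even multiplicity, which a polynomial of degree at most 1 allows
   only if it is constant. *)
have l1 : size l == 1%N.
  apply/negPn/negP => /closed_rootP[e re].
  have := congr1 (fun p => odd (mup e p)) el2; rewrite mup_sqr // mupM ?expf_neq0 // oddD mup_sqr //.
  suff -> : mup e l = 1%N by [].
  apply/eqP; rewrite eqn_leq mup_geq // expr1 dvdp_XsubCl re andbT mup_leq //.
  by apply/negP => /(dvdp_leq l0); rewrite size_exp_XsubC ltnNge sl.
have {l0 l1 sl} [k k0 lk] : exists2 k, k != 0 & l = k%:P.
  by have /size_poly1P[k k0 lk] := l1; exists k.
pose e0 := sqrtC k.
(* Polynomials form a domain, so one choice of sign is valid for all x at once. *)
have : (B' * q ^+ 4 - e0 *: D) * (B' * q ^+ 4 + e0 *: D) = 0.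
  rewrite -subr_sqr el2 lk -mul_polyC exprMn -polyC_exp sqrtCK; ring.
move/eqP; rewrite mulf_eq0 => hh.
have [e e2 eB] : exists2 e, e ^+ 2 = k & B' * q ^+ 4 = e *: D.
  case/orP: hh; first by rewrite subr_eq0 => /eqP h; exists e0; rewrite ?sqrtCK.
  by rewrite addr_eq0 => /eqP h; exists (- e0); rewrite ?sqrrN ?sqrtCK // scaleNr.
exists M, e; rewrite M00 M01 M10 M11; split=> //.
- by apply: contraNneq k0 => e00; rewrite -e2 e00 expr0n.
- by rewrite -/G el lk e2 mul_polyC.
exists W => // x y hW hy; have [hZ hD hf hE hq] := WP _ hW; split=> //; first exact: uE.
rewrite A'0 horner0 add0r; have := congr1 (fun p => p.[x]) eB.
rewrite hornerM hornerZ horner_exp qE => h.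
by apply/eqP; rewrite eqr_div ?expf_neq0 // mulrAC h; apply/eqP; ring.
Qed.

End CurveMaps.

(** * Equivalence of octics *)

Section OcticEquivalence.

Variable C : numClosedFieldType.
Implicit Types (f g h : {poly C}) (M N A B P : 'M[C]_2) (s t x k : C).

Definition mx2 (a b c d : C) : 'M[C]_2 :=
  \matrix_(i, j) if i == 0 then if j == 0 then a else b
                 else if j == 0 then c else d.

Lemma mx2_00 a b c d : mx2 a b c d 0 0 = a. Proof. by rewrite mxE. Qed.
Lemma mx2_01 a b c d : mx2 a b c d 0 1 = b. Proof. by rewrite mxE. Qed.
Lemma mx2_10 a b c d : mx2 a b c d 1 0 = c. Proof. by rewrite mxE. Qed.
Lemma mx2_11 a b c d : mx2 a b c d 1 1 = d. Proof. by rewrite mxE. Qed.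

Definition mx2_entries := (mx2_00, mx2_01, mx2_10, mx2_11).

Lemma eq_mx2 M N : M 0 0 = N 0 0 -> M 0 1 = N 0 1 -> M 1 0 = N 1 0 ->
  M 1 1 = N 1 1 -> M = N.
Proof.
move=> h00 h01 h10 h11; apply/matrixP => i j.
have ord2 (l : 'I_2) : l = 0 \/ l = 1.
  by case: l => -[|[|//]] h; [left|right]; apply/val_inj.
by case: (ord2 i) => ->; case: (ord2 j) => ->.
Qed.

Definition det2 M := M 0 0 * M 1 1 - M 0 1 * M 1 0.

Definition tr2 M := M 0 0 + M 1 1.

Definition adj2 M := mx2 (M 1 1) (- M 0 1) (- M 1 0) (M 0 0).

Lemma det2M M N : det2 (M *m N) = det2 M * det2 N.
Proof. by rewrite /det2 !mul2E; ring. Qed.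

Lemma det2_adj M : det2 (adj2 M) = det2 M.
Proof. by rewrite /det2 !mx2_entries; ring. Qed.

Lemma scale2E (c : C) M i j : (c *: M) i j = c * M i j.
Proof. by rewrite mxE. Qed.

Lemma scalar2E (c : C) : [/\ (c%:M : 'M[C]_2) 0 0 = c, (c%:M : 'M[C]_2) 0 1 = 0,
  (c%:M : 'M[C]_2) 1 0 = 0 & (c%:M : 'M[C]_2) 1 1 = c].
Proof. by rewrite !mxE. Qed.

Lemma det2Z (c : C) M : det2 (c *: M) = c ^+ 2 * det2 M.
Proof. by rewrite /det2 !scale2E; ring. Qed.

Lemma mul_adj2 M : M *m adj2 M = (det2 M)%:M.
Proof.
have [e1 e2 e3 e4] := scalar2E (det2 M).
by apply: eq_mx2; rewrite ?e1 ?e2 ?e3 ?e4 mul2E !mx2_entries /det2; ring.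
Qed.

Lemma adj_mul2 M : adj2 M *m M = (det2 M)%:M.
Proof.
have [e1 e2 e3 e4] := scalar2E (det2 M).
by apply: eq_mx2; rewrite ?e1 ?e2 ?e3 ?e4 mul2E !mx2_entries /det2; ring.
Qed.

Lemma act_scalar (c : C) f : (size f <= 9)%N -> act c%:M f = c ^+ 8 *: f.
Proof. by move=> f9; rewrite -(scalemx1 _ c) act_scale act1. Qed.

(** The factor k corresponds to a rescaling of y by a square root of k. *)
Definition equiv f g := exists M k, [/\ det2 M != 0, k != 0 & act M f = k *: g].

Lemma equiv_act M f : det2 M != 0 -> equiv f (act M f).
Proof. by move=> dM; exists M, 1; rewrite scale1r oner_neq0. Qed.

Lemma equiv_refl f : (size f <= 9)%N -> equiv f f.
Proof.
move=> f9; exists 1%:M, 1; rewrite act1 // scale1r oner_neq0; split=> //.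
by have [e1 e2 e3 e4] := scalar2E 1; rewrite /det2 e1 e2 e3 e4 mulr1 mulr0 subr0 oner_neq0.
Qed.

Lemma equiv_sym f g : (size f <= 9)%N -> equiv f g -> equiv g f.
Proof.
move=> f9 [M [k [dM k0 e]]]; exists (adj2 M), (det2 M ^+ 8 / k).
rewrite det2_adj mulf_neq0 ?invr_eq0 ?expf_neq0 //; split=> //.
have -> : g = k^-1 *: act M f by rewrite e scalerA mulVf // scale1r.
by rewrite actZ act_comp mul_adj2 act_scalar // scalerA mulrC.
Qed.

Lemma equiv_trans f g h : equiv f g -> equiv g h -> equiv f h.
Proof.
move=> [M [k [dM k0 e]]] [N [l [dN l0 e']]]; exists (M *m N), (k * l).
by rewrite det2M -act_comp e actZ e' scalerA !mulf_neq0.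
Qed.

Lemma equiv_scale f k : k != 0 -> (size f <= 9)%N -> equiv f (k *: f).
Proof.
move=> k0 f9; have [M [l [dM l0 e]]] := equiv_refl f9; exists M, (l / k).
by rewrite mulf_neq0 ?invr_eq0 // e scalerA divfK.
Qed.

(** Zeros are counted on the projective line, infinity included, because in this form separability
    is visibly preserved by substitutions. *)
Definition eight_roots f := exists r : 'I_8 -> C * C,
  (forall i, hev f (r i).1 (r i).2 = 0) /\
  forall i j, i != j -> (r i).1 * (r j).2 != (r j).1 * (r i).2.

Lemma hev0 f s : hev f s 0 = f`_8 * s ^+ 8.
Proof.
rewrite /hev (bigD1 ord_max) //= subnn expr0 mulr1 big1 ?addr0 // => k.
rewrite -val_eqE /= => kn; rewrite expr0n subn_eq0 leqNgt.
by rewrite ltn_neqAle kn -ltnS ltn_ord mulr0.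
Qed.

Lemma octic_size f : octic f -> (size f <= 9)%N.
Proof. by case/and3P. Qed.

Lemma octic_neq0 f : octic f -> f != 0.
Proof. by case/andP => /separable_poly_neq0. Qed.

Lemma octic_roots f : octic f -> exists rs : seq C,
  [/\ uniq rs, size f = (size rs).+1 & forall x, x \in rs -> root f x].
Proof. by case/andP => /separable_roots. Qed.

Lemma octic_root f : octic f -> exists x, root f x.
Proof.
move=> oF; have [[|x rs] [_ srs hrs]] := octic_roots oF; last by exists x; rewrite hrs ?inE ?eqxx.
by have /and3P[] := oF; rewrite srs.
Qed.

Lemma octic_eight_roots f : octic f -> eight_roots f.
Proof.
move=> oF; have [rs [urs srs hrs]] := octic_roots oF.
have [sf f7 f9] := and3P oF.
exists (fun i => if (i < size rs)%N then (rs`_i, 1) else (1, 0)); split.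
  move=> i; case: ltnP => h /=; first by rewrite -horner_hev //; apply/rootP/hrs/mem_nth.
  by rewrite hev0 nth_default ?mul0r // srs (leq_ltn_trans h).
move=> i j; rewrite -val_eqE /= => ij.
have r7 : (7 <= size rs)%N by rewrite -ltnS -srs.
have big (l : 'I_8) : (size rs <= l)%N -> l = 7%N :> nat.
  by move=> h; apply/eqP; rewrite eqn_leq -ltnS ltn_ord (leq_trans r7).
case: ltnP => hi; case: ltnP => hj /=; rewrite ?mulr1 ?mulr0 ?mul1r ?mul0r ?oner_neq0 //.
- by rewrite nth_uniq.
- by rewrite eq_sym oner_neq0.
- by case/eqP: ij; rewrite (big _ hi) (big _ hj).
Qed.

Lemma eight_roots_octic f : f != 0 -> (size f <= 9)%N -> eight_roots f -> octic f.
Proof.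
move=> f0 f9 [r [hr rr]].
pose I := enum [pred i | (r i).2 != 0].
pose rs := [seq (r i).1 / (r i).2 | i <- I].
have hI i : i \in I -> (r i).2 != 0 by rewrite mem_enum.
have uI : uniq I by exact: enum_uniq.
have urs : uniq rs.
  rewrite map_inj_in_uniq // => i j /hI hi /hI hj e.
  apply/eqP; apply: contraTT isT => /rr; case/eqP.
  by apply/eqP; rewrite -eqr_div // e.
have rrs : all (root f) rs.
  apply/allP => x /mapP[i /hI hi ->]; apply/rootP; have := hr i.
  by rewrite hev_dehom // => /eqP; rewrite mulf_eq0 expf_eq0 (negPf hi) => /eqP.
have srs := max_poly_roots f0 rrs urs.
suff [r7 sf] : (7 <= size rs)%N /\ (size f <= (size rs).+1)%N.
  have sfe : size f = (size rs).+1 by apply/eqP; rewrite eqn_leq sf.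
  rewrite /octic f9 sfe ltnS r7 !andbT.
  rewrite (all_roots_prod_XsubC sfe rrs) ?uniq_rootsE //.
  by rewrite (eqp_separable (eqp_scale _ _)) ?lead_coef_eq0 // separable_prod_XsubC.
rewrite size_map -cardE.
(* At most one of the eight zeros is at infinity; if there is one, the coefficient of degree 8
   vanishes and seven finite roots suffice. *)
case: (boolp.pselect (exists i, (r i).2 = 0)) => [[i0 ri0]|H].
  have -> : #|[pred i | (r i).2 != 0]| = 7%N.
    rewrite (eq_card (B := predC1 i0)) ?cardC1 ?card_ord // => i; rewrite !inE.
    have [->|ne] := eqVneq i i0; first by rewrite ri0 eqxx.
    by apply: contraNneq (rr _ _ ne) => ri; rewrite ri ri0 !mulr0.
  split=> //; move: f9; rewrite leq_eqVlt => /orP[/eqP f9|//].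
  have := hr i0; rewrite ri0 hev0 => /eqP; rewrite mulf_eq0 expf_eq0 /=.
  have -> : (f`_8 == 0) = false by rewrite -[8%N]/(9.-1) -f9 -lead_coefE lead_coef_eq0 (negPf f0).
  move=> /eqP r1.
  have [j ji] : exists j, j != i0 by case: (eqVneq i0 0) => [->|h]; [exists 1|exists 0; rewrite eq_sym].
  by have := rr _ _ ji; rewrite ri0 r1 mulr0 mul0r eqxx.
rewrite (eq_card (B := predT)) ?cardT ?size_enum_ord // => i; rewrite !inE.
by apply/negP => /eqP e; apply: H; exists i.
Qed.

Lemma octic_equiv f g : octic f -> (size g <= 9)%N -> equiv f g -> octic g.
Proof.
move=> oF g9 [M [k [dM k0 e]]]; have [r [hr rr]] := octic_eight_roots oF.
apply: eight_roots_octic => //.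
  apply: contraNneq (octic_neq0 oF) => g0; rewrite g0 scaler0 in e.
  have := congr1 (act (adj2 M)) e; rewrite act_comp mul_adj2 act_scalar ?octic_size //.
  have -> : act (adj2 M) 0 = 0 by rewrite /act big1 // => i _; rewrite coef0 scale0r.
  by move/eqP; rewrite scaler_eq0 expf_eq0 (negPf dM).
pose N := adj2 M.
exists (fun i => (N 0 0 * (r i).1 + N 0 1 * (r i).2, N 1 0 * (r i).1 + N 1 1 * (r i).2)).
split=> [i|i j /rr].
  apply: (mulfI k0); rewrite mulr0 -hev_scale -e hev_act /= !mx2_entries.
  set u := _ + _; set v := _ + _.
  have -> : u = det2 M * (r i).1 by rewrite /u /det2; ring.
  have -> : v = det2 M * (r i).2 by rewrite /v /det2; ring.
  by rewrite hevZ hr mulr0.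
rewrite -subr_eq0 => h; rewrite -subr_eq0 /=; have := mulf_neq0 dM h; rewrite /N !mx2_entries /det2.
by apply: contraNneq => <-; apply/eqP; ring.
Qed.

End OcticEquivalence.

(** * Coefficients of transformed octics and the covariant (f,f)_6 *)

Section OcticCoefficients.

Variable C : numClosedFieldType.
Implicit Types (f g h : {poly C}) (M N A B P : 'M[C]_2) (s t x : C).

Lemma eq_octic f g : (size f <= 9)%N -> (size g <= 9)%N ->
  (forall k, (k < 9)%N -> f`_k = g`_k) -> f = g.
Proof.
move=> f9 g9 H; apply/polyP => k; case: (ltnP k 9) => [/H //|k9].
by rewrite !nth_default // (leq_trans _ k9).
Qed.

Lemma hev_poly (E : nat -> C) s t :
  hev (\poly_(k < 9) E k) s t = \sum_(k < 9) E k * s ^+ k * t ^+ (8 - k).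
Proof. by apply: eq_bigr => k _; rewrite coef_poly ltn_ord. Qed.

Lemma act_diag p q f :
  act (mx2 p 0 0 q) f = \poly_(k < 9) (f`_k * p ^+ k * q ^+ (8 - k)).
Proof.
apply: hev_inj; rewrite ?size_act ?size_poly // => x.
rewrite hev_act hev_poly !mx2_entries; apply: eq_bigr => k _.
by rewrite !mul0r addr0 add0r !exprMn; ring.
Qed.

Lemma act_antidiag p q f :
  act (mx2 0 p q 0) f = \poly_(k < 9) (f`_(8 - k) * p ^+ (8 - k) * q ^+ k).
Proof.
apply: hev_inj; rewrite ?size_act ?size_poly // => x.
rewrite hev_act hev_poly !mx2_entries [LHS](reindex_inj rev_ord_inj) /=.
apply: eq_bigr => k _.
have k8 : (k <= 8)%N by rewrite -ltnS.
by rewrite subSS subKn // !mul0r addr0 add0r !exprMn; ring.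
Qed.

Lemma hev_trinomial i j t u v : (i < 9)%N -> (j < 4)%N -> (i + j = 8)%N ->
  hev (t *: 'X^i + 'X^4 + 'X^j) u v =
    t * (u ^+ i * v ^+ j) + u ^+ 4 * v ^+ 4 + u ^+ j * v ^+ i.
Proof.
move=> i9 j4 ij; have j9 : (j < 9)%N by rewrite (ltn_trans j4).
have E (l : nat) : (l < 9)%N -> \sum_(k < 9) (k == l :> nat)%:R * u ^+ k * v ^+ (8 - k) = u ^+ l * v ^+ (8 - l).
  move=> l9; rewrite (bigD1 (Ordinal l9)) //= eqxx mul1r big1 ?addr0 // => k.
  by rewrite -val_eqE /= => /negPf ->; rewrite !mul0r.
have -> : hev (t *: 'X^i + 'X^4 + 'X^j) u v = \sum_(k < 9) (t * ((k == i :> nat)%:R * u ^+ k * v ^+ (8 - k))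
   + (k == 4 :> nat)%:R * u ^+ k * v ^+ (8 - k) + (k == j :> nat)%:R * u ^+ k * v ^+ (8 - k)).
  by apply: eq_bigr => k _; rewrite !(coefD, coefZ, coefXn); ring.
rewrite !big_split /= -mulr_sumr !E //.
have -> : (8 - i = j)%N by rewrite -ij addKn.
by have -> : (8 - j = i)%N by rewrite -ij addnK.
Qed.

(* The value at (1 : 0) of the transvectant (f,f)_6, up to a constant factor. *)
Definition transvectant f : C :=
  56 * f`_8 * f`_2 - 21 * f`_7 * f`_3 + 12 * f`_6 * f`_4 - 5 * f`_5 ^+ 2.

(** For this trinomial the covariant is a multiple of s^2 t^2 and has weight 6. Its value at (1 : 0)
    after the substitution M is therefore that of s^2 t^2 at the first column of M, times the sixth
    power of the determinant. The same holds for the other trinomial. *)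
Lemma transvectant80 t M : transvectant (act M (t *: 'X^8 + 'X^4 + 'X^0)) =
  (1568 * t - 8) * det2 M ^+ 6 * (M 0 0 * M 1 0) ^+ 2.
Proof.
rewrite /det2; set a := M 0 0; set b := M 0 1; set c := M 1 0; set d := M 1 1.
have -> : act M (t *: 'X^8 + 'X^4 + 'X^0) = Poly [::
      t * (b ^+ 8) + (b ^+ 4 * d ^+ 4) + (d ^+ 8);
      t * (8 * a * b ^+ 7) + (4 * b ^+ 4 * c * d ^+ 3 + 4 * a * b ^+ 3 * d ^+ 4) + (8 * c * d ^+ 7);
      t * (28 * a ^+ 2 * b ^+ 6) + (6 * b ^+ 4 * c ^+ 2 * d ^+ 2 + 16 * a * b ^+ 3 * c * d ^+ 3 + 6 * a ^+ 2 * b ^+ 2 * d ^+ 4) + (28 * c ^+ 2 * d ^+ 6);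
      t * (56 * a ^+ 3 * b ^+ 5) + (4 * b ^+ 4 * c ^+ 3 * d + 24 * a * b ^+ 3 * c ^+ 2 * d ^+ 2 + 24 * a ^+ 2 * b ^+ 2 * c * d ^+ 3 + 4 * a ^+ 3 * b * d ^+ 4) + (56 * c ^+ 3 * d ^+ 5);
      t * (70 * a ^+ 4 * b ^+ 4) + (b ^+ 4 * c ^+ 4 + 16 * a * b ^+ 3 * c ^+ 3 * d + 36 * a ^+ 2 * b ^+ 2 * c ^+ 2 * d ^+ 2 + 16 * a ^+ 3 * b * c * d ^+ 3 + a ^+ 4 * d ^+ 4) + (70 * c ^+ 4 * d ^+ 4);
      t * (56 * a ^+ 5 * b ^+ 3) + (4 * a * b ^+ 3 * c ^+ 4 + 24 * a ^+ 2 * b ^+ 2 * c ^+ 3 * d + 24 * a ^+ 3 * b * c ^+ 2 * d ^+ 2 + 4 * a ^+ 4 * c * d ^+ 3) + (56 * c ^+ 5 * d ^+ 3);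
      t * (28 * a ^+ 6 * b ^+ 2) + (6 * a ^+ 2 * b ^+ 2 * c ^+ 4 + 16 * a ^+ 3 * b * c ^+ 3 * d + 6 * a ^+ 4 * c ^+ 2 * d ^+ 2) + (28 * c ^+ 6 * d ^+ 2);
      t * (8 * a ^+ 7 * b) + (4 * a ^+ 3 * b * c ^+ 4 + 4 * a ^+ 4 * c ^+ 3 * d) + (8 * c ^+ 7 * d);
      t * (a ^+ 8) + (a ^+ 4 * c ^+ 4) + (c ^+ 8)].
  apply: hev_inj; rewrite ?size_act ?(leq_trans (size_Poly _)) // => x.
  rewrite hev_act hev_trinomial // -horner_hev ?(leq_trans (size_Poly _)) //.
  by rewrite horner_Poly /= -/a -/b -/c -/d; ring.
by rewrite /transvectant !coef_Poly /=; ring.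
Qed.

Lemma transvectant71 t M : transvectant (act M (t *: 'X^7 + 'X^4 + 'X^1)) =
  - (49 * t + 8) * det2 M ^+ 6 * (M 0 0 * M 1 0) ^+ 2.
Proof.
rewrite /det2; set a := M 0 0; set b := M 0 1; set c := M 1 0; set d := M 1 1.
have -> : act M (t *: 'X^7 + 'X^4 + 'X^1) = Poly [::
      t * (b ^+ 7 * d) + (b ^+ 4 * d ^+ 4) + (b * d ^+ 7);
      t * (b ^+ 7 * c + 7 * a * b ^+ 6 * d) + (4 * b ^+ 4 * c * d ^+ 3 + 4 * a * b ^+ 3 * d ^+ 4) + (7 * b * c * d ^+ 6 + a * d ^+ 7);
      t * (7 * a * b ^+ 6 * c + 21 * a ^+ 2 * b ^+ 5 * d) + (6 * b ^+ 4 * c ^+ 2 * d ^+ 2 + 16 * a * b ^+ 3 * c * d ^+ 3 + 6 * a ^+ 2 * b ^+ 2 * d ^+ 4) + (21 * b * c ^+ 2 * d ^+ 5 + 7 * a * c * d ^+ 6);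
      t * (21 * a ^+ 2 * b ^+ 5 * c + 35 * a ^+ 3 * b ^+ 4 * d) + (4 * b ^+ 4 * c ^+ 3 * d + 24 * a * b ^+ 3 * c ^+ 2 * d ^+ 2 + 24 * a ^+ 2 * b ^+ 2 * c * d ^+ 3 + 4 * a ^+ 3 * b * d ^+ 4) + (35 * b * c ^+ 3 * d ^+ 4 + 21 * a * c ^+ 2 * d ^+ 5);
      t * (35 * a ^+ 3 * b ^+ 4 * c + 35 * a ^+ 4 * b ^+ 3 * d) + (b ^+ 4 * c ^+ 4 + 16 * a * b ^+ 3 * c ^+ 3 * d + 36 * a ^+ 2 * b ^+ 2 * c ^+ 2 * d ^+ 2 + 16 * a ^+ 3 * b * c * d ^+ 3 + a ^+ 4 * d ^+ 4) + (35 * b * c ^+ 4 * d ^+ 3 + 35 * a * c ^+ 3 * d ^+ 4);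
      t * (35 * a ^+ 4 * b ^+ 3 * c + 21 * a ^+ 5 * b ^+ 2 * d) + (4 * a * b ^+ 3 * c ^+ 4 + 24 * a ^+ 2 * b ^+ 2 * c ^+ 3 * d + 24 * a ^+ 3 * b * c ^+ 2 * d ^+ 2 + 4 * a ^+ 4 * c * d ^+ 3) + (21 * b * c ^+ 5 * d ^+ 2 + 35 * a * c ^+ 4 * d ^+ 3);
      t * (21 * a ^+ 5 * b ^+ 2 * c + 7 * a ^+ 6 * b * d) + (6 * a ^+ 2 * b ^+ 2 * c ^+ 4 + 16 * a ^+ 3 * b * c ^+ 3 * d + 6 * a ^+ 4 * c ^+ 2 * d ^+ 2) + (7 * b * c ^+ 6 * d + 21 * a * c ^+ 5 * d ^+ 2);
      t * (7 * a ^+ 6 * b * c + a ^+ 7 * d) + (4 * a ^+ 3 * b * c ^+ 4 + 4 * a ^+ 4 * c ^+ 3 * d) + (b * c ^+ 7 + 7 * a * c ^+ 6 * d);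
      t * (a ^+ 7 * c) + (a ^+ 4 * c ^+ 4) + (a * c ^+ 7)].
  apply: hev_inj; rewrite ?size_act ?(leq_trans (size_Poly _)) // => x.
  rewrite hev_act hev_trinomial // -horner_hev ?(leq_trans (size_Poly _)) //.
  by rewrite horner_Poly /= -/a -/b -/c -/d; ring.
by rewrite /transvectant !coef_Poly /=; ring.
Qed.

End OcticCoefficients.

(** * Octics stabilised by a diagonal matrix of order greater than 2 *)

Section Descent.

Variable C : numClosedFieldType.
Implicit Types (f g h : {poly C}) (M N A B P : 'M[C]_2) (s t x : C).

Variables (F : divringClosed C) (S : {rmorphism C -> C} -> Prop).
Hypothesis fixF : forall z, (forall sigma, S sigma -> sigma z = z) -> z \in F.

(** In the application [S] consists of the automorphisms of C fixing F, and this is what the field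
    of moduli provides. *)
Definition conj_equiv f := forall sigma, S sigma -> equiv f (map_poly sigma f).

Definition descends f := exists g, [/\ octic g, equiv f g & g \is a polyOver F].

Lemma map_act (sigma : {rmorphism C -> C}) M f :
  map_poly sigma (act M f) = act (map_mx sigma M) (map_poly sigma f).
Proof.
have L a b : map_poly sigma (lin a b) = lin (sigma a) (sigma b).
  by rewrite rmorphD /= map_polyZ map_polyX map_polyC.
rewrite rmorph_sum; apply: eq_bigr => k _ /=.
by rewrite map_polyZ rmorphM /= !rmorphXn /= !L coef_map !mxE.
Qed.

Lemma det2_map (sigma : {rmorphism C -> C}) M : det2 (map_mx sigma M) = sigma (det2 M).
Proof. by rewrite /det2 !mxE rmorphB !rmorphM. Qed.

Lemma equiv_map (sigma : {rmorphism C -> C}) f g :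
  equiv f g -> equiv (map_poly sigma f) (map_poly sigma g).
Proof.
move=> [M [k [dM k0 e]]]; exists (map_mx sigma M), (sigma k).
by rewrite det2_map !fmorph_eq0 -map_act e map_polyZ.
Qed.

Lemma octic_map (sigma : {rmorphism C -> C}) f : octic f -> octic (map_poly sigma f).
Proof. by rewrite /octic separable_map size_map_poly. Qed.

Lemma conj_equiv_trans f g : octic f -> equiv f g -> conj_equiv f -> conj_equiv g.
Proof.
move=> /octic_size f9 e H sigma Ss; apply: equiv_trans (equiv_sym f9 e) _.
by apply: equiv_trans (H _ Ss) (equiv_map _ e).
Qed.

Lemma descends_equiv f g : equiv f g -> descends g -> descends f.
Proof. by move=> e [h [oh eh hF]]; exists h; split=> //; apply: equiv_trans e eh. Qed.

(** Otherwise infinity would be a multiple root of the form; the next lemma is the same at 0. *)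
Lemma octic_coef_high f : octic f -> (f`_8 != 0) || (f`_7 != 0).
Proof.
case/and3P => sf f7; rewrite leq_eqVlt => /orP[/eqP e|f8].
  by rewrite -[8%N]/(9.-1) -e -lead_coefE lead_coef_eq0 separable_poly_neq0.
have e : size f = 8%N by apply/eqP; rewrite eqn_leq -ltnS f8.
have -> : f`_7 = lead_coef f by rewrite lead_coefE e.
by rewrite lead_coef_eq0 separable_poly_neq0 ?orbT.
Qed.

Lemma octic_coef_low f : octic f -> (f`_0 != 0) || (f`_1 != 0).
Proof.
case/andP => sf _; apply/negPn/negP; rewrite negb_or !negbK => /andP[f0 f1].
have r0 : root f 0 by rewrite rootE horner_coef0.
have : f^`().[0] != 0 by move: sf; rewrite unlock => /coprimep_root ->.
by rewrite horner_coef0 coef_deriv mulr1n f1.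
Qed.

Lemma size_binomial (a b : C) i j : (i < 9)%N -> (j < 9)%N ->
  (size (a *: 'X^i + b *: 'X^j)%R <= 9)%N.
Proof.
move=> i9 j9; rewrite (leq_trans (size_polyD _ _)) // geq_max.
by rewrite !(leq_trans (size_scale_leq _ _)) ?size_polyXn.
Qed.

Lemma size_trinomial (a b c : C) i j l : (i < 9)%N -> (j < 9)%N -> (l < 9)%N ->
  (size (a *: 'X^i + b *: 'X^j + c *: 'X^l)%R <= 9)%N.
Proof.
move=> i9 j9 l9; rewrite (leq_trans (size_polyD _ _)) // geq_max size_binomial //.
by rewrite (leq_trans (size_scale_leq _ _)) ?size_polyXn.
Qed.

(** Scaling x by an (i - j)-th root of b / a makes the two coefficients equal, so the form becomes
    rational. *)
Lemma binomial_descends i j (a b : C) : (j < i)%N -> (i < 9)%N ->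
  a != 0 -> b != 0 -> octic (a *: 'X^i + b *: 'X^j) -> descends (a *: 'X^i + b *: 'X^j).
Proof.
move=> ji i9 a0 b0 oF; have j9 := ltn_trans ji i9.
pose n := (i - j)%N; have n0 : (0 < n)%N by rewrite subn_gt0.
pose s := n.-root (b / a).
have sn : s ^+ n = b / a by rewrite rootCK.
have s0 : s != 0.
  by apply/eqP => s0; move/eqP: sn; rewrite s0 expr0n -(prednK n0) eq_sym mulf_eq0 invr_eq0 (negPf a0) (negPf b0).
pose g : {poly C} := 1 *: 'X^i + 1 *: 'X^j.
have e : equiv (a *: 'X^i + b *: 'X^j) g.
  exists (mx2 s 0 0 1), (b * s ^+ j); rewrite /det2 !mx2_entries !mulr1 mul0r subr0 s0 mulf_neq0 ?expf_neq0 //.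
  split=> //; rewrite act_diag; apply: eq_octic => [||k k9].
  - exact: size_poly.
  - by rewrite (leq_trans (size_scale_leq _ _)) // size_binomial.
  rewrite coef_poly k9 expr1n mulr1 !(coefD, coefZ, coefXn).
  case: (eqVneq k i) => [->|ki].
    rewrite (gtn_eqF ji) !mulr1 !mulr0 !addr0 mulr1 -{1}(subnK (ltnW ji)) exprD sn.
    by rewrite mulrA mulrCA divff // mulr1.
  case: (eqVneq k j) => [->|kj]; first by rewrite !mulr0 !mulr1 !add0r mulr1.
  by rewrite !mulr0 !addr0 mul0r mulr0.
exists g; split=> //; first by apply: octic_equiv oF _ e; rewrite size_binomial.
by rewrite /g !scale1r rpredD ?polyOverXn.
Qed.

Definition trinomial i j t : {poly C} := t *: 'X^i + 'X^4 + 'X^j.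

Lemma size_trinomial1 i j t : (i < 9)%N -> (j < 9)%N -> (size (trinomial i j t) <= 9)%N.
Proof.
by move=> i9 j9; have := @size_trinomial t 1 1 i 4 j i9 isT j9; rewrite !scale1r.
Qed.

(** A scaling of x makes the last two coefficients equal. Since 4 is the midpoint of i and j, the
    quantity a c / b^2 is unchanged by scalings, and so it is the coefficient left over. *)
Lemma trinomial_equiv i j (a b c : C) : (i < 9)%N -> (j < 4)%N -> (i + j = 8)%N ->
  b != 0 -> c != 0 ->
  equiv (a *: 'X^i + b *: 'X^4 + c *: 'X^j) (trinomial i j (a * c / b ^+ 2)).
Proof.
move=> i9 j4 ij b0 c0; have j9 : (j < 9)%N by rewrite (ltn_trans j4).
pose n := (4 - j)%N; have n0 : (0 < n)%N by rewrite subn_gt0.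
have i4 : (4 < i)%N by rewrite -(ltn_add2r j) ij -(subnK (ltnW j4)) -addnA -/n; move: n0 j4; rewrite /n; case: (j) => [|[|[|[|?]]]].
pose s := n.-root (c / b).
have sn : s ^+ n = c / b by rewrite rootCK.
have s0 : s != 0.
  by apply/eqP => s0; move/eqP: sn; rewrite s0 expr0n -(prednK n0) eq_sym mulf_eq0 invr_eq0 (negPf b0) (negPf c0).
exists (mx2 s 0 0 1), (c * s ^+ j); rewrite /det2 !mx2_entries !mulr1 mul0r subr0 s0 mulf_neq0 ?expf_neq0 //.
split=> //; rewrite act_diag; apply: eq_octic => [||k k9].
- exact: size_poly.
- by rewrite (leq_trans (size_scale_leq _ _)) // size_trinomial1.
rewrite coef_poly k9 expr1n mulr1 !(coefD, coefZ, coefXn).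
have e4 : s ^+ 4 = c / b * s ^+ j by rewrite -sn -exprD subnK // ltnW.
have ei : s ^+ i = (c / b) ^+ 2 * s ^+ j.
  rewrite -sn -exprM -exprD; congr (_ ^+ _); rewrite /n.
  by move: ij j4; case: (j) => [|[|[|[|?]]]] //; rewrite ?addn0 ?addn1 ?addn2 ?addn3 => -[->].
case: (eqVneq k i) => [->|ki].
  rewrite (gtn_eqF i4) (gtn_eqF (ltn_trans j4 i4)) ei !mulr1 !mulr0 !addr0; field; exact: b0.
case: (eqVneq k 4%N) => [->|k4].
  rewrite (gtn_eqF j4) e4 /= mulr1n !mulr0n; field; exact: b0.
case: (eqVneq k j) => [->|kj]; last by rewrite !(mulr0, addr0, mul0r).
by rewrite !(mulr0, mulr1, add0r).
Qed.

Lemma map_trinomial (sigma : {rmorphism C -> C}) i j t :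
  map_poly sigma (trinomial i j t) = trinomial i j (sigma t).
Proof. by rewrite /trinomial !rmorphD /= map_polyZ !map_polyXn. Qed.

(** The two products vanish only for a diagonal or antidiagonal M. Such a substitution multiplies
    the product of the outer coefficients and the square of the middle one by the same factor, and t
    is their quotient. *)
Lemma trinomial_rigid i j t t' k M : (i < 9)%N -> (j < 4)%N -> (i + j = 8)%N ->
  det2 M != 0 -> k != 0 -> act M (trinomial i j t) = k *: trinomial i j t' ->
  M 0 0 * M 1 0 = 0 -> M 0 1 * M 1 1 = 0 -> t = t'.
Proof.
move=> i9 j4 ij dM k0 e e0 e1; have j9 : (j < 9)%N by rewrite (ltn_trans j4).
have i4 : (4 < i)%N by rewrite -(ltn_add2r j) ij -[8%N]/(4 + 4)%N ltn_add2l.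
have [hi hj] : (8 - i = j /\ 8 - j = i)%N by rewrite -ij addKn addnK.
have [ji ij4] := (ltn_trans j4 i4, (gtn_eqF i4, gtn_eqF j4)).
have [ci c4 cj] : [/\ (trinomial i j t)`_i = t, (trinomial i j t)`_4 = 1 & (trinomial i j t)`_j = 1].
  rewrite /trinomial !(coefD, coefZ, coefXn) !eqxx (gtn_eqF i4) (gtn_eqF ji) (ltn_eqF i4) (gtn_eqF j4) (ltn_eqF j4) (ltn_eqF ji) /=.
  by rewrite mulr1n !mulr0n; split; ring.
have [di d4 dj] : [/\ (k *: trinomial i j t')`_i = k * t', (k *: trinomial i j t')`_4 = k & (k *: trinomial i j t')`_j = k].
  rewrite /trinomial !(coefD, coefZ, coefXn) !eqxx (gtn_eqF i4) (gtn_eqF ji) (ltn_eqF i4) (gtn_eqF j4) (ltn_eqF j4) (ltn_eqF ji) /=.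
  by rewrite mulr1n !mulr0n; split; ring.
have kk : k * k != 0 by rewrite mulf_neq0.
case: (eqVneq (M 1 0) 0) => [m10|m10].
  have m11 : M 1 1 != 0 by apply: contraNneq dM => m11; rewrite /det2 m10 m11 !mulr0 subr0.
  have m01 : M 0 1 = 0 by move/eqP: e1; rewrite mulf_eq0 (negPf m11) orbF => /eqP.
  have eM : M = mx2 (M 0 0) 0 0 (M 1 1) by apply: eq_mx2; rewrite !mx2_entries.
  rewrite eM act_diag in e.
  have := (congr1 (fun p : {poly C} => p`_i) e, congr1 (fun p : {poly C} => p`_4) e, congr1 (fun p : {poly C} => p`_j) e).
  rewrite /= !coef_poly i9 j9 /= ci c4 cj di d4 dj hi hj !mul1r -[(8 - 4)%N]/4%N => -[[h1 h2] h3].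
  have hk : k * k = (M 0 0 ^+ i * M 1 1 ^+ j) * (M 0 0 ^+ j * M 1 1 ^+ i).
    by rewrite -h2 mulrACA [RHS]mulrACA -!exprD ij addnC ij.
  apply: (mulIf kk); transitivity (t * M 0 0 ^+ i * M 1 1 ^+ j * (M 0 0 ^+ j * M 1 1 ^+ i)).
    by rewrite hk !mulrA.
  by rewrite h1 h3; ring.
have m00 : M 0 0 = 0 by move/eqP: e0; rewrite mulf_eq0 (negPf m10) orbF => /eqP.
have m01 : M 0 1 != 0 by apply: contraNneq dM => m01; rewrite /det2 m00 m01 !mul0r subr0.
have m11 : M 1 1 = 0 by move/eqP: e1; rewrite mulf_eq0 (negPf m01) => /eqP.
have eM : M = mx2 0 (M 0 1) (M 1 0) 0 by apply: eq_mx2; rewrite !mx2_entries.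
rewrite eM act_antidiag in e.
have := (congr1 (fun p : {poly C} => p`_i) e, congr1 (fun p : {poly C} => p`_4) e, congr1 (fun p : {poly C} => p`_j) e).
rewrite /= !coef_poly i9 j9 /= hi hj -[(8 - 4)%N]/4%N ci c4 cj di d4 dj !mul1r => -[[h1 h2] h3].
have hk : k * k = (M 0 1 ^+ i * M 1 0 ^+ j) * (M 0 1 ^+ j * M 1 0 ^+ i).
  by rewrite -h2 mulrACA [RHS]mulrACA -!exprD ij addnC ij.
apply: (mulIf kk); transitivity (t * M 0 1 ^+ i * M 1 0 ^+ j * (M 0 1 ^+ j * M 1 0 ^+ i)).
  by rewrite hk !mulrA.
by rewrite h1 h3; ring.
Qed.

Definition swap2 : 'M[C]_2 := mx2 0 1 1 0.

(** The covariant of the target trinomial vanishes at (1 : 0) and at (0 : 1), the second point being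
    brought to the first by [swap2]. So both columns of M lie on s t = 0 and [trinomial_rigid]
    applies, unless the covariant is identically zero; then t is a rational number and sigma fixes
    it. *)
Lemma trinomial_fixed i j t (sigma : {rmorphism C -> C}) :
  (i = 8 /\ j = 0)%N \/ (i = 7 /\ j = 1)%N ->
  equiv (trinomial i j t) (trinomial i j (sigma t)) -> sigma t = t.
Proof.
move=> hij [M [k [dM k0 e]]].
have [i9 j4 ij] : [/\ (i < 9)%N, (j < 4)%N & (i + j = 8)%N] by case: hij => [[-> ->]|[-> ->]].
have e' : act (M *m swap2) (trinomial i j t) = k *: act swap2 (trinomial i j (sigma t)).
  by rewrite -act_comp e actZ.
have [m0 m1] : (M *m swap2) 0 0 = M 0 1 /\ (M *m swap2) 1 0 = M 1 1.
  by rewrite !mul2E !mx2_entries !mulr0 !mulr1 !add0r.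
have dM' : det2 (M *m swap2) != 0.
  by rewrite det2M mulf_neq0 // /det2 !mx2_entries mulr0 mulr1 sub0r oppr_eq0 oner_neq0.
have [T T'] : transvectant (act M (trinomial i j t)) = 0 /\
   transvectant (act (M *m swap2) (trinomial i j t)) = 0.
  rewrite e e' act_antidiag /transvectant /trinomial; case: hij => [[-> ->]|[-> ->]].
    by rewrite !(coefZ, coef_poly) /= !(coefD, coefZ, coefXn) /= !mulr0n mulr1n; split; ring.
  by rewrite !(coefZ, coef_poly) /= !(coefD, coefZ, coefXn) /= !mulr0n mulr1n; split; ring.
have fin (c : C) (M' : 'M[C]_2) : c != 0 -> det2 M' != 0 ->
    c * det2 M' ^+ 6 * (M' 0 0 * M' 1 0) ^+ 2 = 0 -> M' 0 0 * M' 1 0 = 0.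
  move=> c0 d0 /eqP; rewrite mulf_eq0 expf_eq0 mulf_eq0 (negPf c0) expf_eq0 (negPf d0) /=.
  by move/eqP.
case: hij => [[ei ej]|[ei ej]]; subst i j.
  move: T T'; rewrite !transvectant80 => T T'.
  case: (eqVneq (1568 * t - 8) 0) => [/eqP|c0].
    rewrite subr_eq0 => /eqP h; have -> : t = 8 / 1568 by rewrite -h mulrC mulKf // pnatr_eq0.
    by rewrite fmorph_div !rmorph_nat.
  apply/esym/(trinomial_rigid i9 j4 ij dM k0 e); first exact: fin T.
  by rewrite -m0 -m1; apply: fin T'.
move: T T'; rewrite !transvectant71 => T T'.
case: (eqVneq (- (49 * t + 8)) 0) => [/eqP|c0].
  rewrite oppr_eq0 addr_eq0 => /eqP h.
  have -> : t = - 8 / 49 by rewrite -h mulrC mulKf // pnatr_eq0.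
  by rewrite fmorph_div rmorphN !rmorph_nat.
apply/esym/(trinomial_rigid i9 j4 ij dM k0 e); first exact: fin T.
by rewrite -m0 -m1; apply: fin T'.
Qed.

Lemma trinomial_descends i j (a b c : C) :
  (i = 8 /\ j = 0)%N \/ (i = 7 /\ j = 1)%N -> b != 0 -> c != 0 ->
  let f := a *: 'X^i + b *: 'X^4 + c *: 'X^j in
  octic f -> conj_equiv f -> descends f.
Proof.
move=> hij b0 c0 f oF H.
have [i9 j4 ij] : [/\ (i < 9)%N, (j < 4)%N & (i + j = 8)%N] by case: hij => [[-> ->]|[-> ->]].
have e : equiv f (trinomial i j (a * c / b ^+ 2)) := trinomial_equiv a i9 j4 ij b0 c0.
have s9 : (size (trinomial i j (a * c / b ^+ 2)) <= 9)%N.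
  by apply: size_trinomial1 => //; apply: ltn_trans j4 _.
exists (trinomial i j (a * c / b ^+ 2)); split=> //; first exact: octic_equiv oF s9 e.
have tF : a * c / b ^+ 2 \in F.
  apply: fixF => sigma Ss; apply: (trinomial_fixed hij).
  by rewrite -map_trinomial; apply: (conj_equiv_trans oF e H).
by rewrite /trinomial !rpredD ?polyOverXn // polyOverZ ?polyOverXn.
Qed.

Lemma expr_gcd_eq1 x m n : (0 < m)%N -> x ^+ m = 1 -> x ^+ n = 1 -> x ^+ gcdn m n = 1.
Proof.
move=> m0 xm xn; case: (egcdnP n m0) => u v e _.
by have := congr1 (fun d => x ^+ d) e; rewrite /= exprD mulnC exprM xm expr1n mulnC exprM xn expr1n mul1r => <-.
Qed.

(** All exponents i present in f have the same m^i. An octic contains one of the exponents 0, 1 and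
    one of 7, 8, so m has order dividing 6, 7 or 8; as m^2 is not 1, an exponent survives only if
    its distance to the lowest one is not prime to the order bound and has more than a factor 2 in
    common with it. This leaves 1, 4, 7, or 0, 4, 8, or only the two extreme exponents. *)
Lemma diagonal_descends f (m k : C) : octic f -> conj_equiv f -> m != 1 -> m != -1 ->
  act (mx2 m 0 0 1) f = k *: f -> m != 0 -> descends f.
Proof.
move=> oF H m1 mN1 e m0; have f9 := octic_size oF.
have supp i : (i < 9)%N -> f`_i != 0 -> m ^+ i = k.
  move=> i9 fi; have := congr1 (fun p : {poly C} => p`_i) e.
  by rewrite act_diag /= coef_poly i9 coefZ expr1n mulr1 mulrC => /(mulIf fi).
have m2 : m ^+ 2 != 1 by rewrite sqrf_eq1 negb_or m1.
have no a b : (0 < a)%N -> m ^+ a = 1 -> (gcdn a b == 1%N) || (gcdn a b == 2%N) -> m ^+ b <> 1.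
  move=> a0 ma g mb; have := expr_gcd_eq1 a0 ma mb.
  by case/orP: g => /eqP -> /eqP; [rewrite expr1 (negPf m1)|rewrite (negPf m2)].
have zero i : (i < 9)%N -> m ^+ i <> k -> f`_i = 0.
  by move=> i9 h; apply/eqP/negPn/negP => /(supp _ i9).
case: (eqVneq f`_0 0) (octic_coef_low oF) => [f0 /= f1|f0 _].
  have k1 := supp 1%N isT f1; rewrite expr1 in k1.
  have zero' i a : (i.+1 < 9)%N -> (0 < a)%N -> m ^+ a = 1 -> (gcdn a i == 1%N) || (gcdn a i == 2%N) -> f`_i.+1 = 0.
    move=> i9 a0 ma g; apply: zero => // h; apply: (no a i) => //; apply: (mulfI m0).
    by rewrite -exprS h mulr1.
  case: (eqVneq f`_8 0) (octic_coef_high oF) => [f8 /= f7|f8 _].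
    have m6 : m ^+ 6 = 1 by apply: (mulfI m0); rewrite -exprS (supp 7%N) // mulr1.
    have ef : f = f`_7 *: 'X^7 + f`_4 *: 'X^4 + f`_1 *: 'X^1.
      apply: eq_octic => //; first exact: size_trinomial.
      move=> [|[|[|[|[|[|[|[|[|//]]]]]]]]] _; rewrite !(coefD, coefZ, coefXn) /= ?mulr1n ?mulr0n ?mulr0 ?mulr1 ?addr0 ?add0r //;
        by apply: (zero' _ 6%N).
    case: (eqVneq f`_4 0) => [f4|f4].
      rewrite ef f4 scale0r addr0 in oF *; exact: binomial_descends.
    by rewrite ef in oF H *; apply: trinomial_descends => //; right.
  have m7 : m ^+ 7 = 1 by apply: (mulfI m0); rewrite -exprS (supp 8%N) // mulr1.
  have ef : f = f`_8 *: 'X^8 + f`_1 *: 'X^1.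
    apply: eq_octic => //; first exact: size_binomial.
    move=> [|[|[|[|[|[|[|[|[|//]]]]]]]]] _; rewrite !(coefD, coefZ, coefXn) /= ?mulr1n ?mulr0n ?mulr0 ?mulr1 ?addr0 ?add0r //;
      by apply: (zero' _ 7%N).
  by rewrite ef in oF *; apply: binomial_descends.
have k1 := supp 0%N isT f0; rewrite expr0 in k1.
have zero' i a : (i < 9)%N -> (0 < a)%N -> m ^+ a = 1 -> (gcdn a i == 1%N) || (gcdn a i == 2%N) -> f`_i = 0.
  by move=> i9 a0 ma g; apply: zero => //; rewrite -k1; apply: (no a i).
case: (eqVneq f`_8 0) (octic_coef_high oF) => [f8 /= f7|f8 _].
  have m7 : m ^+ 7 = 1 by rewrite (supp 7%N).
  have ef : f = f`_7 *: 'X^7 + f`_0 *: 'X^0.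
    apply: eq_octic => //; first exact: size_binomial.
    move=> [|[|[|[|[|[|[|[|[|//]]]]]]]]] _; rewrite !(coefD, coefZ, coefXn) /= ?mulr1n ?mulr0n ?mulr0 ?mulr1 ?addr0 ?add0r //;
      by apply: (zero' _ 7%N).
  by rewrite ef in oF *; apply: binomial_descends.
have m8 : m ^+ 8 = 1 by rewrite (supp 8%N).
have ef : f = f`_8 *: 'X^8 + f`_4 *: 'X^4 + f`_0 *: 'X^0.
  apply: eq_octic => //; first exact: size_trinomial.
  move=> [|[|[|[|[|[|[|[|[|//]]]]]]]]] _; rewrite !(coefD, coefZ, coefXn) /= ?mulr1n ?mulr0n ?mulr0 ?mulr1 ?addr0 ?add0r //;
    by apply: (zero' _ 8%N).
case: (eqVneq f`_4 0) => [f4|f4].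
  rewrite ef f4 scale0r addr0 in oF *; exact: binomial_descends.
by rewrite ef in oF H *; apply: trinomial_descends => //; left.
Qed.

End Descent.

(** * Stabilisers of an octic and the quaternion matrices *)

Section Stabilizers.

Variable C : numClosedFieldType.
Implicit Types (f g h : {poly C}) (M N A B P : 'M[C]_2) (s t x : C).

Definition stab f A := det2 A != 0 /\ exists k, act A f = k *: f.

Definition nonscalar A := forall c : C, A <> c%:M.

Lemma mulmx_scale2 (c : C) A B : A *m (c *: B) = c *: (A *m B).
Proof. by rewrite scalemxAr. Qed.

Lemma stab_mul f A B : stab f A -> stab f B -> stab f (A *m B).
Proof.
move=> [dA [k ek]] [dB [l el]]; split; first by rewrite det2M mulf_neq0.
by exists (k * l); rewrite -act_comp ek actZ el scalerA.
Qed.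

Lemma stab_conj f A B P : det2 P != 0 -> A *m P = P *m B -> stab f A ->
  stab (act P f) B.
Proof.
move=> dP e [dA [k ek]]; split.
  have := congr1 (@det2 C) e; rewrite !det2M => e2.
  by apply: contraNneq dA => dB; move/eqP: e2; rewrite dB mulr0 mulf_eq0 (negPf dP) orbF.
by exists k; rewrite act_comp -e -act_comp ek actZ.
Qed.

Lemma stabZ f A (c : C) : c != 0 -> stab f (c *: A) <-> stab f A.
Proof.
move=> c0; rewrite /stab det2Z mulf_eq0 expf_eq0 (negPf c0) /=; split=> -[dA [k ek]]; split=> //.
  exists (c ^- 8 * k); rewrite -scalerA -ek act_scale scalerA mulVf ?scale1r // expf_neq0 //.
by exists (c ^+ 8 * k); rewrite act_scale ek scalerA.
Qed.

Lemma nonscalar_cases A : nonscalar A ->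
  [|| A 0 1 != 0, A 1 0 != 0 | A 0 0 != A 1 1].
Proof.
move=> nA; apply/negPn/negP; rewrite !negb_or !negbK => /and3P[/eqP h01 /eqP h10 /eqP e].
by case: (nA (A 0 0)); have [e1 e2 e3 e4] := scalar2E (A 0 0); apply: eq_mx2; rewrite ?e1 ?e2 ?e3 ?e4.
Qed.

(** With rows (a, b) and (c, d) and b nonzero, (b, l - a) is an eigenvector for the eigenvalue l;
    the case b = 0, where this vector may vanish, is treated apart. *)
Lemma triangularize A : nonscalar A -> exists P l m,
  [/\ det2 P != 0, l + m = tr2 A, l * m = det2 A &
    (l != m /\ A *m P = P *m mx2 l 0 0 m) \/ (l = m /\ A *m P = P *m mx2 l 1 0 l)].
Proof.
move/nonscalar_cases; rewrite /tr2 /det2.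
set a : C := A 0 0; set b : C := A 0 1; set c : C := A 1 0; set d : C := A 1 1.
case: (eqVneq b 0) => [b0 /= H|b0 _].
  case: (eqVneq a d) H => [ad|ad _].
    rewrite orbF => c0; exists (mx2 0 1 c 0), a, a; rewrite !mx2_entries b0 -ad.
    split; [by rewrite !mul0r sub0r oppr_eq0 mul1r|by []|by rewrite mul0r subr0|right; split=> //].
    by apply: eq_mx2; rewrite !mul2E !mx2_entries -/a -/b -/c -/d -?ad ?b0; ring.
  exists (mx2 (a - d) 0 c 1), a, d; rewrite !mx2_entries b0.
  split; [by rewrite mul0r subr0 mulr1 subr_eq0|by []|by rewrite mul0r subr0|left; split=> //].
  by apply: eq_mx2; rewrite !mul2E !mx2_entries -/a -/b -/c -/d ?b0; ring.
pose D := sqrtC ((a + d) ^+ 2 - 4 * (a * d - b * c)).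
have DD : D ^+ 2 = (a + d) ^+ 2 - 4 * (a * d - b * c) by rewrite sqrtCK.
pose l := (a + d + D) / 2; pose m := (a + d - D) / 2.
have n2 : (2 : C) != 0 by rewrite pnatr_eq0.
have slm : l + m = a + d by rewrite /l /m; field.
have plm : l * m = a * d - b * c.
  have -> : l * m = ((a + d) ^+ 2 - D ^+ 2) / 4 by rewrite /l /m; field.
  by rewrite DD; field.
have em : m = a + d - l by rewrite -slm addrAC subrr add0r.
have ll : l * (a + d - l) = a * d - b * c by rewrite -em plm.
have mm : m * (a + d - m) = a * d - b * c by rewrite -slm addrK mulrC.
case: (eqVneq l m) => [lm|lm].
  exists (mx2 b 0 (l - a) 1), l, m; rewrite !mx2_entries; split=> //.
    by rewrite mulr1 mul0r subr0.
  right; split=> //; have e2 : d = l + l - a by rewrite {2}lm slm addrC addKr.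
  apply: eq_mx2; rewrite !mul2E !mx2_entries -/a -/b -/c -/d.
  - by ring.
  - by ring.
  - apply/eqP; rewrite -subr_eq0; apply/eqP.
    by rewrite -[RHS](subrr (a * d - b * c)) -{1}ll; ring.
  - by rewrite e2; ring.
exists (mx2 b b (l - a) (m - a)), l, m; rewrite !mx2_entries; split=> //.
  by rewrite -mulrBr mulf_neq0 // opprB addrA subrK subr_eq0 eq_sym.
left; split=> //.
apply: eq_mx2; rewrite !mul2E !mx2_entries -/a -/b -/c -/d; try ring.
- apply/eqP; rewrite -subr_eq0; apply/eqP.
  by rewrite -[RHS](subrr (a * d - b * c)) -{1}ll; ring.
- apply/eqP; rewrite -subr_eq0; apply/eqP.
  by rewrite -[RHS](subrr (a * d - b * c)) -{1}mm; ring.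
Qed.

(** The matrix acts as x -> x + 1 / l, which has infinite order in characteristic zero: the orbit of
    a finite root would be an infinite set of roots. *)
Lemma translation_not_stab f (l : C) : octic f -> ~ stab f (mx2 l 1 0 l).
Proof.
move=> oF [dl [k e]].
have l0 : l != 0 by move: dl; rewrite /det2 !mx2_entries mulr0 subr0 mulf_eq0 orbb.
have f9 := octic_size oF.
have step x : root f x -> root f (x + l^-1).
  rewrite !rootE => /eqP fx; have : hev (act (mx2 l 1 0 l) f) x 1 = 0.
    by rewrite e hev_scale -horner_hev // fx mulr0.
  rewrite hev_act !mx2_entries mul0r add0r !mulr1 hev_dehom // => /eqP.
  rewrite mulf_eq0 expf_eq0 (negPf l0) /=.
  by have -> : (l * x + 1) / l = x + l^-1 by field.
have [x fx] := octic_root oF.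
have all n : root f (x + l^-1 *+ n).
  by elim: n => [|n IH]; rewrite ?mulr0n ?addr0 // mulrSr addrA step.
case/eqP: (octic_neq0 oF); apply: (@roots_geq_poly_eq0 _ f [seq x + l^-1 *+ i | i <- iota 0 9]).
- by apply/allP => y /mapP[i _ ->].
- rewrite map_inj_uniq ?iota_uniq // => i j /addrI /mulrIn; apply.
  by rewrite invr_eq0.
- by rewrite size_map size_iota.
Qed.

(** The quaternion units as matrices of determinant 1. On the projective line they are x -> -x, x ->
    -1/x and x -> 1/x, a Klein four-group. *)
Definition QI : 'M[C]_2 := mx2 'i 0 0 (- 'i).
Definition QJ : 'M[C]_2 := mx2 0 1 (- 1) 0.
Definition QK : 'M[C]_2 := mx2 0 'i 'i 0.

Lemma ii : 'i * 'i = -1 :> C. Proof. by rewrite -expr2 sqrCi. Qed.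

Lemma traceless_nonscalar A : det2 A != 0 -> tr2 A = 0 -> nonscalar A.
Proof.
move=> dA tA c eA; have [e1 e2 e3 e4] := scalar2E c.
move: dA tA; rewrite /det2 /tr2 eA e1 e2 e3 e4 mulr0 subr0 -mulr2n.
by move=> d0 /eqP; rewrite mulrn_eq0 /= => /eqP c0; rewrite c0 mul0r eqxx in d0.
Qed.

(** The three traces vanish exactly when A and B are traceless and anticommute. Once A is diagonal
    with eigenvalues l and -l, the conditions on B and A B make B antidiagonal, and a diagonal
    conjugation brings it to a multiple of [QJ]. *)
Lemma quaternion_pair A B : det2 A != 0 -> det2 B != 0 -> tr2 A = 0 -> tr2 B = 0 ->
  tr2 (A *m B) = 0 -> exists P a b,
  [/\ det2 P != 0, a != 0, b != 0, A *m P = P *m (a *: QI) & B *m P = P *m (b *: QJ)].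
Proof.
move=> dA dB tA tB tAB.
have [P [l [m [dP slm plm H]]]] := triangularize (traceless_nonscalar dA tA).
rewrite tA in slm; have em : m = - l by apply/eqP; rewrite -addr_eq0 addrC slm.
have l0 : l != 0 by apply: contraNneq dA => l0; rewrite -plm l0 mul0r.
have {H} e : A *m P = P *m mx2 l 0 0 (- l).
  case: H => [[_ ->]|[lm _]]; first by rewrite em.
  move: lm; rewrite em => /eqP; rewrite -addr_eq0 -mulr2n mulrn_eq0 /= => /eqP l00.
  by rewrite l00 eqxx in l0.
pose B' := adj2 P *m B *m P.
have tB' : tr2 B' = 0.
  transitivity (det2 P * tr2 B); last by rewrite tB mulr0.
  by rewrite /B' /tr2 !mul2E !mx2_entries /det2; ring.
have tAB' : tr2 (mx2 l 0 0 (- l) *m B') = 0.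
  have -> : mx2 l 0 0 (- l) *m B' = adj2 P *m A *m (B *m P).
    have d1 : det2 P *: (mx2 l 0 0 (- l) *m B') = det2 P *: (adj2 P *m A *m (B *m P)).
      rewrite -!mul_scalar_mx -adj_mul2 -!mulmxA; congr (_ *m _).
      rewrite [P *m (mx2 _ _ _ _ *m _)]mulmxA -e /B' -!mulmxA [P *m (adj2 P *m _)]mulmxA.
      rewrite mul_adj2 mul_scalar_mx.
      rewrite [P *m (adj2 P *m _)]mulmxA mul_adj2 mul_scalar_mx.
      by rewrite -scalemxAr.
    by rewrite -[LHS]scale1r -(mulVf dP) -scalerA d1 scalerA mulVf // scale1r.
  transitivity (det2 P * tr2 (A *m B)); last by rewrite tAB mulr0.
  by rewrite /tr2 !mul2E !mx2_entries /det2; ring.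
have [b00 b11] : B' 0 0 = 0 /\ B' 1 1 = 0.
  have e11 : B' 1 1 = - B' 0 0 by apply/eqP; rewrite -addr_eq0 addrC -tB'.
  have : B' 0 0 = 0.
    move: tAB'; rewrite /tr2 [(_ *m B') 0 0]mul2E [(_ *m B') 1 1]mul2E !mx2_entries !mul0r addr0 add0r e11 mulrNN -mulr2n.
    by move/eqP; rewrite mulrn_eq0 mulf_eq0 (negPf l0) /= => /eqP.
  by move=> h; rewrite e11 h oppr0.
have dB' : det2 B' = det2 P ^+ 2 * det2 B by rewrite !det2M det2_adj; ring.
have eB : B *m P = (det2 P)^-1 *: (P *m B').
  by rewrite /B' !mulmxA mul_adj2 -mulmxA mul_scalar_mx scalerA mulVf ?scale1r.
clearbody B'.
have : det2 B' != 0 by rewrite dB' mulf_neq0 ?expf_neq0.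
rewrite /det2 b00 mul0r sub0r oppr_eq0 mulf_eq0 negb_or => /andP[p0 q0].
set p : C := B' 0 1 in p0; set q : C := B' 1 0 in q0.
(* Conjugation by diag(r, 1) turns the antidiagonal entries p, q into p / r, q r, which are opposite
   when r^2 = - p / q. *)
pose r := sqrtC (- p / q).
have rr : r ^+ 2 = - p / q by rewrite sqrtCK.
have r0 : r != 0 by rewrite sqrtC_eq0 mulf_neq0 ?oppr_eq0 ?invr_eq0.
exists (P *m mx2 r 0 0 1), (l / 'i), (- (q * r) / det2 P); split.
- by rewrite -/(det2 _) det2M mulf_neq0 // /det2 !mx2_entries mulr1 mul0r subr0.
- by rewrite mulf_neq0 ?invr_eq0 ?neq0Ci.
- by rewrite mulf_neq0 ?invr_eq0 ?oppr_eq0 ?mulf_neq0.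
- rewrite mulmxA e -!mulmxA; congr (_ *m _).
  have li : l / 'i * 'i = l by rewrite divfK ?neq0Ci.
  apply: eq_mx2; rewrite !mul2E !(mx2_entries, scale2E) ?mulrN ?li; ring.
- rewrite mulmxA eB -scalemxAl -!mulmxA -mulmx_scale2; congr (_ *m _).
  have ep : p = - (q * r ^+ 2) by rewrite rr; field.
  apply: eq_mx2; rewrite !(scale2E, mul2E, mx2_entries) ?b00 ?b11 -/p -/q ?ep; ring.
Qed.

(** By Cayley-Hamilton a traceless matrix has a scalar square: every nontrivial stabiliser is an
    involution of the projective line. *)
Definition traceless_stab f := forall A, stab f A -> nonscalar A -> tr2 A = 0.

Definition Q (i : 'I_3) : 'M[C]_2 :=
  if i == 0 then QI else if i == 1 then QJ else QK.

Lemma det2Q i : det2 (Q i) = 1.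
Proof.
rewrite /Q; case: ifP => _; last case: ifP => _; rewrite /det2 !mx2_entries.
- by rewrite mulrN ii mulr0 opprK subr0.
- by rewrite mulr0 mul1r opprK add0r.
- by rewrite ii mulr0 opprK add0r.
Qed.

Lemma tr2Q i : tr2 (Q i) = 0.
Proof.
by rewrite /Q; case: ifP => _; last case: ifP => _; rewrite /tr2 !mx2_entries ?addr0 ?subrr.
Qed.

(** If A is a multiple of neither [QI] nor [QJ], its products with both are nonscalar stabilisers.
    So A is orthogonal to 1, [QI] and [QJ] for the trace form, which leaves the line of [QK]. *)
Lemma klein_stab f A : traceless_stab f -> stab f QI -> stab f QJ -> stab f A ->
  nonscalar A -> exists i e, A = e *: Q i.
Proof.
move=> T sI sJ sA nA; have tA := T _ sA nA.
have i0 : ('i : C) != 0 by rewrite neq0Ci.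
have sum0 (x y : C) : x + y = 0 -> x - y = 0 -> x = 0.
  move=> h1 h2; have : x *+ 2 = 0 by rewrite mulr2n -[RHS](addr0 0) -{1}h1 -h2; ring.
  by move/eqP; rewrite mulrn_eq0 => /eqP.
case: (boolp.pselect (exists c : C, QI *m A = c%:M)) => [[c ec]|H].
  exists 0, (- c); have := congr1 (mulmx QI) ec; rewrite mulmxA mul_mx_scalar.
  have -> : QI *m QI = (-1)%:M.
    have [e1 e2 e3 e4] := scalar2E (-1 : C).
    by apply: eq_mx2; rewrite ?e1 ?e2 ?e3 ?e4 mul2E !mx2_entries ?mulrNN ?ii; ring.
  by rewrite mul_scalar_mx scaleN1r scaleNr => <-; rewrite opprK.
have n1 : nonscalar (QI *m A) by move=> c ec; apply: H; exists c.
have := T _ (stab_mul sI sA) n1; rewrite /tr2 !mul2E !mx2_entries !mul0r addr0 add0r mulNr -mulrBr.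
move/eqP; rewrite mulf_eq0 (negPf i0) /= => /eqP dd.
have a00 : A 0 0 = 0 := sum0 _ _ tA dd.
have a11 : A 1 1 = 0 by move/eqP: tA; rewrite /tr2 a00 add0r => /eqP.
case: (boolp.pselect (exists c : C, QJ *m A = c%:M)) => [[c ec]|H'].
  exists 1, (- c); have := congr1 (mulmx QJ) ec; rewrite mulmxA mul_mx_scalar.
  have -> : QJ *m QJ = (-1)%:M.
    have [e1 e2 e3 e4] := scalar2E (-1 : C).
    by apply: eq_mx2; rewrite ?e1 ?e2 ?e3 ?e4 mul2E !mx2_entries; ring.
  by rewrite mul_scalar_mx scaleN1r scaleNr => <-; rewrite opprK.
have n2 : nonscalar (QJ *m A) by move=> c ec; apply: H'; exists c.
have := T _ (stab_mul sJ sA) n2; rewrite /tr2 !mul2E !mx2_entries !mul0r addr0 add0r mulN1r mul1r.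
move/eqP; rewrite subr_eq0 => /eqP e10.
exists 2, (A 0 1 / 'i).
by apply: eq_mx2; rewrite scale2E /Q /= !mx2_entries ?a00 ?a11 ?mulr0 ?divfK.
Qed.

End Stabilizers.

(** * Stabilisers made of involutions; the antipalindromic case *)

Section KleinCases.

Variable C : numClosedFieldType.
Implicit Types (f g h : {poly C}) (M N A B P : 'M[C]_2) (s t x : C).

Variables (F : divringClosed C) (S : {rmorphism C -> C} -> Prop).
Hypothesis fixF : forall z, (forall sigma, S sigma -> sigma z = z) -> z \in F.

Local Notation conj_equiv := (conj_equiv S).
Local Notation descends := (descends F).

Lemma eq_oppr0 x : x = - x -> x = 0.
Proof. by move/esym/eqP; rewrite eqNr => /eqP. Qed.

(** A unipotent part is excluded by [translation_not_stab]. For eigenvalues l and m, the ratio -1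
    means trace zero, and any other ratio is covered by [diagonal_descends]. *)
Lemma stab_trace f A : octic f -> conj_equiv f -> stab f A -> nonscalar A ->
  tr2 A = 0 \/ descends f.
Proof.
move=> oF H sA nA; have [P [l [m [dP slm plm HP]]]] := triangularize nA.
have eP := equiv_act f dP.
have oP : octic (act P f) := octic_equiv oF (size_act _ _) eP.
have HcP : conj_equiv (act P f) := conj_equiv_trans oF eP H.
case: HP => [[lm e]|[_ e]]; last by case: (@translation_not_stab _ (act P f) l oP); apply: stab_conj sA.
case: (stab_conj dP e sA) => dlm [k ek].
move: dlm; rewrite /det2 !mx2_entries mul0r subr0 mulf_eq0 negb_or => /andP[l0 m0].
case: (eqVneq (l / m) (-1)) => [lmN|lmN].
  left; rewrite -slm -(mulfK m0 l) -[l * m / m]mulrAC lmN; ring.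
right; apply: (descends_equiv eP); apply: (diagonal_descends fixF oP HcP _ lmN (k := m ^- 8 * k)).
- by apply: contraNneq lm => lm1; rewrite -(mulfK m0 l) mulrAC lm1 mul1r.
- have -> : mx2 (l / m) 0 0 1 = m^-1 *: mx2 l 0 0 m.
    by apply: eq_mx2; rewrite scale2E !mx2_entries ?mulr0 // ?mulVf // mulrC.
  by rewrite act_scale ek scalerA exprVn.
- by rewrite mulf_neq0 ?invr_eq0.
Qed.

Lemma traceless_or_descends f : octic f -> conj_equiv f ->
  traceless_stab f \/ descends f.
Proof.
move=> oF H; case: (boolp.pselect (descends f)) => [|nd]; [by right|left].
by move=> A sA nA; case: (stab_trace oF H sA nA).
Qed.

Lemma stab_inv f g M (k : C) B : (size f <= 9)%N -> det2 M != 0 -> k != 0 -> act M f = k *: g ->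
  stab g B -> stab f (M *m B *m adj2 M).
Proof.
move=> f9 dM k0 e [dB [l el]]; split; first by rewrite !det2M det2_adj !mulf_neq0.
exists (det2 M ^+ 8 * l); rewrite -!act_comp e actZ el scalerA mulrC -scalerA -e actZ.
by rewrite act_comp mul_adj2 act_scalar // scalerA mulrC.
Qed.

Lemma tr2_conj M B : tr2 (M *m B *m adj2 M) = det2 M * tr2 B.
Proof. by rewrite /tr2 !mul2E !mx2_entries /det2; ring. Qed.

Lemma nonscalar_conj M B : det2 M != 0 -> nonscalar B -> nonscalar (M *m B *m adj2 M).
Proof.
move=> dM nB c ec; apply: (nB (c / det2 M)).
have : adj2 M *m (M *m B *m adj2 M) *m M = det2 M ^+ 2 *: B.
  by rewrite !mulmxA adj_mul2 -mulmxA adj_mul2 mul_scalar_mx mul_mx_scalar scalerA expr2.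
rewrite ec mul_mx_scalar -scalemxAl adj_mul2 => /(congr1 (fun X => det2 M ^- 2 *: X)).
rewrite [RHS]scalerA mulVf ?expf_neq0 // scale1r => <-.
by rewrite !scale_scalar_mx; congr (_%:M); field.
Qed.

Lemma traceless_equiv f g : (size f <= 9)%N -> equiv f g -> traceless_stab f -> traceless_stab g.
Proof.
move=> f9 [M [k [dM k0 e]]] T B sB nB.
have := T _ (stab_inv f9 dM k0 e sB) (nonscalar_conj dM nB).
by rewrite tr2_conj => /eqP; rewrite mulf_eq0 (negPf dM) => /eqP.
Qed.

Lemma sign_sub8 k : (k < 9)%N -> (-1) ^+ (8 - k) = (-1) ^+ k :> C.
Proof.
by case: k => [|[|[|[|[|[|[|[|[|//]]]]]]]]] _; rewrite -[LHS]signr_odd -[RHS]signr_odd.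
Qed.

Lemma act_QI f : act (QI C) f = \poly_(k < 9) ((-1) ^+ k * f`_k).
Proof.
rewrite act_diag; apply: eq_octic => [||k k9]; rewrite ?size_poly // !coef_poly k9.
have i4 : ('i : C) ^+ 4 = 1 by rewrite (exprM _ 2 2) sqrCi sqrrN expr1n.
have i8 : ('i : C) ^+ 8 = 1 by rewrite (exprM _ 4 2) i4 expr1n.
have k8 : (k <= 8)%N := k9.
have e : ('i : C) ^+ k * (- 'i) ^+ (8 - k) = (-1) ^+ k.
  rewrite -[- 'i]mulN1r exprMn mulrCA -exprD subnKC // i8 mulr1.
  exact: sign_sub8.
by rewrite -mulrA e mulrC.
Qed.

Lemma act_QJ f : act (QJ C) f = \poly_(k < 9) ((-1) ^+ k * f`_(8 - k)).
Proof.
rewrite act_antidiag; apply: eq_octic => [||k k9]; rewrite ?size_poly // !coef_poly k9.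
by rewrite expr1n mulr1 mulrC.
Qed.

Lemma det2_QI : det2 (QI C) = 1. Proof. exact: (det2Q C 0). Qed.
Lemma det2_QJ : det2 (QJ C) = 1. Proof. exact: (det2Q C 1). Qed.

Definition antipalindrome a : {poly C} := 'X^8 + a *: 'X^6 - a *: 'X^2 - 'X^0.

Lemma coef_antipalindrome a k : (antipalindrome a)`_k =
  (k == 8)%:R + a * (k == 6)%:R - a * (k == 2)%:R - (k == 0)%:R.
Proof. by rewrite /antipalindrome !(coefB, coefD, coefZ, coefXn). Qed.

Lemma size_antipalindrome a : (size (antipalindrome a) <= 9)%N.
Proof.
apply/leq_sizeP => -[|[|[|[|[|[|[|[|[|k]]]]]]]]] // _.
by rewrite coef_antipalindrome /=; ring.
Qed.

Lemma stab_antipalindrome a : stab (antipalindrome a) (QI C) /\ stab (antipalindrome a) (QJ C).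
Proof.
split; split; rewrite ?det2_QI ?det2_QJ ?oner_neq0 //.
  exists 1; rewrite scale1r act_QI; apply: eq_octic; rewrite ?size_poly ?size_antipalindrome //.
  by move=> [|[|[|[|[|[|[|[|[|//]]]]]]]]] _; rewrite coef_poly !coef_antipalindrome /=; ring.
exists (-1); rewrite act_QJ; apply: eq_octic; rewrite ?size_poly //.
  by rewrite (leq_trans (size_scale_leq _ _)) ?size_antipalindrome.
by move=> [|[|[|[|[|[|[|[|[|//]]]]]]]]] _; rewrite coef_poly coefZ !coef_antipalindrome /=; ring.
Qed.

Lemma hev_antipalindrome a s t : hev (antipalindrome a) s t =
  s ^+ 8 + a * s ^+ 6 * t ^+ 2 - a * s ^+ 2 * t ^+ 6 - t ^+ 8.
Proof.
rewrite /hev !big_ord_recl big_ord0 !coef_antipalindrome /=; ring.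
Qed.

(** Zeros of these forms include the fixed points of [QJ] and [QK], but not 0 and infinity, which
    are those of [QI]. So an equivalence carries [QI] to itself up to a scalar, its matrix is
    diagonal or antidiagonal, and the coefficients give a^2 = b^2. *)
Lemma antipalindrome_rigid a b : octic (antipalindrome a) ->
  traceless_stab (antipalindrome a) ->
  equiv (antipalindrome a) (antipalindrome b) -> a ^+ 2 = b ^+ 2.
Proof.
move=> oF T e; have T' := traceless_equiv (size_antipalindrome a) e T.
have [M [k [dM k0 {}e]]] := e.
have [sI _] := stab_antipalindrome a; have [sI' sJ'] := stab_antipalindrome b.
pose B := (det2 M)^-1 *: (adj2 M *m QI C *m M).
have eB : QI C *m M = M *m B.
  by rewrite /B -scalemxAr !mulmxA mul_adj2 -mulmxA mul_scalar_mx scalerA mulVf ?scale1r.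
have sB : stab (antipalindrome b) B.
  have [dB [l el]] := stab_conj dM eB sI; split=> //; exists l.
  by move: el; rewrite e actZ scalerA mulrC -scalerA => /(scalerI k0).
have nB : nonscalar B.
  apply: traceless_nonscalar sB.1 _.
  rewrite /B /tr2 !scale2E -mulrDr !mul2E !mx2_entries; ring.
have [i [c ec]] := klein_stab T' sI' sJ' sB nB.
have i0 : ('i : C) != 0 by rewrite neq0Ci.
rewrite ec in eB.
have m00 := congr1 (fun X : 'M[C]_2 => X 0 0) eB.
have m01 := congr1 (fun X : 'M[C]_2 => X 0 1) eB.
have m10 := congr1 (fun X : 'M[C]_2 => X 1 0) eB.
have m11 := congr1 (fun X : 'M[C]_2 => X 1 1) eB.
rewrite /= !(mul2E, scale2E) !mx2_entries !mul0r ?addr0 ?add0r in m00 m01 m10 m11.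
have c1 (x : C) : 'i * x = c * 'i * x -> c != 1 -> x = 0.
  move=> h cn; apply/eqP; apply: contraNT cn => x0; apply/eqP.
  by apply: (mulIf i0); apply: (mulIf x0); rewrite mul1r.
have cN1 (x : C) : - 'i * x = c * 'i * x -> c != -1 -> x = 0.
  move=> h cn; apply/eqP; apply: contraNT cn => x0; apply/eqP.
  by apply: (mulIf i0); apply: (mulIf x0); rewrite mulN1r.
case: (eqVneq i 0) ec eB m00 m01 m10 m11 => [->|ni] ec eB m00 m01 m10 m11.
  rewrite /Q /= !mx2_entries in m00 m01 m10 m11.
  case: (eqVneq c 1) => cc.
    have {}m01 : M 0 1 = 0 by apply: (mulfI i0); rewrite mulr0; apply: eq_oppr0; rewrite {1}m01 cc; ring.
    have {}m10 : M 1 0 = 0 by apply: (mulfI i0); rewrite mulr0; apply: eq_oppr0; rewrite -mulNr m10 cc; ring.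
    have eM : M = mx2 (M 0 0) 0 0 (M 1 1) by apply: eq_mx2; rewrite !mx2_entries.
    rewrite eM act_diag in e.
    have hk i0 := congr1 (fun p : {poly C} => p`_i0) e.
    have := (hk 8%N, hk 6%N, hk 2%N, hk 0%N).
    rewrite /= !coef_poly !coefZ !coef_antipalindrome /= -[(8 - 8)%N]/0%N -[(8 - 6)%N]/2%N -[(8 - 2)%N]/6%N -[(8 - 0)%N]/8%N.
    move=> [[[h8 h6] h2] h0]; set p := M 0 0 in h8 h6 h2 h0; set q := M 1 1 in h8 h6 h2 h0.
    have {}h8 : p ^+ 8 = k by apply: etrans (etrans _ h8) _; ring.
    have {}h6 : a * p ^+ 6 * q ^+ 2 = k * b by apply: etrans (etrans _ h6) _; ring.
    have {}h2 : - a * p ^+ 2 * q ^+ 6 = - (k * b) by apply: etrans (etrans _ h2) _; ring.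
    have {}h0 : - q ^+ 8 = - k by apply: etrans (etrans _ h0) _; ring.
    apply: (mulfI (mulf_neq0 k0 k0)); transitivity ((k * b) * - - (k * b)); last by ring.
    by rewrite -h2 -h6 -{1}h8 -[k]opprK -h0; ring.
  have {}m00 : M 0 0 = 0 by apply: c1 cc; rewrite m00; ring.
  have {}m11 : M 1 1 = 0.
    by apply: c1 cc; apply: oppr_inj; rewrite -mulNr m11; ring.
  have eM : M = mx2 0 (M 0 1) (M 1 0) 0 by apply: eq_mx2; rewrite !mx2_entries.
  rewrite eM act_antidiag in e.
  have hk i0 := congr1 (fun p : {poly C} => p`_i0) e.
  have := (hk 8%N, hk 6%N, hk 2%N, hk 0%N).
  rewrite /= !coef_poly !coefZ /= -[(8 - 8)%N]/0%N -[(8 - 6)%N]/2%N -[(8 - 2)%N]/6%N -[(8 - 0)%N]/8%N !coef_antipalindrome /=.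
  move=> [[[h8 h6] h2] h0]; set p := M 0 1 in h8 h6 h2 h0; set q := M 1 0 in h8 h6 h2 h0.
  have {}h8 : - q ^+ 8 = k by apply: etrans (etrans _ h8) _; ring.
  have {}h6 : - a * p ^+ 2 * q ^+ 6 = k * b by apply: etrans (etrans _ h6) _; ring.
  have {}h2 : a * p ^+ 6 * q ^+ 2 = - (k * b) by apply: etrans (etrans _ h2) _; ring.
  have {}h0 : p ^+ 8 = - k by apply: etrans (etrans _ h0) _; ring.
  apply: (mulfI (mulf_neq0 k0 k0)); transitivity (- ((k * b) * - (k * b))); last by ring.
  by rewrite -h2 -h6 -{1}h8 -[k]opprK -h0; ring.
(* Otherwise a fixed point of [Q i] which is a zero of the target is sent to an eigenvector of [QI]
   which is a zero of the source. Neither 0 nor infinity is such a zero. *)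
have [p1 [p2 [pn0 hp qp]]] : exists p1 p2, [/\ (p1 != 0) || (p2 != 0), hev (antipalindrome b) p1 p2 = 0 &
   (Q C i) 0 0 * p1 + (Q C i) 0 1 * p2 = 'i * p1 /\ (Q C i) 1 0 * p1 + (Q C i) 1 1 * p2 = 'i * p2].
  rewrite /Q (negPf ni); case: ifP => _; [exists 1, 'i|exists 1, 1].
    rewrite oner_neq0 hev_antipalindrome !mx2_entries.
    have i6 : ('i : C) ^+ 6 = -1 by rewrite (exprM _ 2 3) sqrCi; ring.
    have i8 : ('i : C) ^+ 8 = 1 by rewrite (exprM _ 2 4) sqrCi; ring.
    rewrite i6 i8 sqrCi.
    by split=> //; [ring|split; rewrite ?mulr1 ?ii ?mul0r; ring].
  by rewrite oner_neq0 hev_antipalindrome !mx2_entries; split=> //; [ring|split; ring].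
pose w1 := M 0 0 * p1 + M 0 1 * p2; pose w2 := M 1 0 * p1 + M 1 1 * p2.
have hw : hev (antipalindrome a) w1 w2 = 0 by rewrite -hev_act e hev_scale hp mulr0.
have [q0 q1] := qp.
have e1 : 'i * w1 = c * 'i * w1.
  transitivity (c * (M 0 0 * ('i * p1) + M 0 1 * ('i * p2))); last by rewrite /w1; ring.
  by transitivity (('i * M 0 0) * p1 + ('i * M 0 1) * p2); [rewrite /w1; ring|rewrite m00 m01 -q0 -q1; ring].
have e2 : - 'i * w2 = c * 'i * w2.
  transitivity (c * (M 1 0 * ('i * p1) + M 1 1 * ('i * p2))); last by rewrite /w2; ring.
  by transitivity ((- 'i * M 1 0) * p1 + (- 'i * M 1 1) * p2); [rewrite /w2; ring|rewrite m10 m11 -q0 -q1; ring].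
have z (x : C) : x ^+ 8 = 0 -> x = 0 by move/eqP; rewrite expf_eq0 => /eqP.
have [w10 w20] : w1 = 0 /\ w2 = 0.
  rewrite hev_antipalindrome in hw.
  case: (eqVneq c 1) => cc.
    have w20 : w2 = 0 by apply: cN1 e2 _; rewrite cc -subr_eq0 opprK (pnatr_eq0 C 2).
    split=> //; apply: z; rewrite -[RHS]hw w20; ring.
  have w10 := c1 _ e1 cc; split=> //; apply: z; apply: oppr_inj; rewrite oppr0 -[RHS]hw w10; ring.
have d1 : det2 M * p1 = 0 by transitivity (M 1 1 * w1 - M 0 1 * w2); [rewrite /w1 /w2 /det2; ring|rewrite w10 w20; ring].
have d2 : det2 M * p2 = 0 by transitivity (M 0 0 * w2 - M 1 0 * w1); [rewrite /w1 /w2 /det2; ring|rewrite w10 w20; ring].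
have p10 : p1 = 0 by apply: (mulfI dM); rewrite mulr0.
have p20 : p2 = 0 by apply: (mulfI dM); rewrite mulr0.
by rewrite p10 p20 eqxx in pn0.
Qed.

(** Only a^2 is invariant, so x is scaled by a square root of 1 / a; with t = 1 / a^2 the form
    becomes t^2 x^8 + t x^6 - x^2 - 1. *)
Lemma antipalindrome_descends a : octic (antipalindrome a) ->
  conj_equiv (antipalindrome a) -> traceless_stab (antipalindrome a) ->
  descends (antipalindrome a).
Proof.
move=> oF H T; case: (eqVneq a 0) => [a0|a0].
  have e : antipalindrome a = 1 *: 'X^8 + (-1) *: 'X^0.
    by rewrite /antipalindrome a0 !scale0r addr0 subr0 scale1r scaleN1r.
  by rewrite e in oF *; apply: binomial_descends; rewrite ?oppr_eq0 ?oner_neq0.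
pose t := (a ^+ 2)^-1.
have tF : t \in F.
  apply: fixF => sigma Ss; have := H _ Ss.
  have -> : map_poly sigma (antipalindrome a) = antipalindrome (sigma a).
    by rewrite /antipalindrome !rmorphB !rmorphD /= !map_polyZ !map_polyXn.
  by move/(antipalindrome_rigid oF T) => e; rewrite /t fmorphV rmorphXn /= -e.
pose g : {poly C} := t ^+ 2 *: 'X^8 + t *: 'X^6 - 'X^2 - 'X^0.
have g9 : (size g <= 9)%N.
  apply/leq_sizeP => -[|[|[|[|[|[|[|[|[|k]]]]]]]]] // _.
  by rewrite /g !(coefB, coefD, coefZ, coefXn) /=; ring.
pose s := sqrtC a^-1.
have ss : s ^+ 2 = a^-1 by rewrite sqrtCK.
have e : equiv (antipalindrome a) g.
  exists (mx2 s 0 0 1), 1; rewrite scale1r oner_neq0 /det2 !mx2_entries mulr1 mul0r subr0.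
  split=> //; first by rewrite sqrtC_eq0 invr_eq0.
  rewrite act_diag; apply: eq_octic; rewrite ?size_poly // => k k9.
  rewrite coef_poly k9 coef_antipalindrome expr1n mulr1 /g !(coefB, coefD, coefZ, coefXn) /t.
  have s8 : s ^+ 8 = (a ^+ 4)^-1 by rewrite (exprM _ 2 4) ss exprVn.
  have s6 : s ^+ 6 = (a ^+ 3)^-1 by rewrite (exprM _ 2 3) ss exprVn.
  case: k k9 => [|[|[|[|[|[|[|[|[|//]]]]]]]]] _; rewrite /= ?s8 ?s6 ?ss; field; exact: a0.
exists g; split=> //; first exact: octic_equiv oF g9 e.
by rewrite /g !rpredB ?rpredD ?polyOverXn // polyOverZ ?polyOverXn ?rpredX.
Qed.

Lemma even_antipalindromic_descends f : octic f -> conj_equiv f -> traceless_stab f ->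
  (forall k, (k < 9)%N -> (-1) ^+ k * f`_k = f`_k) ->
  (forall k, (k < 9)%N -> f`_(8 - k) = - f`_k) -> descends f.
Proof.
move=> oF H T ev ap.
have od k : (k < 9)%N -> odd k -> f`_k = 0.
  by move=> k9 ok; apply: eq_oppr0; rewrite -{1}ev // -signr_odd ok expr1 mulN1r.
have f8 : f`_8 != 0.
  have := octic_coef_high oF; case/orP => //; by rewrite od // eqxx.
have e : f = f`_8 *: antipalindrome (f`_6 / f`_8).
  apply: eq_octic; first exact: octic_size.
    by rewrite (leq_trans (size_scale_leq _ _)) ?size_antipalindrome.
  have f0 : f`_0 = - f`_8 by rewrite -(ap 8%N).
  have f2 : f`_2 = - f`_6 by rewrite -(ap 6%N).
  have f4 : f`_4 = 0 by apply: eq_oppr0; rewrite -(ap 4%N).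
  case=> [|[|[|[|[|[|[|[|[|//]]]]]]]]] _; rewrite coefZ coef_antipalindrome /= ?f0 ?f2 ?f4 ?(od 1%N) ?(od 3%N) ?(od 5%N) ?(od 7%N) //; field; exact: f8.
have f9 := octic_size oF.
have e' : equiv f (antipalindrome (f`_6 / f`_8)).
  move: e; set a := f`_6 / f`_8; set c := f`_8 in f8 * => e.
  have -> : antipalindrome a = c^-1 *: f by rewrite e scalerA mulVf ?scale1r.
  by apply: equiv_scale; rewrite ?invr_eq0.
have o' := octic_equiv oF (size_antipalindrome _) e'.
apply: (descends_equiv e'); apply: antipalindrome_descends => //.
  exact: conj_equiv_trans oF e' H.
exact: traceless_equiv f9 e' T.
Qed.

(** The matrix U of x -> (x + 1) / (x - 1) exchanges x -> -x and x -> 1/x. It turns an odd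
    palindromic form into an even antipalindromic one. *)
Lemma odd_descends f (k : C) : octic f -> conj_equiv f -> traceless_stab f ->
  (forall i, (i < 9)%N -> (-1) ^+ i * f`_i = - f`_i) ->
  (forall i, (i < 9)%N -> (-1) ^+ i * f`_(8 - i) = k * f`_i) -> k ^+ 2 = 1 -> descends f.
Proof.
move=> oF H T od pal k2.
have ev i : (i < 9)%N -> ~~ odd i -> f`_i = 0.
  by move=> i9 oi; apply: eq_oppr0; rewrite -od // -signr_odd (negPf oi) expr0 mul1r.
have f9 := octic_size oF.
(* Either f is palindromic already, or f(ix) is. *)
pose r : C := if k == -1 then 1 else 'i.
pose f1 := act (mx2 r 0 0 1) f.
have r4 : r ^+ 4 = 1 by rewrite /r; case: ifP => _; rewrite ?expr1n // (exprM _ 2 2) sqrCi sqrrN expr1n.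
have r0 : r != 0 by rewrite /r; case: ifP => _; rewrite ?oner_neq0 ?neq0Ci.
have rk : r ^+ 2 = - k.
  rewrite /r; case: eqP => [->|/eqP kn]; first by rewrite expr1n opprK.
  rewrite sqrCi; move/eqP: k2; rewrite sqrf_eq1 (negPf kn) orbF => /eqP ->.
  by [].
have c1 i : (i < 9)%N -> f1`_i = f`_i * r ^+ i.
  by move=> i9; rewrite /f1 act_diag coef_poly i9 expr1n mulr1.
have pal1 : act (swap2 C) f1 = f1.
  rewrite /swap2 act_antidiag; apply: eq_octic; rewrite ?size_poly ?size_act // => i i9.
  rewrite coef_poly i9 !expr1n !mulr1 !c1 ?ltnS ?leq_subr //.
  case: (boolP (odd i)) => oi; last first.
    by rewrite !ev ?mul0r // ?ltnS ?leq_subr // oddB.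
  have e : f`_(8 - i) = - k * f`_i.
    by rewrite mulNr -pal // -signr_odd oi expr1 mulN1r opprK.
  rewrite e -rk mulrAC -exprD mulrC; congr (_ * _).
  rewrite -[LHS](expr_mod _ r4) -[RHS](expr_mod _ r4).
  by case: i i9 oi {e} => [|[|[|[|[|[|[|[|[|//]]]]]]]]].
have od1 : act (mx2 1 0 0 (-1)) f1 = - f1.
  rewrite act_diag; apply: eq_octic; rewrite ?size_poly ?size_polyN ?size_act // => i i9.
  by rewrite coef_poly i9 coefN c1 // expr1n mulr1 sign_sub8 // mulrAC [f`_i * (-1) ^+ i]mulrC od // mulNr.
pose U : 'M[C]_2 := mx2 1 1 1 (-1); pose g := act U f1.
have dU : det2 U != 0 by rewrite /det2 !mx2_entries mulrN !mulr1 -opprD oppr_eq0 -mulr2n mulrn_eq0 oner_eq0.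
have dr : det2 (mx2 r 0 0 1) != 0 by rewrite /det2 !mx2_entries mulr1 mul0r subr0.
have eg : equiv f g by apply: equiv_trans (equiv_act _ dr) (equiv_act _ dU).
have og : octic g := octic_equiv oF (size_act _ _) eg.
apply: (descends_equiv eg); apply: even_antipalindromic_descends => //.
- exact: conj_equiv_trans oF eg H.
- exact: traceless_equiv f9 eg T.
- have e : act (mx2 1 0 0 (-1)) g = g.
    rewrite /g act_comp; have -> : U *m mx2 1 0 0 (-1) = swap2 C *m U.
      by apply: eq_mx2; rewrite !mul2E !mx2_entries; ring.
    by rewrite -act_comp pal1.
  move=> i i9; have := congr1 (fun p : {poly C} => p`_i) e.
  rewrite /= act_diag coef_poly i9 expr1n mulr1 mulrC => {2}<-; congr (_ * _).
  by rewrite sign_sub8.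
have e : act (swap2 C) g = - g.
  rewrite /g act_comp; have -> : U *m swap2 C = mx2 1 0 0 (-1) *m U.
    by apply: eq_mx2; rewrite !mul2E !mx2_entries; ring.
  by rewrite -act_comp od1 -scaleN1r actZ scaleN1r.
move=> i i9; have := congr1 (fun p : {poly C} => p`_i) e.
by rewrite /= /swap2 act_antidiag coef_poly i9 !expr1n !mulr1 coefN.
Qed.

End KleinCases.

(** * Sums of fourth powers of the forms of three involutions *)

Section TernaryForms.

Variable C : numClosedFieldType.
Implicit Types (f g h : {poly C}) (M N P : 'M[C]_2) (s t x : C).
Implicit Types (c d e : 'I_3 -> C) (A B : 'I_3 -> 'M[C]_2).

(* The quadratic form vanishing at the fixed points of [M] on the projective line. *)
Definition fixed_form M s t := M 1 0 * s ^+ 2 + (M 1 1 - M 0 0) * s * t - M 0 1 * t ^+ 2.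

Definition fixed_poly M : {poly C} := M 1 0 *: 'X^2 + (M 1 1 - M 0 0) *: 'X - (M 0 1)%:P.

Definition quartic_sum c A : {poly C} := \sum_i c i *: fixed_poly (A i) ^+ 4.

Lemma size_fixed_poly M : (size (fixed_poly M) <= 3)%N.
Proof.
apply/leq_sizeP => -[|[|[|k]]] // _.
by rewrite !(coefB, coefD, coefZ, coefXn, coefX, coefC) /=; ring.
Qed.

Lemma size_quartic_sum c A : (size (quartic_sum c A) <= 9)%N.
Proof.
apply/(leq_trans (size_sum _ _ _))/bigmax_leqP => i _.
apply: leq_trans (size_scale_leq _ _) _; apply: leq_trans (size_poly_exp_leq _ _) _.
have := size_fixed_poly (A i); case: size => [|[|[|[|n]]]] //.
Qed.

Lemma hev_quartic_sum c A s t :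
  hev (quartic_sum c A) s t = \sum_i c i * fixed_form (A i) s t ^+ 4.
Proof.
pose q M : {poly C} := (M 1 0 * s ^+ 2)%:P + ((M 1 1 - M 0 0) * s) *: 'X - M 0 1 *: 'X^2.
have qE M y : (q M).[y] = fixed_form M s y.
  by rewrite /q !(hornerD, hornerN, hornerZ, hornerC, hornerX, hornerXn).
pose p : {poly C} := \sum_i c i *: q (A i) ^+ 4.
have pE y : p.[y] = \sum_i c i * fixed_form (A i) s y ^+ 4.
  by rewrite horner_sum; apply: eq_bigr => i _; rewrite hornerZ horner_exp qE.
pose r : {poly C} := \sum_(k < 9) ((quartic_sum c A)`_k * s ^+ k) *: 'X ^+ (8 - k).
have rE y : r.[y] = hev (quartic_sum c A) s y.
  by rewrite horner_sum; apply: eq_bigr => k _; rewrite hornerZ hornerXn.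
rewrite -pE -rE; congr (_.[_]); apply/eqP; rewrite -subr_eq0; apply/eqP.
apply: (@poly_eq0_generic _ 'X) => [|y]; rewrite ?polyX_eq0 // hornerX => y0.
rewrite hornerD hornerN pE rE hev_dehom ?size_quartic_sum //.
rewrite horner_sum mulr_sumr -sumrB big1 // => i _.
rewrite hornerZ horner_exp !(hornerD, hornerN, hornerZ, hornerC, hornerX, hornerXn) /fixed_form.
field; exact: y0.
Qed.

(** The form attached to N is the determinant of the pair (v, N v) for v = (s, t), and det(M v, N M
    v) = det(M v, M P v). *)
Lemma fixed_form_conj M N P s t : N *m M = M *m P ->
  fixed_form N (M 0 0 * s + M 0 1 * t) (M 1 0 * s + M 1 1 * t) = det2 M * fixed_form P s t.
Proof.
move=> e.
have e00 := congr1 (fun X : 'M[C]_2 => X 0 0) e.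
have e01 := congr1 (fun X : 'M[C]_2 => X 0 1) e.
have e10 := congr1 (fun X : 'M[C]_2 => X 1 0) e.
have e11 := congr1 (fun X : 'M[C]_2 => X 1 1) e.
rewrite /= !mul2E in e00 e01 e10 e11.
transitivity ((M 0 0 * s + M 0 1 * t) * ((N 1 0 * M 0 0 + N 1 1 * M 1 0) * s + (N 1 0 * M 0 1 + N 1 1 * M 1 1) * t)
  - (M 1 0 * s + M 1 1 * t) * ((N 0 0 * M 0 0 + N 0 1 * M 1 0) * s + (N 0 0 * M 0 1 + N 0 1 * M 1 1) * t)).
  by rewrite /fixed_form; ring.
by rewrite e00 e01 e10 e11 /fixed_form /det2; ring.
Qed.

Lemma act_quartic_sum M c A B : (forall i, A i *m M = M *m B i) ->
  act M (quartic_sum c A) = det2 M ^+ 4 *: quartic_sum c B.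
Proof.
move=> H; apply: hev_inj; rewrite ?size_act ?(leq_trans (size_scale_leq _ _)) ?size_quartic_sum // => x.
rewrite hev_act hev_scale !hev_quartic_sum mulr_sumr; apply: eq_bigr => i _.
by rewrite (fixed_form_conj x 1 (H i)) exprMn mulrCA.
Qed.

Lemma quartic_sum_scale c e A : quartic_sum c (fun i => e i *: A i) =
  quartic_sum (fun i => c i * e i ^+ 4) A.
Proof.
apply: eq_bigr => i _.
have -> : fixed_poly (e i *: A i) = e i *: fixed_poly (A i).
  by rewrite /fixed_poly !scale2E -!mul_polyC !polyCM polyCB !polyCM; ring.
by rewrite exprZn scalerA.
Qed.

Lemma quartic_sumZ k c A : k *: quartic_sum c A = quartic_sum (fun i => k * c i) A.
Proof. by rewrite scaler_sumr; apply: eq_bigr => i _; rewrite scalerA. Qed.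

Lemma eq_quartic_sum c d A B : c =1 d -> A =1 B -> quartic_sum c A = quartic_sum d B.
Proof. by move=> ec eA; apply: eq_bigr => i _; rewrite ec eA. Qed.

Lemma quartic_sum_reindex c A (u : 'I_3 -> 'I_3) : injective u ->
  quartic_sum (fun i => c (u i)) (fun i => A (u i)) = quartic_sum c A.
Proof. by move=> uI; rewrite /quartic_sum [RHS](reindex_inj uI). Qed.

Lemma sum3 (V : zmodType) (E : 'I_3 -> V) : \sum_i E i = E 0 + E 1 + E 2.
Proof.
rewrite !big_ord_recl big_ord0 addr0 addrA; congr (E _ + E _ + E _); exact/val_inj.
Qed.

Lemma ord3 (i : 'I_3) : [\/ i = 0, i = 1 | i = 2].
Proof.
by case: i => -[|[|[|//]]] h; [apply: Or31|apply: Or32|apply: Or33]; apply/val_inj.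
Qed.

Lemma i4 : ('i : C) ^+ 4 = 1. Proof. by rewrite (exprM _ 2 2) sqrCi sqrrN expr1n. Qed.

Lemma quartic_sumQE c : quartic_sum c (Q C) = Poly [:: c 1 + c 2; 0; (c 1 - c 2) *+ 4; 0;
  c 0 *+ 16 + (c 1 + c 2) *+ 6; 0; (c 1 - c 2) *+ 4; 0; c 1 + c 2].
Proof.
apply: hev_inj; rewrite ?size_quartic_sum ?(leq_trans (size_Poly _)) // => x.
rewrite -[RHS]horner_hev ?(leq_trans (size_Poly _)) // horner_Poly /= hev_quartic_sum sum3.
rewrite /fixed_form /Q /= !mx2_entries.
transitivity ('i ^+ 4 * c 0 * 16 * x ^+ 4 + c 1 * (x ^+ 2 + 1) ^+ 4 + 'i ^+ 4 * c 2 * (x ^+ 2 - 1) ^+ 4); first by ring.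
by rewrite i4; ring.
Qed.

Lemma quartic_sumQ_inj c d : quartic_sum c (Q C) = quartic_sum d (Q C) -> c =1 d.
Proof.
rewrite !quartic_sumQE => e.
have := congr1 (fun p : {poly C} => p`_0) e; rewrite !coef_Poly /= => h0.
have := congr1 (fun p : {poly C} => p`_2) e; rewrite !coef_Poly /= => h2.
have := congr1 (fun p : {poly C} => p`_4) e; rewrite !coef_Poly /= => h4.
have mulnI n (x y : C) : (0 < n)%N -> x *+ n = y *+ n -> x = y.
  move=> n0; rewrite -[x *+ n]mulr_natr -[y *+ n]mulr_natr; apply: mulIf.
  by rewrite pnatr_eq0 -lt0n.
have {}h2 := mulnI 4%N _ _ isT h2.
have h1 : c 1 = d 1.
  apply: (mulnI 2%N) => //; transitivity ((c 1 + c 2) + (c 1 - c 2)); first by ring.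
  by rewrite h0 h2; ring.
have h3 : c 2 = d 2 by apply: (addrI (c 1)); rewrite h0 h1.
have h5 : c 0 = d 0.
  by apply: (mulnI 16%N) => //; apply: (addIr ((c 1 + c 2) *+ 6)); rewrite h4 h0.
by move=> i; case: (ord3 i) => ->.
Qed.

Lemma map_quartic_sumQ (sigma : {rmorphism C -> C}) c :
  map_poly sigma (quartic_sum c (Q C)) = quartic_sum (fun i => sigma (c i)) (Q C).
Proof.
rewrite !quartic_sumQE; apply/polyP => k; rewrite coef_map !coef_Poly.
by case: k => [|[|[|[|[|[|[|[|[|k]]]]]]]]] /=; rewrite ?nth_nil ?(rmorph0, rmorphN, rmorphD, rmorphMn).
Qed.

(** Such forms make up a space of dimension 3, spanned by the fourth powers; the coefficients come
    from solving the system displayed in [quartic_sumQE]. *)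
Lemma even_palindromic_quartic_sum f : (size f <= 9)%N ->
  (forall k, (k < 9)%N -> (-1) ^+ k * f`_k = f`_k) ->
  (forall k, (k < 9)%N -> f`_(8 - k) = f`_k) -> exists c, f = quartic_sum c (Q C).
Proof.
move=> f9 ev pal.
have od k : (k < 9)%N -> odd k -> f`_k = 0.
  by move=> k9 ok; apply: eq_oppr0; rewrite -{1}ev // -signr_odd ok expr1 mulN1r.
exists (fun i => if i == 0 then (f`_4 - f`_8 * 6) / 16 else if i == 1 then (f`_8 + f`_6 / 4) / 2 else (f`_8 - f`_6 / 4) / 2).
apply: eq_octic => // [|k k9]; first exact: size_quartic_sum.
have f0 : f`_0 = f`_8 by rewrite -(pal 8%N).
have f2 : f`_2 = f`_6 by rewrite -(pal 6%N).
rewrite quartic_sumQE coef_Poly.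
by case: k k9 => [|[|[|[|[|[|[|[|[|//]]]]]]]]] _ /=; rewrite ?f0 ?f2 ?(od 1%N) ?(od 3%N) ?(od 5%N) ?(od 7%N) //; field.
Qed.

Lemma tr2Q_mul i j : tr2 (Q C i *m Q C j) = if i == j then - 2 else 0.
Proof.
case: (ord3 i) => ->; case: (ord3 j) => ->;
  rewrite /tr2 !mul2E /Q /= !mx2_entries ?mulrNN ?ii; ring.
Qed.

Lemma Q_inj i j (k : C) : Q C i = k *: Q C j -> i = j.
Proof.
move=> e; have := tr2Q_mul i i; rewrite eqxx {1}e -scalemxAl /tr2 !scale2E -mulrDr.
rewrite -/(tr2 _) tr2Q_mul; case: (eqVneq j i) => // _.
by rewrite mulr0 => /eqP; rewrite eq_sym oppr_eq0 pnatr_eq0.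
Qed.

(** The signs [e i] disappear in fourth powers, so N only permutes the terms. *)
Lemma quartic_sum_stab c (N : 'M[C]_2) (u : 'I_3 -> 'I_3) e (k : C) : injective u ->
  det2 N != 0 -> (forall i, e i ^+ 2 = 1) -> (forall i, Q C i *m N = N *m (e i *: Q C (u i))) ->
  (forall i, c i = k * c (u i)) -> stab (quartic_sum c (Q C)) N.
Proof.
move=> uI dN e2 rel hc; split=> //; exists (det2 N ^+ 4 * k).
rewrite (act_quartic_sum c rel) -[RHS]scalerA; congr (_ *: _).
rewrite quartic_sumZ -[RHS](quartic_sum_reindex _ _ uI) quartic_sum_scale.
by apply: eq_quartic_sum => // i; rewrite (exprM _ 2 2) e2 expr1n mulr1 hc.
Qed.

Lemma add2E (M N : 'M[C]_2) i j : (M + N) i j = M i j + N i j.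
Proof. by rewrite mxE. Qed.

(** Conjugation by the quaternion 1 + Q l is a quarter turn about the axis l. Indices are taken
    modulo 3, where - (i + l) is l for i = l and the third index otherwise. *)
Lemma quaternion_transposition l i : Q C i *m (1%:M + Q C l) =
  (1%:M + Q C l) *m ((if i == l + 1 then -1 else 1) *: Q C (- (i + l))).
Proof.
have [o1 o2 o3 o4] := scalar2E (1 : C).
by case: (ord3 i) => ->; case: (ord3 l) => ->; apply: eq_mx2;
  rewrite !(mul2E, add2E, scale2E) ?o1 ?o2 ?o3 ?o4 /Q /= !mx2_entries; ring: (ii C).
Qed.

(** Conjugation by 1 + I + J + K is the rotation of order 3 that permutes the axes cyclically. *)
Lemma quaternion_rotation i : Q C i *m (1%:M + Q C 0 + Q C 1 + Q C 2) =
  (1%:M + Q C 0 + Q C 1 + Q C 2) *m (1 *: Q C (i + 2)).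
Proof.
have [o1 o2 o3 o4] := scalar2E (1 : C).
by case: (ord3 i) => ->; apply: eq_mx2;
  rewrite !(mul2E, add2E, scale2E) ?o1 ?o2 ?o3 ?o4 /Q /= !mx2_entries; ring: (ii C).
Qed.

(** A symmetry of the coefficients makes 1 + Q l a stabiliser, and its trace is 2. A cyclic symmetry
    is excluded in the same way below. *)
Lemma transposition_stab c l (k : C) : (forall i, c i = k * c (- (i + l))) ->
  ~ traceless_stab (quartic_sum c (Q C)).
Proof.
move=> hc T; have [o1 o2 o3 o4] := scalar2E (1 : C).
have tN : tr2 (1%:M + Q C l) = 2.
  have := tr2Q C l; rewrite /tr2 !add2E o1 o4 => h.
  by transitivity (2 + (Q C l 0 0 + Q C l 1 1)); [ring|rewrite h addr0].
have dN : det2 (1%:M + Q C l) = 2.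
  by case: (ord3 l) => ->; rewrite /det2 !add2E o1 o2 o3 o4 /Q /= !mx2_entries; ring: (ii C).
have n2 : (2 : C) != 0 by rewrite pnatr_eq0.
have uI : injective (fun i => - (i + l)) by move=> i j /oppr_inj /addIr.
have sN : stab (quartic_sum c (Q C)) (1%:M + Q C l).
  apply: (quartic_sum_stab uI _ _ (quaternion_transposition l) hc); first by rewrite dN.
  by move=> i; case: ifP => _; rewrite ?sqrrN expr1n.
have nN : nonscalar (1%:M + Q C l).
  move=> x ex; case: (@traceless_nonscalar _ (Q C l) _ (tr2Q _ _) (x - 1)).
    by rewrite det2Q oner_neq0.
  by rewrite raddfB /= -ex addrC addKr.
by have := T _ sN nN; rewrite tN; apply/eqP.
Qed.

Lemma rotation_stab c (k : C) : (forall i, c i = k * c (i + 2)) ->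
  ~ traceless_stab (quartic_sum c (Q C)).
Proof.
move=> hc T; have [o1 o2 o3 o4] := scalar2E (1 : C).
set N : 'M[C]_2 := 1%:M + Q C 0 + Q C 1 + Q C 2.
have tN : tr2 N = 2.
  by rewrite /N /tr2 !add2E o1 o4 /Q /= !mx2_entries; ring.
have dN : det2 N = 4.
  by rewrite /N /det2 !add2E o1 o2 o3 o4 /Q /= !mx2_entries; ring: (ii C).
have uI : injective (fun i : 'I_3 => i + 2) by move=> i j /addIr.
have sN : stab (quartic_sum c (Q C)) N.
  apply: (quartic_sum_stab uI _ _ quaternion_rotation hc); first by rewrite dN pnatr_eq0.
  by move=> i; rewrite expr1n.
have nN : nonscalar N.
  move=> x ex; have [e1 e2 e3 e4] := scalar2E x.
  have h1 : N 0 1 = 1 + 'i by rewrite /N !add2E o2 /Q /= !mx2_entries; ring.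
  have h2 : N 1 0 = - 1 + 'i by rewrite /N !add2E o3 /Q /= !mx2_entries; ring.
  have : N 0 1 - N 1 0 = 0 by rewrite ex e2 e3 subrr.
  have -> : N 0 1 - N 1 0 = 2 by rewrite h1 h2; ring.
  by apply/eqP; rewrite pnatr_eq0.
by have := T _ sN nN; rewrite tN; apply/eqP; rewrite pnatr_eq0.
Qed.

End TernaryForms.

(** * Descent of sums of fourth powers and of general octics *)

Section OcticDescent.

Variable C : numClosedFieldType.
Implicit Types (f g h : {poly C}) (M N P : 'M[C]_2) (s t x : C).
Implicit Types (c d e : 'I_3 -> C).

Variables (F : divringClosed C) (S : {rmorphism C -> C} -> Prop).
Hypothesis fixF : forall z, (forall sigma, S sigma -> sigma z = z) -> z \in F.

Local Notation conj_equiv := (conj_equiv S).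
Local Notation descends := (descends F).

Lemma quartic_sum_stabQ c l : stab (quartic_sum c (Q C)) (Q C l).
Proof.
apply: (@quartic_sum_stab _ c _ id (fun i => if i == l then 1 else -1) 1) => //.
- by rewrite det2Q oner_neq0.
- by move=> i; case: ifP => _; rewrite ?sqrrN expr1n.
- by move=> i; case: (ord3 i) => ->; case: (ord3 l) => ->; apply: eq_mx2;
    rewrite !(mul2E, scale2E) /Q /= !mx2_entries; ring.
- by move=> i; rewrite mul1r.
Qed.

(** An equivalence conjugates each [Q i] into a stabiliser of the target, which by [klein_stab] is
    some [Q (u i)] up to a sign. Fourth powers ignore the sign, and the independence of the three
    fourth powers gives the relation between coefficients. *)
Lemma quartic_sum_conj c d : traceless_stab (quartic_sum c (Q C)) ->
  equiv (quartic_sum c (Q C)) (quartic_sum d (Q C)) ->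
  exists (u : 'I_3 -> 'I_3) (k : C), [/\ injective u, k != 0 & forall i, d (u i) = k * c i].
Proof.
move=> T e; have T' := traceless_equiv (size_quartic_sum _ _) e T.
have [M [k [dM k0 {}e]]] := e.
pose B i := (det2 M)^-1 *: (adj2 M *m Q C i *m M).
have eB i : Q C i *m M = M *m B i.
  by rewrite /B -scalemxAr !mulmxA mul_adj2 -mulmxA mul_scalar_mx scalerA mulVf ?scale1r.
have dB i : det2 (B i) = 1.
  by rewrite /B det2Z !det2M det2_adj det2Q mulr1 exprVn -expr2 mulVf // expf_neq0.
have sB i : stab (quartic_sum d (Q C)) (B i).
  have [_ [l el]] := stab_conj dM (eB i) (quartic_sum_stabQ c i).
  split; first by rewrite dB oner_neq0.
  by exists l; move: el; rewrite e actZ scalerA mulrC -scalerA => /(scalerI k0).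
have nB i : nonscalar (B i).
  apply: traceless_nonscalar (sB i).1 _.
  transitivity ((det2 M)^-1 * (det2 M * tr2 (Q C i))); last by rewrite tr2Q !mulr0.
  by rewrite /B /tr2 !scale2E -mulrDr !mul2E !mx2_entries /det2; ring.
have /boolp.choice [w hw] : forall i, exists w : 'I_3 * C, B i = w.2 *: Q C w.1.
  by move=> i; have [j [a ea]] := klein_stab T' (quartic_sum_stabQ d 0) (quartic_sum_stabQ d 1) (sB i) (nB i); exists (j, a).
pose u i := (w i).1; pose a i := (w i).2.
have a2 i : a i ^+ 2 = 1 by have := dB i; rewrite hw det2Z det2Q mulr1.
have a0 i : a i != 0 by apply: contraTneq (oner_neq0 C) => h; rewrite -(a2 i) h expr0n eqxx.
have uI : injective u.
  move=> i j uij; apply: (@Q_inj _ i j (a i / a j)).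
  have : Q C i *m M = (a i / a j) *: (Q C j *m M).
    by rewrite !eB !hw -/(u i) -/(u j) uij -!mulmx_scale2 scalerA divfK.
  move/(congr1 (fun X => X *m adj2 M)); rewrite /= -scalemxAl -!mulmxA mul_adj2 !mul_mx_scalar.
  by move=> h; apply: (scalerI dM); rewrite h !scalerA [_ * det2 M]mulrC.
have e' : quartic_sum (fun i => det2 M ^+ 4 * c i) (fun i => Q C (u i)) = quartic_sum (fun i => k * d (u i)) (fun i => Q C (u i)).
  rewrite (quartic_sum_reindex (fun i => k * d i) _ uI) -!quartic_sumZ -e (act_quartic_sum c eB); congr (_ *: _).
  have -> : quartic_sum c B = quartic_sum c (fun i => a i *: Q C (u i)) by apply: eq_quartic_sum => // i.
  rewrite quartic_sum_scale; apply: eq_quartic_sum => // i.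
  by rewrite (exprM _ 2 2) a2 expr1n mulr1.
pose v := invF uI; have uv i : u (v i) = i by rewrite f_invF.
have vI : injective v by apply: can_inj uv.
have {}e' : quartic_sum (fun i => det2 M ^+ 4 * c (v i)) (Q C) = quartic_sum (fun i => k * d i) (Q C).
  have h1 := quartic_sum_reindex (fun i => det2 M ^+ 4 * c i) (fun i => Q C (u i)) vI.
  have h2 := quartic_sum_reindex (fun i => k * d (u i)) (fun i => Q C (u i)) vI.
  rewrite -e' in h2; rewrite -h2 in h1.
  have := h1; rewrite (eq_quartic_sum (d := fun i => det2 M ^+ 4 * c (v i)) (B := Q C)) //; last by move=> i; rewrite uv.
  by move=> ->; apply: eq_quartic_sum => i; rewrite uv.
exists u, (det2 M ^+ 4 / k); split=> // [|i]; first by rewrite mulf_neq0 ?expf_neq0 ?invr_eq0.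
have := quartic_sumQ_inj e' (u i); rewrite /v invF_f => h.
by apply: (mulfI k0); rewrite -h; field.
Qed.

(* Over the base field the three involutions of a cubic [(T - c 0)(T - c 1)(T - c 2)]
   are [x |-> c i + P'(c i) / (x - c i)], the translations by 2-torsion points
   on the x-line of the elliptic curve [y^2 = P(x)]. *)
Definition cubic_deriv c i := \prod_(j | j != i) (c i - c j).

Definition torsion2 c i := mx2 (c i) (cubic_deriv c i - c i ^+ 2) 1 (- c i).

Lemma cubic_derivE c : [/\ cubic_deriv c 0 = (c 0 - c 1) * (c 0 - c 2),
  cubic_deriv c 1 = (c 1 - c 0) * (c 1 - c 2) & cubic_deriv c 2 = (c 2 - c 0) * (c 2 - c 1)].
Proof.
rewrite /cubic_deriv; split; rewrite big_mkcond !big_ord_recl big_ord0 /= ?mulr1 ?mul1r;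
  congr ((_ - c _) * (_ - c _)); exact/val_inj.
Qed.

Lemma cubic_deriv_neq0 c i : injective c -> cubic_deriv c i != 0.
Proof.
by move=> cI; apply/prodf_neq0 => j ji; rewrite subr_eq0 (inj_eq cI) eq_sym.
Qed.

Lemma det2_torsion2 c i : det2 (torsion2 c i) = - cubic_deriv c i.
Proof. by rewrite /det2 !mx2_entries; ring. Qed.

(** The translations anticommute, so they are simultaneously conjugate to multiples n_i Q_i of the
    quaternion units. Determinants give n_i^2 = - P'(c_i), and the weight n_i^-4 is the factor
    P'(c_i)^-2. *)
Lemma torsion2_equiv c d : injective c ->
  equiv (quartic_sum d (Q C)) (quartic_sum (fun i => d i / cubic_deriv c i ^+ 2) (torsion2 c)).
Proof.
move=> cI; have [d0 d1 d2] := cubic_derivE c.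
have dN i : det2 (torsion2 c i) != 0 by rewrite det2_torsion2 oppr_eq0 cubic_deriv_neq0.
have tN i : tr2 (torsion2 c i) = 0 by rewrite /tr2 !mx2_entries subrr.
have t01 : tr2 (torsion2 c 0 *m torsion2 c 1) = 0.
  by rewrite /tr2 !mul2E !mx2_entries d0 d1; ring.
have [P [a [b [dP a0 b0 eI eJ]]]] := quaternion_pair (dN 0) (dN 1) (tN 0) (tN 1) t01.
have c10 : c 1 - c 0 != 0 by rewrite subr_eq0 (inj_eq cI).
have eK : torsion2 c 2 *m P = P *m ((a * b / (c 1 - c 0)) *: QK C).
  have -> : torsion2 c 2 = (c 1 - c 0)^-1 *: (torsion2 c 0 *m torsion2 c 1).
    by apply: eq_mx2; rewrite scale2E !mul2E !mx2_entries ?d0 ?d1 ?d2; field; exact: c10.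
  have -> : QK C = QI C *m QJ C.
    by apply: eq_mx2; rewrite !mul2E !mx2_entries; ring.
  rewrite -scalemxAl -mulmxA eJ [torsion2 c 0 *m _]mulmxA eI -mulmxA mulmx_scale2.
  by rewrite -[LHS]mulmx_scale2 -scalemxAl !scalerA; congr (_ *m (_ *: _)); ring.
pose n (i : 'I_3) := if i == 0 then a else if i == 1 then b else a * b / (c 1 - c 0).
have n0 i : n i != 0.
  by rewrite /n; case: ifP => _ //; case: ifP => _ //; rewrite !mulf_neq0 // invr_eq0.
have rel i : torsion2 c i *m P = P *m (n i *: Q C i).
  by case: (ord3 i) => ->; rewrite /n /Q.
have n2 i : n i ^+ 2 = - cubic_deriv c i.
  have := congr1 (@det2 C) (rel i); rewrite !det2M det2Z det2Q mulr1 det2_torsion2 mulrC.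
  by move/(mulfI dP).
have rel' i : Q C i *m adj2 P = adj2 P *m ((n i)^-1 *: torsion2 c i).
  have : adj2 P *m (torsion2 c i *m P) *m adj2 P = adj2 P *m (P *m (n i *: Q C i)) *m adj2 P by rewrite rel.
  rewrite [adj2 P *m (P *m _)]mulmxA adj_mul2 mul_scalar_mx -mulmxA -[torsion2 c i *m P *m _]mulmxA mul_adj2.
  rewrite mul_mx_scalar mulmx_scale2 -scalemxAl => /(scalerI dP).
  rewrite -scalemxAl => h; rewrite mulmx_scale2 h scalerA mulVf // scale1r.
  by [].
exists (adj2 P), (det2 (adj2 P) ^+ 4); rewrite det2_adj dP expf_neq0 //; split=> //.
rewrite (act_quartic_sum d rel') det2_adj; congr (_ *: _).
rewrite quartic_sum_scale; apply: eq_quartic_sum => // i.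
by rewrite exprVn (exprM _ 2 2) n2 sqrrN.
Qed.

Lemma power_sum_conj (sigma : {rmorphism C -> C}) c (u : 'I_3 -> 'I_3) (k : C) m :
  injective u -> (forall i, sigma (c (u i)) = k * c i) ->
  sigma (\sum_i c i ^+ m) = k ^+ m * \sum_i c i ^+ m.
Proof.
move=> uI h; rewrite {1}(reindex_inj uI) rmorph_sum mulr_sumr /=.
by apply: eq_bigr => i _; rewrite rmorphXn /= h exprMn.
Qed.

Lemma third_index (i l : 'I_3) : [\/ i = l /\ - (i + l) = l,
  i = l + 1 /\ - (i + l) = l + 2 | i = l + 2 /\ - (i + l) = l + 1].
Proof.
have : [|| (i == l) && (- (i + l) == l), (i == l + 1) && (- (i + l) == l + 2)
  | (i == l + 2) && (- (i + l) == l + 1)] by case: (ord3 i) => ->; case: (ord3 l) => ->.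
by case/or3P => /andP[/eqP -> /eqP h]; [apply: Or31|apply: Or32|apply: Or33].
Qed.

(** Conjugation takes the c_i to a permutation of themselves times k. Once divided by a quantity l
    that is multiplied by the same k, they are merely permuted, and so are the terms of the sum
    built on their own torsion translations. *)
Lemma quartic_sum_descends c : octic (quartic_sum c (Q C)) ->
  conj_equiv (quartic_sum c (Q C)) -> traceless_stab (quartic_sum c (Q C)) ->
  descends (quartic_sum c (Q C)).
Proof.
move=> oF H T.
have conj sigma : S sigma -> exists (u : 'I_3 -> 'I_3) (k : C),
    [/\ injective u, k != 0 & forall i, sigma (c (u i)) = k * c i].
  move=> Ss; have := H _ Ss; rewrite map_quartic_sumQ => /(quartic_sum_conj T)[u [k [uI k0 h]]].
  by exists u, k.
(* Two equal coefficients would be exchanged by a quarter turn. *)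
have cI : injective c.
  have ne l : c (l + 1) <> c (l + 2).
    move=> h; apply: (@transposition_stab _ c l 1) T => i; rewrite mul1r.
    by case: (third_index i l) => -[-> ->].
  move=> i j e; apply/eqP/negPn/negP => ij.
  have := ne (- (i + j)); have : ((i == - (i + j) + 1) && (j == - (i + j) + 2)) ||
      ((i == - (i + j) + 2) && (j == - (i + j) + 1)).
    by move: ij {e}; case: (ord3 i) => ->; case: (ord3 j) => ->.
  by case/orP => /andP[/eqP {1}<- /eqP {1}<-]; rewrite e.
(* The power sum of degree m is multiplied by k^m: [p 1] serves as l, or [p 3 / p 2] if [p 1] is
   zero. *)
have [l [l0 hl]] : exists l, l != 0 /\ forall sigma, S sigma -> forall (u : 'I_3 -> 'I_3) (k : C),
    injective u -> (forall i, sigma (c (u i)) = k * c i) -> k != 0 -> sigma l = k * l.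
  pose p m := \sum_i c i ^+ m.
  have sp sigma : S sigma -> forall (u : 'I_3 -> 'I_3) (k : C),
    injective u -> (forall i, sigma (c (u i)) = k * c i) -> forall m, sigma (p m) = k ^+ m * p m.
    by move=> _ u k uI h m; apply: power_sum_conj h.
  case: (eqVneq (p 1%N) 0) => [p1|p1]; last first.
    by exists (p 1%N); split=> // sigma Ss u k uI h _; rewrite (sp _ Ss u k) // expr1.
  have p1' : c 0 + c 1 + c 2 = 0 by rewrite -p1 /p sum3 !expr1.
  have n2 : (2 : C) != 0 by rewrite pnatr_eq0.
  (* If [p 1] and [p 2] were both zero, the c_i would be proportional to the cube roots of unity,
     which have a cyclic symmetry. *)
  have p2 : p 2%N != 0.
    apply/negP => /eqP p2; rewrite /p sum3 in p2.
    have e2 : c 2 = - (c 0 + c 1) by apply/eqP; rewrite -addr_eq0 addrC p1'.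
    have q : c 0 ^+ 2 + c 0 * c 1 + c 1 ^+ 2 = 0.
      by apply: (mulfI n2); rewrite mulr0 -p2 e2; ring.
    have c0 : c 0 != 0.
      apply/negP => /eqP c0; move/eqP: q; rewrite c0 mul0r expr0n /= !add0r expf_eq0 /= -{1}c0.
      by rewrite (inj_eq cI).
    apply: (@rotation_stab _ c (c 1 / c 0)) T => i; case: (ord3 i) => ->.
    - have -> : (0 + 2 : 'I_3) = 2 by exact/val_inj.
      apply: (mulfI c0); rewrite mulrA mulrC [c 0 * (c 1 / c 0)]mulrC divfK // e2.
      by apply/eqP; rewrite -subr_eq0 -[X in _ == X]q; apply/eqP; ring.
    - have -> : (1 + 2 : 'I_3) = 0 by exact/val_inj.
      by rewrite divfK.
    have -> : (2 + 2 : 'I_3) = 1 by exact/val_inj.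
    apply: (mulfI c0); rewrite mulrA [c 0 * (c 1 / c 0)]mulrC divfK // e2.
    by apply/eqP; rewrite eq_sym -subr_eq0 -[X in _ == X]q; apply/eqP; ring.
  (* If [p 1] and [p 3] were both zero, Newton's identity would give c_0 c_1 c_2 = 0, and 0, x, -x
     is reversed in sign by a transposition. *)
  have p3 : p 3 != 0.
    apply/negP => /eqP p3; rewrite /p sum3 in p3.
    have e2 : c 2 = - (c 0 + c 1) by apply/eqP; rewrite -addr_eq0 addrC p1'.
    have : 3 * (c 0 * c 1 * c 2) = 0 by rewrite -p3 e2; ring.
    move/eqP; rewrite mulf_eq0 pnatr_eq0 /= => h.
    have [l cl] : exists l, c l = 0.
      by move: h; rewrite !mulf_eq0 => /orP[/orP[]|] /eqP h; [exists 0|exists 1|exists 2].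
    have s12 : c (l + 1) = - c (l + 2).
      apply/eqP; rewrite -addr_eq0 -p1' -[X in X == _]add0r -cl.
      case: (ord3 l) => ->; rewrite ?add0r.
      - by rewrite addrA.
      - have -> : (1 + 1 : 'I_3) = 2 by exact/val_inj.
        have -> : (1 + 2 : 'I_3) = 0 by exact/val_inj.
        by apply/eqP; ring.
      have -> : (2 + 1 : 'I_3) = 0 by exact/val_inj.
      have -> : (2 + 2 : 'I_3) = 1 by exact/val_inj.
      by apply/eqP; ring.
    apply: (@transposition_stab _ c l (-1)) T => i; rewrite mulN1r.
    by case: (third_index i l) => -[-> ->]; rewrite ?cl ?s12 ?opprK ?oppr0.
  exists (p 3 / p 2); rewrite mulf_neq0 ?invr_eq0 //; split=> // sigma Ss u k uI h k0.
  rewrite fmorph_div !(sp _ Ss u k) //; field; by rewrite k0 p2.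
pose th i := c i / l.
have thI : injective th by move=> i j /(mulIf (invr_neq0 l0)) /cI.
pose g := quartic_sum (fun i => th i / cubic_deriv th i ^+ 2) (torsion2 th).
have e : equiv (quartic_sum c (Q C)) g.
  apply: equiv_trans (torsion2_equiv th thI).
  have -> : quartic_sum th (Q C) = l^-1 *: quartic_sum c (Q C).
    by rewrite quartic_sumZ; apply: eq_quartic_sum => // i; rewrite mulrC.
  by apply: equiv_scale; rewrite ?invr_eq0 ?size_quartic_sum.
exists g; split=> //; first exact: octic_equiv oF (size_quartic_sum _ _) e.
apply/polyOverP => j; apply: fixF => sigma Ss.
have [u [k [uI k0 h]]] := conj _ Ss.
have hth i : sigma (th (u i)) = th i.
  by rewrite /th fmorph_div h (hl _ Ss u k) //; field; rewrite k0 l0.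
have hd i : sigma (cubic_deriv th (u i)) = cubic_deriv th i.
  rewrite /cubic_deriv rmorph_prod (reindex_inj uI) /=; apply: eq_big => [m|m _]; first by rewrite (inj_eq uI).
  by rewrite rmorphB /= !hth.
have -> : g = quartic_sum (fun i => th (u i) / cubic_deriv th (u i) ^+ 2) (fun i => torsion2 th (u i)).
  by rewrite (quartic_sum_reindex (fun i => th i / cubic_deriv th i ^+ 2)).
rewrite -coef_map; suff -> : map_poly sigma (quartic_sum (fun i => th (u i) / cubic_deriv th (u i) ^+ 2) (fun i => torsion2 th (u i))) = g.
  by rewrite /g (quartic_sum_reindex (fun i => th i / cubic_deriv th i ^+ 2)).
rewrite rmorph_sum; apply: eq_bigr => i _ /=.
rewrite map_polyZ rmorphXn /= fmorph_div rmorphXn /= hth hd; congr (_ *: _ ^+ 4).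
have -> : map_poly sigma (fixed_poly (torsion2 th (u i))) = fixed_poly (map_mx sigma (torsion2 th (u i))).
  by rewrite /fixed_poly !mxE rmorphB rmorphD /= !map_polyZ map_polyC map_polyXn map_polyX /= -rmorphB.
congr fixed_poly; apply: eq_mx2; rewrite mxE !mx2_entries ?rmorph1 ?rmorphN /= ?hth //.
by rewrite rmorphB rmorphXn /= hth hd.
Qed.

(** With M and N moved to [QI] and [QJ], both act on the form by a sign. Sign -1 for [QI] is the odd
    case; otherwise the sign of [QJ] decides between sums of fourth powers and antipalindromic
    forms. *)
Theorem octic_descends f M N : octic f -> conj_equiv f ->
  stab f M -> stab f N -> nonscalar M -> nonscalar N -> (forall k : C, N <> k *: M) ->
  descends f.
Proof.
move=> oF H sM sN nM nN MN; have f9 := octic_size oF.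
case: (traceless_or_descends fixF oF H) => // T.
have dM := sM.1; have dN := sN.1; have tM := T _ sM nM.
(* A traceless M is its own inverse up to a scalar, so a scalar product would make N proportional to
   M. *)
have nMN : nonscalar (M *m N).
  move=> k ek; apply: (MN (- (k / det2 M))).
  have aM : adj2 M = - M.
    have h11 : M 1 1 = - M 0 0 by apply/eqP; rewrite -addr_eq0 addrC -/(tr2 M) tM.
    by apply: eq_mx2; rewrite [RHS]mxE !mx2_entries // h11 // opprK.
  have := congr1 (fun X => adj2 M *m X) ek; rewrite /= mulmxA adj_mul2 mul_scalar_mx mul_mx_scalar aM.
  move/(congr1 (fun X => (det2 M)^-1 *: X)); rewrite scalerA mulVf // scale1r => ->.
  by rewrite scalerN scaleNr scalerN scalerA mulrC.
have tMN := T _ (stab_mul sM sN) nMN.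
have [P [a [b [dP a0 b0 eI eJ]]]] := quaternion_pair dM dN tM (T _ sN nN) tMN.
have eP := equiv_act f dP; apply: (descends_equiv eP).
have og := octic_equiv oF (size_act _ _) eP.
have Hg := conj_equiv_trans oF eP H; have Tg := traceless_equiv f9 eP T.
have /(stabZ _ _ a0) sI := stab_conj dP eI sM; have /(stabZ _ _ b0) sJ := stab_conj dP eJ sN.
move: (act P f) og Hg Tg sI sJ => g og Hg Tg [_ [k ek]] [_ [l el]].
have {}ek i : (i < 9)%N -> (-1) ^+ i * g`_i = k * g`_i.
  by move=> i9; have := congr1 (fun p : {poly C} => p`_i) ek; rewrite /= act_QI coef_poly i9 coefZ.
have {}el i : (i < 9)%N -> (-1) ^+ i * g`_(8 - i) = l * g`_i.
  by move=> i9; have := congr1 (fun p : {poly C} => p`_i) el; rewrite /= act_QJ coef_poly i9 coefZ.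
have l2 : l ^+ 2 = 1.
  have sq i : (i < 9)%N -> g`_i != 0 -> l ^+ 2 = 1.
    move=> i9 gi; apply: (mulIf gi); rewrite mul1r expr2 -mulrA -el // mulrCA -el ?ltnS ?leq_subr //.
    by rewrite subKn // mulrA sign_sub8 // -exprD addnn -signr_odd odd_double mul1r.
  by case/orP: (octic_coef_low og) => h; [apply: (sq 0%N)|apply: (sq 1%N)].
have k1 : k = 1 \/ k = -1.
  case/orP: (octic_coef_low og) => h; [left|right]; apply: (mulIf h); first by rewrite -(ek 0%N).
  by rewrite -(ek 1%N).
case: k1 ek => -> ek; last first.
  apply: (odd_descends fixF og Hg Tg _ el l2) => i i9; by rewrite ek // mulN1r.
have {}ek i : (i < 9)%N -> (-1) ^+ i * g`_i = g`_i by move=> i9; rewrite ek // mul1r.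
have el' i : (i < 9)%N -> g`_(8 - i) = l * g`_i.
  move=> i9; rewrite -el // -{1}ek ?ltnS ?leq_subr // sign_sub8 //.
move/eqP: l2; rewrite sqrf_eq1 => /orP[] /eqP l1.
  have [c ec] : exists c, g = quartic_sum c (Q C).
    apply: even_palindromic_quartic_sum => //; first exact: octic_size.
    by move=> i i9; rewrite el' // l1 mul1r.
  by rewrite ec in og Hg Tg *; apply: quartic_sum_descends.
apply: (even_antipalindromic_descends fixF og Hg Tg ek) => i i9.
by rewrite el' // l1 mulN1r.
Qed.

End OcticDescent.

(** The empty set is added to the good sets because Zorn's lemma also takes the union of the empty
    chain. Goodness of a union is asked for pairs of elements at a time, as the field axioms involve
    at most two. *)
Lemma maximal_of_directed (T : Type) (good : classical_sets.set T -> Prop) A0 w0 : good A0 -> A0 w0 ->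
  (forall B w, B w ->
     (forall v v', B v -> B v' -> exists A, [/\ good A, forall u, A u -> B u, A v & A v']) -> good B) ->
  exists2 A, good A & forall B, good B -> (forall w, A w -> B w) -> forall w, B w -> A w.
Proof.
move=> g0 A0w H; pose P (A : classical_sets.set T) := (forall w, ~ A w) \/ good A.
have [A [PA maxA]] : exists A, P A /\ forall B, classical_sets.proper A B -> ~ P B.
  apply: classical_sets.Zorn_bigcup => U UP tU.
  case: (boolp.pselect (exists A w, U A /\ A w)) => [[A [w [UA Aw]]]|nU]; last first.
    by left=> w [A UA Aw]; apply: nU; exists A, w.
  right; apply: (H _ w); first by exists A.
  move=> v v' [B UB Bv] [B' UB' Bv'].
  have [D [UD Dv Dv']] : exists D, [/\ U D, D v & D v'].
    by case: (tU _ _ UB UB') => s; [exists B'|exists B]; split=> //; apply: s.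
  by exists D; split=> //; [case: (UP _ UD) => // /(_ v)|move=> u Du; exists D].
case: PA => [A_0|gA]; first by case: (maxA A0); [split=> [w /A_0 //|/(_ _ A0w)/A_0]|right].
exists A => // B gB AB w Bw; apply: boolp.contrapT => nA.
by case: (maxA B); [split=> // /(_ w Bw)|right].
Qed.

(** * Automorphisms of an algebraically closed field over a subfield *)

Section FixedField.

Variable C : numClosedFieldType.
Implicit Types (G : C -> C -> Prop) (p q r m n a : {poly C}) (x y z t u : C).

(* The graph of an isomorphism between two subfields of [C]. *)
Record field_graph G : Prop := FieldGraph {
  graph1 : G 1 1;
  graphB : forall x y x' y', G x y -> G x' y' -> G (x - x') (y - y');
  graph_div : forall x y x' y', G x y -> G x' y' -> G (x / x') (y / y');
  graph_eq0 : forall x y, G x y -> (x == 0) = (y == 0) }.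

Section Graph.

Variable G : C -> C -> Prop.
Hypothesis gG : field_graph G.

Lemma graph0 : G 0 0.
Proof. by have := graphB gG (graph1 gG) (graph1 gG); rewrite subrr. Qed.

Lemma graphN x y : G x y -> G (- x) (- y).
Proof. by move=> h; have := graphB gG graph0 h; rewrite !sub0r. Qed.

Lemma graphD x y x' y' : G x y -> G x' y' -> G (x + x') (y + y').
Proof. by move=> h h'; have := graphB gG h (graphN h'); rewrite !opprK. Qed.

Lemma graphV x y : G x y -> G x^-1 y^-1.
Proof. by move=> h; have := graph_div gG (graph1 gG) h; rewrite !div1r. Qed.

Lemma graphM x y x' y' : G x y -> G x' y' -> G (x * x') (y * y').
Proof. by move=> h h'; have := graph_div gG h (graphV h'); rewrite !invrK. Qed.

Lemma graph_nat k : G k%:R k%:R.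
Proof. by elim: k => [|k IH]; [exact: graph0|rewrite mulrSr; apply: graphD => //; apply: graph1]. Qed.

Definition graph_poly p q := forall i, G p`_i q`_i.

Lemma graph_poly_size p q : graph_poly p q -> size p = size q.
Proof.
move=> h; apply/eqP; rewrite eqn_leq; apply/andP; split; apply/leq_sizeP => j /leq_sizeP hj.
  by apply/eqP; rewrite (graph_eq0 gG (h j)) hj.
by apply/eqP; rewrite -(graph_eq0 gG (h j)) hj.
Qed.

Lemma graph_polyB p q p' q' : graph_poly p q -> graph_poly p' q' -> graph_poly (p - p') (q - q').
Proof. by move=> h h' i; rewrite !coefB; apply: graphB. Qed.

Lemma graph_polyD p q p' q' : graph_poly p q -> graph_poly p' q' -> graph_poly (p + p') (q + q').
Proof. by move=> h h' i; rewrite !coefD; apply: graphD. Qed.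

Lemma graph_polyM p q p' q' : graph_poly p q -> graph_poly p' q' -> graph_poly (p * p') (q * q').
Proof.
move=> h h' i; rewrite !coefM; apply: (big_ind2 G) => [||j _]; first exact: graph0.
  by move=> x y x' y'; apply: graphD.
exact: graphM.
Qed.

Lemma graph_poly_exp p q k : graph_poly p q -> graph_poly (p ^+ k) (q ^+ k).
Proof.
move=> h; elim: k => [|k IH]; last by rewrite !exprS; apply: graph_polyM.
by move=> i; rewrite !expr0 coef1; apply: graph_nat.
Qed.

Lemma graph_polyC x y : G x y -> graph_poly x%:P y%:P.
Proof. by move=> h i; rewrite !coefC; case: ifP => _ //; exact: graph0. Qed.

Lemma graph_polyXn k : graph_poly 'X^k 'X^k.
Proof. by move=> i; rewrite coefXn; apply: graph_nat. Qed.

Lemma graph_horner p q x y : graph_poly p q -> G x y -> G p.[x] q.[y].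
Proof.
move=> h hx; rewrite !horner_coef (graph_poly_size h).
apply: (big_ind2 G) => [||j _]; first exact: graph0.
  by move=> ? ? ? ?; apply: graphD.
apply: graphM => //; elim: (j : nat) => [|k IH]; first by rewrite !expr0; apply: graph1.
by rewrite !exprS; apply: graphM.
Qed.

(** Euclidean division is carried out in both fields in parallel, so that quotients and remainders
    correspond. *)
Lemma graph_divp m n p q : graph_poly m n -> m != 0 -> graph_poly p q ->
  exists a a' r r', [/\ graph_poly a a', graph_poly r r', p = a * m + r,
    q = a' * n + r' & (size r < size m)%N].
Proof.
move=> hm m0; move: {2}(size p) (leqnn (size p)) => k; elim: k p q => [|k IH] p q sp hp.
  exists 0, 0, p, q; rewrite !mul0r !add0r; split=> //; first by move=> i; rewrite coef0; apply: graph0.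
  by rewrite (leq_ltn_trans sp) // size_poly_gt0.
case: (ltnP (size p) (size m)) => spm.
  exists 0, 0, p, q; rewrite !mul0r !add0r; split=> //; by move=> i; rewrite coef0; apply: graph0.
pose c := lead_coef p / lead_coef m; pose c' := lead_coef q / lead_coef n.
have hc : G c c'.
  by rewrite /c /c' !lead_coefE -(graph_poly_size hp) -(graph_poly_size hm); apply: graph_div.
pose e := c%:P * 'X^(size p - size m); pose e' := c'%:P * 'X^(size p - size m).
have he : graph_poly e e' by apply: graph_polyM; [apply: graph_polyC|apply: graph_polyXn].
have hp1 := graph_polyB hp (graph_polyM he hm).
have p0 : p != 0 by rewrite -size_poly_gt0 (leq_trans _ spm) // size_poly_gt0.
have lm0 : lead_coef m != 0 by rewrite lead_coef_eq0.
have c0 : c != 0 by rewrite mulf_neq0 ?invr_eq0 // lead_coef_eq0.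
have sem : size (e * m) = size p.
  by rewrite /e -mulrA size_Cmul // size_monicM ?monicXn // size_polyXn addSn /= subnK.
have lem : lead_coef (e * m) = lead_coef p.
  by rewrite /e !lead_coefM lead_coefC lead_coefXn mulr1 divfK.
have s1 : (size (p - e * m)%R <= k)%N.
  apply/leq_sizeP => j kj; rewrite coefB.
  case: (ltnP j (size p)) => jp; last by rewrite !nth_default ?subrr // sem.
  have -> : j = (size p).-1.
    apply/eqP; rewrite eqn_leq -ltnS prednK ?size_poly_gt0 // jp /= -ltnS prednK ?size_poly_gt0 //.
    exact: leq_trans sp _.
  by rewrite -{2}sem -!lead_coefE lem subrr.
have [a [a' [r [r' [ha hr e1 e2 sr]]]]] := IH _ _ s1 hp1.
exists (a + e), (a' + e'), r, r'; split=> //; first exact: graph_polyD.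
  by rewrite mulrDl addrAC -e1 subrK.
by rewrite mulrDl addrAC -e2 subrK.
Qed.

(** A minimal polynomial m of t over the domain of G, not normalised, together with its image n. *)
Definition graph_minpoly t m n := [/\ graph_poly m n, m != 0, m.[t] = 0 &
  forall p q, graph_poly p q -> p != 0 -> p.[t] = 0 -> (size m <= size p)%N].

Lemma graph_minpoly_ex t p q : graph_poly p q -> p != 0 -> p.[t] = 0 ->
  exists m n, graph_minpoly t m n.
Proof.
move: {2}(size p) (leqnn (size p)) => k; elim: k p q => [|k IH] p q sp h p0 pt.
  by case/negP: p0; rewrite -size_poly_leq0.
case: (boolp.pselect (exists p' q', [/\ graph_poly p' q', p' != 0, p'.[t] = 0 & (size p' <= k)%N])).
  by move=> [p' [q' [h' p'0 pt' sp']]]; apply: (IH p' q').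
move=> H; exists p, q; split=> // p' q' h' p'0 pt'; apply: leq_trans sp _.
by rewrite ltnNge; apply/negP => sp'; apply: H; exists p', q'.
Qed.

Lemma graph_minpoly_dvd t m n p q : graph_minpoly t m n -> graph_poly p q -> p.[t] = 0 ->
  exists a a', [/\ graph_poly a a', p = a * m & q = a' * n].
Proof.
move=> [hm m0 mt hmin] hp pt; have [a [a' [r [r' [ha hr e1 e2 sr]]]]] := graph_divp hm m0 hp.
exists a, a'; have r0 : r = 0.
  apply/eqP/negPn/negP => r0; have : r.[t] = 0.
    by move: pt; rewrite e1 hornerD hornerM mt mulr0 add0r.
  by move/(hmin _ _ hr r0); rewrite leqNgt sr.
have r'0 : r' = 0 by apply/eqP; rewrite -size_poly_eq0 -(graph_poly_size hr) r0 size_poly0.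
by rewrite e1 e2 r0 r'0 !addr0.
Qed.

End Graph.

Lemma graph_sym G : field_graph G -> field_graph (fun x y => G y x).
Proof.
move=> gG; split; first exact: graph1.
- by move=> x y x' y'; apply: graphB.
- by move=> x y x' y'; apply: graph_div.
- by move=> x y /(graph_eq0 gG).
Qed.

(** This makes t -> u well defined and injective on rational expressions. For the converse
    direction, a minimal polynomial of u divides n; carried back it divides m, and minimality of m
    forces it to vanish at t. *)
Lemma graph_minpoly_root G t u m n p q : field_graph G -> graph_minpoly G t m n -> n.[u] = 0 ->
  graph_poly G p q -> (p.[t] == 0) = (q.[u] == 0).
Proof.
move=> gG hm nu hp; apply/idP/idP => /eqP h.
  by have [a [a' [_ _ ->]]] := graph_minpoly_dvd gG hm hp h; rewrite hornerM nu mulr0.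
have [hmn m0 mt hmin] := hm.
have gS := graph_sym gG.
have n0 : n != 0 by rewrite -size_poly_eq0 -(graph_poly_size gG hmn) size_poly_eq0.
have [n2 [m2 hm2]] := graph_minpoly_ex (G := fun x y => G y x) (q := m) hmn n0 nu.
have [h2 n20 n2u _] := hm2.
have [a' [a [ha en em]]] := graph_minpoly_dvd gS hm2 (q := m) hmn nu.
have a0 : a != 0 by apply: contraNneq m0 => a0; rewrite em a0 mul0r.
have m20 : m2 != 0 by apply: contraNneq m0 => a1; rewrite em a1 mulr0.
have sn2 : (1 < size n2)%N.
  rewrite ltnNge; apply/negP => /size1_polyC e; move: n2u n20; rewrite e hornerC => ->.
  by rewrite polyC0 eqxx.
have sm2 : size m2 = size n2 by rewrite (graph_poly_size gS h2).
have m2t : m2.[t] = 0.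
  move: mt; rewrite em hornerM => /eqP; rewrite mulf_eq0 => /orP[] /eqP // at0.
  have := hmin _ _ ha a0 at0; rewrite em size_mul // sm2 => hs.
  move: hs; rewrite -(ltn_predK sn2) addnS /= -[X in (_ <= X)%N]addn0 leq_add2l.
  by case: (size n2) sn2 => [|[|]].
have [b' [b [_ _ ep]]] := graph_minpoly_dvd gS hm2 (q := p) hp h.
by rewrite ep hornerM m2t mulr0.
Qed.

Definition graph_adjoin G t u x y := exists p q r s, [/\ graph_poly G p q,
  graph_poly G r s, r.[t] != 0, x = p.[t] / r.[t] & y = q.[u] / s.[u]].

Lemma graph_adjoinP G t u : field_graph G ->
  (forall p q, graph_poly G p q -> (p.[t] == 0) = (q.[u] == 0)) ->
  [/\ field_graph (graph_adjoin G t u), forall x y, G x y -> graph_adjoin G t u x y &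
      graph_adjoin G t u t u].
Proof.
move=> gG H.
have inG x y : G x y -> graph_adjoin G t u x y.
  move=> h; exists x%:P, y%:P, 1%:P, 1%:P; rewrite !hornerC !divr1 oner_neq0.
  by split=> //; apply: graph_polyC => //; apply: graph1.
split=> //; last first.
  exists 'X^1, 'X^1, 1%:P, 1%:P; rewrite !hornerC !hornerXn !divr1 oner_neq0.
  by split=> //; [apply: graph_polyXn|apply: graph_polyC => //; apply: graph1].
split; first by apply: inG; apply: graph1.
- move=> x y x' y' [p [q [r [s [h1 h2 r0 -> ->]]]]] [p' [q' [r' [s' [h1' h2' r0' -> ->]]]]].
  exists (p * r' - p' * r), (q * s' - q' * s), (r * r'), (s * s').
  have s0 : s.[u] != 0 by rewrite -(H _ _ h2).
  have s0' : s'.[u] != 0 by rewrite -(H _ _ h2').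
  split; [apply: graph_polyB => //; exact: graph_polyM|exact: graph_polyM| | |].
  + by rewrite hornerM mulf_neq0.
  + by rewrite hornerD hornerN !hornerM; field; rewrite r0 r0'.
  + by rewrite hornerD hornerN !hornerM; field; rewrite s0 s0'.
- move=> x y x' y' [p [q [r [s [h1 h2 r0 -> ->]]]]] [p' [q' [r' [s' [h1' h2' r0' -> ->]]]]].
  have s0 : s.[u] != 0 by rewrite -(H _ _ h2).
  have s0' : s'.[u] != 0 by rewrite -(H _ _ h2').
  case: (eqVneq p'.[t] 0) => [p0|p0].
    have q0 : q'.[u] = 0 by apply/eqP; rewrite -(H _ _ h1') p0.
    by rewrite p0 q0 !mul0r invr0 !mulr0; apply: inG; apply: graph0.
  have q0 : q'.[u] != 0 by rewrite -(H _ _ h1').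
  exists (p * r'), (q * s'), (r * p'), (s * q'); split; [exact: graph_polyM|exact: graph_polyM| | |].
  + by rewrite hornerM mulf_neq0.
  + by rewrite !hornerM; field; rewrite r0 r0' p0.
  + by rewrite !hornerM; field; rewrite s0 s0' q0.
move=> x y [p [q [r [s [h1 h2 r0 -> ->]]]]].
have s0 : s.[u] != 0 by rewrite -(H _ _ h2).
by rewrite !mulf_eq0 !invr_eq0 (negPf r0) (negPf s0) !orbF; apply: H.
Qed.

Lemma graph_extend G t u m n : field_graph G -> graph_minpoly G t m n -> n.[u] = 0 ->
  exists G', [/\ field_graph G', forall x y, G x y -> G' x y & G' t u].
Proof.
move=> gG hm nu; have [g1 g2 g3] := graph_adjoinP gG (fun p q => graph_minpoly_root gG hm nu).
by exists (graph_adjoin G t u).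
Qed.

Definition subfield (L : C -> Prop) := [/\ L 1, forall x y, L x -> L y -> L (x - y) &
  forall x y, L x -> L y -> L (x / y)].

(** A subfield is treated as the graph of its identity, so that the division and minimal polynomials
    above also serve for one field. *)
Definition diagonal (L : C -> Prop) x y := x = y /\ L x.

Lemma field_graph_diagonal L : subfield L -> field_graph (diagonal L).
Proof.
move=> [L1 LB LD]; split=> //.
- by move=> x _ x' _ [<- h] [<- h']; split=> //; apply: LB.
- by move=> x _ x' _ [<- h] [<- h']; split=> //; apply: LD.
- by move=> x _ [<- _].
Qed.

Lemma diagonal_poly L p q : graph_poly (diagonal L) p q -> p = q.
Proof. by move=> h; apply/polyP => i; case: (h i). Qed.

Lemma diagonal_refl L p q : graph_poly (diagonal L) p q -> graph_poly (diagonal L) p p.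
Proof. by move=> h; rewrite {2}(diagonal_poly h). Qed.

Definition algebraic (L : C -> Prop) t := exists p, [/\ graph_poly (diagonal L) p p, p != 0 & p.[t] = 0].

Lemma adjoin_subfield L t : subfield L -> ~ algebraic L t ->
  exists L', [/\ subfield L', forall x, L x -> L' x, L' t &
    forall z, L' z -> exists p q, [/\ graph_poly (diagonal L) p p, graph_poly (diagonal L) q q, q.[t] != 0 & z = p.[t] / q.[t]]].
Proof.
move=> sL nt; have gL := field_graph_diagonal sL.
have H p q : graph_poly (diagonal L) p q -> (p.[t] == 0) = (q.[t] == 0).
  by move/diagonal_poly => ->.
have [[g1 gB gD _] inG gt] := graph_adjoinP gL H.
have diag x y : graph_adjoin (diagonal L) t t x y -> x = y.
  by move=> [p [q [r [s [/diagonal_poly -> /diagonal_poly -> _ -> ->]]]]].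
exists (fun x => graph_adjoin (diagonal L) t t x x); split=> //.
- by split=> // x y hx hy; [apply: gB|apply: gD].
- by move=> x Lx; apply: inG.
- move=> z [p [q [r [s [h1 h2 r0 ez _]]]]]; exists p, r.
  by split=> //; [apply: diagonal_refl h1|apply: diagonal_refl h2].
Qed.

Lemma maximal_subfield (F : C -> Prop) z : subfield F -> ~ F z -> exists L,
  [/\ subfield L, forall x, F x -> L x, ~ L z &
   forall L', subfield L' -> (forall x, L x -> L' x) -> ~ L' z -> forall x, L' x -> L x].
Proof.
move=> sF Fz; pose good (A : classical_sets.set C) := [/\ subfield A, forall x, F x -> A x & ~ A z].
have [||B w Bw two|L [sL FL Lz] maxL] := @maximal_of_directed _ good F 1.
- by split.
- by case: sF.
- have [A [[[A1 _ _] FA _] AB _ _]] := two _ _ Bw Bw; split; [split; first exact: AB| |].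
  + by move=> x y /two h /h[D [[[_ DB _] _ _] DB' Dx Dy]]; apply/DB'/DB.
  + by move=> x y /two h /h[D [[[_ _ DD] _ _] DB' Dx Dy]]; apply/DB'/DD.
  + by move=> x /FA/AB.
  by move=> Bz; have [D [[_ _ Dz] _ /Dz]] := two _ _ Bz Bz.
exists L; split=> // L' sL' LL' L'z; apply: maxL => //.
by split=> // x /FL/LL'.
Qed.

Lemma comp_sqr_neq0 p : p != 0 -> p \Po 'X^2 != 0.
Proof.
apply: contraNneq => e; apply/eqP/polyP => i.
have := congr1 (fun r : {poly C} => r`_(i.*2)) e.
by rewrite /= coef_comp_poly_Xn // dvdn2 odd_double -muln2 mulnK //= => ->; rewrite !coef0.
Qed.

(** One side has odd exponents only, the other even ones. This provides a nonzero relation for z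
    when z lies in L(z^2). *)
Lemma poly_comp_sqr_neq p q : q != 0 -> 'X * (q \Po 'X^2) != p \Po 'X^2.
Proof.
move=> q0; apply/negP => /eqP e; case/eqP: q0; apply/polyP => i.
have := congr1 (fun r : {poly C} => r`_(i.*2).+1) e.
rewrite /= coefXM /= !coef_comp_poly_Xn //.
have -> : (2 %| i.*2)%N by rewrite dvdn2 odd_double.
have -> : (2 %| i.*2.+1)%N = false by rewrite dvdn2 /= odd_double.
by rewrite -muln2 mulnK // coef0.
Qed.

(* [z] is algebraic over [L], since otherwise it would lie in [L(z^2)]. If [t] were
   transcendental, [z] would lie in [L(t)], hence in [L], by specialising [t]. *)
Lemma maximal_algebraic (L : C -> Prop) z : subfield L -> ~ L z ->
  (forall L', subfield L' -> (forall x, L x -> L' x) -> ~ L' z -> forall x, L' x -> L x) ->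
  forall t, algebraic L t.
Proof.
move=> sL Lz maxL; have gL := field_graph_diagonal sL.
have Xalg x : L x -> algebraic L x.
  move=> Lx; exists ('X - x%:P); rewrite polyXsubC_eq0 hornerXsubC subrr; split=> //.
  by apply: graph_polyB => //; [apply: (graph_polyXn gL 1)|apply: graph_polyC].
have inLz t : ~ algebraic L t -> exists p q, [/\ graph_poly (diagonal L) p p, graph_poly (diagonal L) q q, q.[t] != 0 & z = p.[t] / q.[t]].
  move=> nt; have [L' [sL' LL' L't hL']] := adjoin_subfield sL nt.
  apply: hL'; apply: boolp.contrapT => nz; apply: nt; apply: Xalg.
  exact: maxL nz _ L't.
have compX2 p : graph_poly (diagonal L) p p -> graph_poly (diagonal L) (p \Po 'X^2) (p \Po 'X^2).
  move=> hp i; rewrite coef_comp_poly_Xn //; case: ifP => _ //; exact: graph0.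
have zalg : algebraic L z.
  apply: boolp.contrapT => nz; have nz2 : ~ algebraic L (z ^+ 2).
    move=> [p [hp p0 pz]]; apply: nz; exists (p \Po 'X^2); split; first exact: compX2.
      exact: comp_sqr_neq0.
    by rewrite horner_comp hornerXn.
  have [p [q [hp hq q0 ez]]] := inLz _ nz2; apply: nz.
  exists ('X * (q \Po 'X^2) - (p \Po 'X^2)); split.
  - by apply: graph_polyB => //; [apply: graph_polyM => //; [apply: (graph_polyXn gL 1)|apply: compX2]|apply: compX2].
  - rewrite subr_eq0; apply: poly_comp_sqr_neq; apply: contraNneq q0 => ->; by rewrite horner0.
  - by rewrite hornerD hornerN hornerM hornerX !horner_comp hornerXn {1}ez divfK // subrr.
move=> t; apply: boolp.contrapT => nt.
have [p [q [hp hq q0 ez]]] := inLz _ nt.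
have [m0' [hm0' m0'0 m0'z]] := zalg.
have [m [n [hmn m0 mz hmin]]] := graph_minpoly_ex hm0' m0'0 m0'z.
have {n hmn} hm := diagonal_refl hmn.
pose d := size m.
(* R is m(p / q) cleared of denominators. It vanishes at the transcendental t, hence identically,
   and can be specialised at an integer where q does not vanish. *)
pose R : {poly C} := \sum_(i < d) m`_i *: (p ^+ i * q ^+ (d - i)).
have hR : graph_poly (diagonal L) R R.
  apply: (big_ind (fun r => graph_poly (diagonal L) r r)) => [i|r s|i _].
  - by rewrite coef0; apply: graph0.
  - exact: graph_polyD.
  rewrite -mul_polyC; apply: graph_polyM => //; first exact: graph_polyC.
  by apply: graph_polyM => //; apply: graph_poly_exp.
have Rt : R.[t] = 0.
  transitivity (q.[t] ^+ d * m.[z]); last by rewrite mz mulr0.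
  rewrite horner_sum [m.[z]]horner_coef mulr_sumr; apply: eq_bigr => i _.
  rewrite hornerZ hornerM !horner_exp.
  have -> : p.[t] = z * q.[t] by rewrite ez divfK.
  have -> : q.[t] ^+ d = q.[t] ^+ i * q.[t] ^+ (d - i) by rewrite -exprD subnKC // ltnW.
  by rewrite exprMn; ring.
have R0 : R = 0.
  by apply/eqP/negPn/negP => R0; apply: nt; exists R.
have q00 : q != 0 by apply: contraNneq q0 => ->; rewrite horner0.
have [k qk] : exists k : nat, q.[k%:R] != 0.
  case: (boolp.pselect (exists k : nat, q.[k%:R] != 0)) => // H; case/eqP: q00.
  apply: (@roots_geq_poly_eq0 _ q [seq i%:R | i <- iota 0 (size q)]).
  - apply/allP => x /mapP[i _ ->]; apply/negPn/negP => h; apply: H; by exists i.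
  - by rewrite map_inj_uniq ?iota_uniq // => i j /eqP; rewrite eqr_nat => /eqP.
  - by rewrite size_map size_iota.
pose l := p.[k%:R] / q.[k%:R].
have Ll : diagonal L l l.
  by apply: graph_div => //; apply: graph_horner => //; apply: graph_nat.
have ml : m.[l] = 0.
  have := congr1 (fun r : {poly C} => r.[k%:R]) R0; rewrite /= horner0 horner_sum => e.
  apply: (mulIf (expf_neq0 d qk)); rewrite mul0r -[RHS]e horner_coef mulr_suml; apply: eq_bigr => i _.
  rewrite hornerZ hornerM !horner_exp /l expr_div_n -mulrA; congr (_ * _).
  have -> : q.[k%:R] ^+ d = q.[k%:R] ^+ i * q.[k%:R] ^+ (d - i) by rewrite -exprD subnKC // ltnW.
  by rewrite mulrA divfK // expf_neq0.
have hl : graph_poly (diagonal L) ('X - l%:P) ('X - l%:P).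
  by apply: graph_polyB => //; [apply: (graph_polyXn gL 1)|apply: graph_polyC].
have Xl0 : 'X - l%:P != 0 by rewrite polyXsubC_eq0.
have [a [a' [r [r' [ha hr e1 _ sr]]]]] := graph_divp gL hl Xl0 hm.
have r0 : r = 0.
  move: sr; rewrite size_XsubC ltnS => /size1_polyC er.
  have := congr1 (fun r : {poly C} => r.[l]) e1; rewrite /= ml hornerD hornerM hornerXsubC subrr mulr0 add0r.
  by rewrite er hornerC => <-; rewrite polyC0.
have a0 : a != 0 by apply: contraNneq m0 => a0; rewrite e1 r0 a0 mul0r addr0.
have : m.[z] = 0 by []; rewrite e1 r0 addr0 hornerM hornerXsubC => /eqP; rewrite mulf_eq0 => /orP[/eqP az|].
  have := hmin _ _ ha a0 az; rewrite e1 r0 addr0 size_mul // size_XsubC addn2 /=.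
  by rewrite ltnn.
by rewrite subr_eq0 => /eqP zl; apply: Lz; rewrite zl; case: Ll.
Qed.

Lemma maximal_graph G0 : field_graph G0 -> exists G,
  [/\ field_graph G, forall x y, G0 x y -> G x y &
   forall G', field_graph G' -> (forall x y, G x y -> G' x y) -> forall x y, G' x y -> G x y].
Proof.
move=> g0; pose good (A : classical_sets.set (C * C)) :=
  field_graph (fun x y => A (x, y)) /\ forall x y, G0 x y -> A (x, y).
have [||B w Bw two|A [gA GA] maxA] := @maximal_of_directed _ good (fun w => G0 w.1 w.2) (1, 1).
- by [].
- exact: graph1.
- have [A [[gA GA] AB _ _]] := two _ _ Bw Bw; split; last by move=> x y /GA/AB.
  split; first exact/AB/(graph1 gA).
  + by move=> x y x' y' /two h /h[D [[gD _] DB Dx Dy]]; apply/DB/(graphB gD).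
  + by move=> x y x' y' /two h /h[D [[gD _] DB Dx Dy]]; apply/DB/(graph_div gD).
  by move=> x y Bxy; have [D [[gD _] _ Dxy _]] := two _ _ Bxy Bxy; apply: (graph_eq0 gD).
exists (fun x y => A (x, y)); split=> // G' gG' AG' x y G'xy.
apply: (maxA (fun w => G' w.1 w.2) _ _ (x, y) G'xy) => [|[a b] /AG' //].
by split=> // a b /GA/AG'.
Qed.

(** In characteristic zero m has simple roots. Were z the only one, m would be linear and z a
    quotient of its coefficients, hence in L. *)
Lemma conjugate_root (L : C -> Prop) z m n : subfield L -> ~ L z ->
  graph_minpoly (diagonal L) z m n -> exists2 z', z' != z & n.[z'] = 0.
Proof.
move=> sL Lz [hm m0 mz hmin]; have gL := field_graph_diagonal sL.
rewrite -(diagonal_poly hm); have {}hm := diagonal_refl hm.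
have [rs ers] := closed_field_poly_normal m.
have lm : lead_coef m != 0 by rewrite lead_coef_eq0.
have rm x : x \in rs -> m.[x] = 0.
  by move=> xs; apply/rootP; rewrite ers rootZ // root_prod_XsubC.
case: (boolp.pselect (exists2 z', z' != z & m.[z'] = 0)) => // H.
have rz x : x \in rs -> x = z.
  by move=> /rm mx; apply/eqP/negPn/negP => xz; apply: H; exists x.
have ur : uniq rs.
  apply: (uniq_roots_generic ers) => // x mx; apply/negP => /eqP m'x.
  have xz : x = z by apply/eqP/negPn/negP => xz; apply: H; exists x.
  have hm' : graph_poly (diagonal L) m^`() m^`().
    by move=> i; rewrite coef_deriv -mulr_natr; apply: graphM => //; apply: graph_nat.
  have s1 : (1 < size m)%N.
    rewrite ltnNge; apply/negP => /size1_polyC em; move: mx m0; rewrite em hornerC => ->.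
    by rewrite polyC0 eqxx.
  have m'0 : m^`() != 0.
    rewrite -lead_coef_eq0 lead_coef_deriv mulrn_eq0 (negPf lm) orbF.
    by case: (size m) s1 => [|[]].
  by have := hmin _ _ hm' m'0; rewrite -xz leqNgt lt_size_deriv // => /(_ m'x).
have s2 : size m = (size rs).+1 by rewrite {1}ers size_scale // size_prod_XsubC.
case: rs ers rm rz ur s2 => [|x [|y rs]] ers rm rz ur s2.
- by move: mz; rewrite ers big_nil hornerZ hornerC mulr1 => /eqP; rewrite (negPf lm).
- case: Lz; have xz : x = z by apply: rz; rewrite inE eqxx.
  have em : m = lead_coef m *: ('X - z%:P) by rewrite {1}ers big_seq1 xz.
  have m1 : m`_1 = lead_coef m by rewrite lead_coefE s2.
  have m0' : m`_0 = - (lead_coef m * z) by rewrite {1}em coefZ coefB coefX coefC /= sub0r mulrN.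
  have -> : z = - m`_0 / m`_1 by rewrite m0' m1 opprK mulrC mulKf.
  have : diagonal L (- m`_0 / m`_1) (- m`_0 / m`_1) by apply: graph_div => //; apply: graphN.
  by case.
have xz : x = z by apply: rz; rewrite inE eqxx.
have yz : y = z by apply: rz; rewrite !inE eqxx orbT.
by move: ur; rewrite xz yz /= inE eqxx.
Qed.

(** Surjectivity comes from algebraicity: sigma maps the finite set of roots of a polynomial over L
    injectively into itself, hence onto itself. *)
Lemma total_graph_automorphism G (L : C -> Prop) : field_graph G -> subfield L ->
  (forall x, L x -> G x x) -> (forall x, exists y, G x y) -> (forall t, algebraic L t) ->
  exists sigma : {rmorphism C -> C}, bijective sigma /\ forall x, G x (sigma x).
Proof.
move=> gG sL LG tot alg; have [s hs] := boolp.choice tot.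
have fn x y y' : G x y -> G x y' -> y = y'.
  by move=> h h'; have := graph_eq0 gG (graphB gG h h'); rewrite subrr eqxx => /esym/eqP/subr0_eq.
have sB : {morph s : x y / x - y} by move=> x y; apply: fn (hs _) _; apply: (graphB gG).
have sM : {morph s : x y / x * y} by move=> x y; apply: fn (hs _) _; apply: (graphM gG).
have s1 : s 1 = 1 by apply: fn (hs _) _; apply: (graph1 gG).
pose a := GRing.isZmodMorphism.Build C C s sB.
pose b := GRing.isMonoidMorphism.Build C C s (conj s1 sM).
pose sigma : {rmorphism C -> C} := HB.pack s a b.
exists sigma; split; last exact: hs.
have inj : injective sigma by exact: fmorph_inj.
have surj y : exists x, sigma x = y.
  have [p [hp p0 py]] := alg y; have [rs ers] := closed_field_poly_normal p.
  have rp x : (x \in undup rs) = (p.[x] == 0).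
    by rewrite mem_undup -rootE ers rootZ ?lead_coef_eq0 // root_prod_XsubC.
  have fixp : map_poly sigma p = p.
    apply/polyP => i; rewrite coef_map /=; apply: fn (hs _) _.
    by apply: LG; case: (hp i).
  have sub : {subset map sigma (undup rs) <= undup rs}.
    move=> _ /mapP[x xs ->]; rewrite rp -fixp horner_map fmorph_eq0 -rp //.
  have us : uniq (map sigma (undup rs)) by rewrite (map_inj_uniq inj) undup_uniq.
  have [_ eqm] := uniq_min_size us sub (eq_leq (esym (size_map _ _))).
  have : y \in undup rs by rewrite rp py.
  by rewrite -eqm => /mapP[x _ ->]; exists x.
have [r hr] := boolp.choice surj.
by exists r => x //; apply: inj; rewrite hr.
Qed.

(** The isomorphism over L sending z to another root of its minimal polynomial is enlarged to a
    maximal one. That one is defined everywhere, since every element is algebraic over its domain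
    and could otherwise be adjoined. *)
Theorem automorphism_moving (F : C -> Prop) z : subfield F -> ~ F z ->
  exists sigma : {rmorphism C -> C},
    [/\ bijective sigma, forall x, F x -> sigma x = x & sigma z != z].
Proof.
move=> sF Fz; have [L [sL FL Lz maxL]] := maximal_subfield sF Fz.
have alg := maximal_algebraic sL Lz maxL; have gL := field_graph_diagonal sL.
have [p [hp p0 pz]] := alg z; have [m [n hm]] := graph_minpoly_ex hp p0 pz.
have [z' z'z nz'] := conjugate_root sL Lz hm.
have [G0 [gG0 LG0 G0z]] := graph_extend gL hm nz'.
have [G [gG G0G maxG]] := maximal_graph gG0.
have LG x : L x -> G x x by move=> Lx; apply/G0G/LG0.
have tot t : exists u, G t u.
  have [p' [hp' p'0 p't]] := alg t.
  have hG : graph_poly G p' p' by move=> i; apply: LG; case: (hp' i).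
  have [m' [n' hm']] := graph_minpoly_ex hG p'0 p't.
  have [u nu] : exists u, n'.[u] = 0.
    have [h1 m'0 m't _] := hm'; have : size n' != 1%N.
      rewrite -(graph_poly_size gG h1); apply/negP => /size_poly1P[c c0 em].
      by move: m't c0; rewrite em hornerC => ->; rewrite eqxx.
    by case/closed_rootP => u /rootP; exists u.
  have [G' [gG' GG' G'tu]] := graph_extend gG hm' nu.
  by exists u; apply: maxG gG' GG' _ _ G'tu.
have [sigma [bs hs]] := total_graph_automorphism gG sL LG tot alg.
have fn x y y' : G x y -> G x y' -> y = y'.
  by move=> h h'; have := graph_eq0 gG (graphB gG h h'); rewrite subrr eqxx => /esym/eqP/subr0_eq.
exists sigma; split=> // [x Fx|]; first by apply: fn (hs _) _; apply/LG/FL.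
by rewrite (fn _ _ _ (hs z) (G0G _ _ G0z)).
Qed.

End FixedField.

(** * Morphisms of projective sets given locally by forms *)

Section ProjectiveMorphisms.

Variable C : closedFieldType.

Lemma proj_eq_refl n (v : 'rV[C]_n.+1) : proj_eq v v.
Proof. by exists 1; rewrite ?oner_neq0 ?scale1r. Qed.

Lemma proj_eq_sym n (u v : 'rV[C]_n.+1) : proj_eq u v -> proj_eq v u.
Proof. by move=> [c c0 ->]; exists c^-1; rewrite ?invr_eq0 // scalerA mulVf // scale1r. Qed.

Lemma proj_eq_trans n (u v w : 'rV[C]_n.+1) : proj_eq u v -> proj_eq v w -> proj_eq u w.
Proof. by move=> [c c0 ->] [d d0 ->]; exists (c * d); rewrite ?mulf_neq0 // scalerA. Qed.

Lemma meval_homog n d (p : {mpoly C[n.+1]}) (c : C) (v : 'rV[C]_n.+1) :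
  p \is d.-homog -> p.@[(c *: v) 0] = c ^+ d * p.@[v 0].
Proof.
move=> hp; rewrite !mevalE mulr_sumr !big_seq; apply: eq_bigr => m mp.
have dm : mdeg m = d := dhomog_mf hp mp.
rewrite mulrCA; congr (_ * _); rewrite -dm mdegE -prodrXr -big_split /=.
by apply: eq_bigr => i _; rewrite mxE exprMn.
Qed.

Lemma dhomog_prod_exp n k d (P : 'I_k -> {mpoly C[n.+1]}) (m : 'I_k -> nat) (r : seq 'I_k) :
  (forall i, P i \is d.-homog) ->
  \prod_(i <- r) P i ^+ m i \is (d * \sum_(i <- r) m i).-homog.
Proof.
move=> hP; elim: r => [|i r IH]; first by rewrite !big_nil muln0 dhomog1.
by rewrite !big_cons mulnDr; apply: dhomogM => //; apply: dhomogMn.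
Qed.

Lemma dhomog_comp n k d e (q : {mpoly C[k]}) (P : 'I_k -> {mpoly C[n.+1]}) :
  (forall i, P i \is d.-homog) -> q \is e.-homog ->
  q \mPo [tuple P i | i < k] \is (d * e).-homog.
Proof.
move=> hP hq; rewrite comp_mpolyEX big_seq; apply: rpred_sum => m mq.
have dm : mdeg m = e := dhomog_mf hq mq.
apply: rpredZ; rewrite comp_mpolyX -dm mdegE.
rewrite (eq_bigr (fun i => P i ^+ m i)) => [|i _]; last by rewrite tnth_mktuple.
exact: dhomog_prod_exp.
Qed.

Lemma eval_forms_scale n m d (P : 'I_m.+1 -> {mpoly C[n.+1]}) (c : C) (v : 'rV[C]_n.+1) :
  (forall i, P i \is d.-homog) -> eval_forms P (c *: v) = c ^+ d *: eval_forms P v.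
Proof. by move=> hP; apply/rowP => i; rewrite !mxE (meval_homog _ _ (hP i)). Qed.

Lemma eval_forms_comp n m k (P : 'I_m.+1 -> {mpoly C[n.+1]}) (Q : 'I_k.+1 -> {mpoly C[m.+1]}) v :
  eval_forms (fun i => Q i \mPo [tuple P j | j < m.+1]) v = eval_forms Q (eval_forms P v).
Proof.
apply/rowP => i; rewrite !mxE comp_mpoly_meval; apply: meval_eq => j.
by rewrite tnth_mktuple mxE.
Qed.

Lemma dhomogXU n (i : 'I_n.+1) : ('X_i : {mpoly C[n.+1]}) \is 1.-homog.
Proof. by rewrite dhomogX; apply/eqP/mdeg1. Qed.

Variables (n : nat) (X : seq {mpoly C[n.+1]}).

Lemma morphism_proj m (Y : seq {mpoly C[m.+1]}) phi v w : morphism X Y phi ->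
  on_locus X v -> on_locus X w -> proj_eq v w -> proj_eq (phi v) (phi w).
Proof.
move=> [_ loc] Xv Xw [c c0 ev]; have [d [P [hP Pw H]]] := loc _ Xw.
have ePv : eval_forms P v = c ^+ d *: eval_forms P w by rewrite ev (eval_forms_scale _ _ hP).
have Pv : eval_forms P v != 0 by rewrite ePv scaler_eq0 expf_eq0 (negPf c0) andbF.
apply: proj_eq_trans (H _ Xv Pv) _; apply: proj_eq_trans (proj_eq_sym (H _ Xw Pw)).
by exists (c ^+ d); rewrite ?expf_neq0.
Qed.

(** The composed forms must represent the composite wherever they do not all vanish, even at points
    where the inner forms vanish; there the outer forms can only be constants. *)
Lemma morphism_comp m k (Y : seq {mpoly C[m.+1]}) (Z : seq {mpoly C[k.+1]}) phi psi :
  morphism X Y phi -> morphism Y Z psi -> morphism X Z (psi \o phi).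
Proof.
move=> mphi mpsi; have [XY locX] := mphi; have [YZ locY] := mpsi.
split=> [v /XY/YZ //|v Xv].
have [d [P [hP Pv HP]]] := locX _ Xv.
have [e [Q [hQ Qv HQ]]] := locY _ (XY _ Xv).
have key w : on_locus X w -> eval_forms P w != 0 ->
    exists2 c, c != 0 & eval_forms Q (eval_forms P w) = c *: eval_forms Q (phi w).
  move=> Xw Pw; have [c c0 ew] := HP _ Xw Pw; exists (c^-1 ^+ e); first by rewrite expf_neq0 ?invr_eq0.
  by rewrite -(eval_forms_scale _ _ hQ) ew scalerA mulVf // scale1r.
exists (d * e)%N, (fun i => Q i \mPo [tuple P j | j < m.+1]); split.
- by move=> i; apply: dhomog_comp.
- rewrite eval_forms_comp; have [c c0 ->] := key _ Xv Pv.
  by rewrite scaler_eq0 (negPf c0).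
move=> w Xw; rewrite eval_forms_comp => QPw; have Yw := XY _ Xw.
have Qw c : c != 0 -> eval_forms Q (eval_forms P w) = c *: eval_forms Q (phi w) ->
    proj_eq (psi (phi w)) (eval_forms Q (eval_forms P w)).
  move=> c0 e'; have Qw : eval_forms Q (phi w) != 0.
    by apply: contraNneq QPw => h; rewrite e' h scaler0.
  apply: proj_eq_trans (HQ _ Yw Qw) _; apply: proj_eq_sym; exists c => //.
case: (eqVneq (eval_forms P w) 0) => [Pw|Pw]; last by have [c c0 e'] := key _ Xw Pw; apply: Qw e'.
case: (posnP e) => [e0|e_gt0].
  (* constant forms do not see where they are evaluated *)
  have := eval_forms_scale 0 (phi w) hQ; rewrite scale0r e0 expr0 scale1r => e1.
  by apply: (Qw 1); rewrite ?oner_neq0 // scale1r Pw -e1.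
by move: QPw; rewrite Pw -(scale0r (phi w)) (eval_forms_scale _ _ hQ) expr0n gtn_eqF // scale0r eqxx.
Qed.

End ProjectiveMorphisms.

(** * Composition of isomorphisms *)

Section Isomorphisms.

Variable C : closedFieldType.

Lemma isomorphism_comp n m k (X : seq {mpoly C[n.+1]}) (Y : seq {mpoly C[m.+1]})
    (Z : seq {mpoly C[k.+1]}) phi psi :
  isomorphism X Y phi -> isomorphism Y Z psi -> isomorphism X Z (psi \o phi).
Proof.
move=> [mphi [phi' [mphi' e1 e2]]] [mpsi [psi' [mpsi' e3 e4]]].
split; first exact: morphism_comp mphi mpsi.
exists (phi' \o psi'); split; first exact: morphism_comp mpsi' mphi'.
  move=> v Xv /=; have Yv := mphi.1 _ Xv.
  apply: proj_eq_trans (e1 _ Xv); apply: (morphism_proj mphi') => //; last exact: e3.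
  by apply: mpsi'.1; apply: mpsi.1.
move=> w Zw /=; have Yw := mpsi'.1 _ Zw.
apply: proj_eq_trans (e4 _ Zw); apply: (morphism_proj mpsi) => //; last exact: e2.
by apply: mphi.1; apply: mphi'.1.
Qed.

Lemma isomorphic_sym n m (X : seq {mpoly C[n.+1]}) (Y : seq {mpoly C[m.+1]}) :
  isomorphic X Y -> isomorphic Y X.
Proof. by move=> [phi [mphi [psi [mpsi e1 e2]]]]; exists psi; split=> //; exists phi. Qed.

Lemma isomorphic_trans n m k (X : seq {mpoly C[n.+1]}) (Y : seq {mpoly C[m.+1]})
    (Z : seq {mpoly C[k.+1]}) : isomorphic X Y -> isomorphic Y Z -> isomorphic X Z.
Proof. by move=> [phi h1] [psi h2]; exists (psi \o phi); apply: isomorphism_comp h1 h2. Qed.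

End Isomorphisms.

(** * Conjugation of curves and morphisms by a field automorphism *)

Section Conjugation.

Variables (C : closedFieldType) (sigma : {rmorphism C -> C}) (tau : C -> C).
Hypotheses (sK : cancel sigma tau) (tK : cancel tau sigma).

Lemma meval_map n (p : {mpoly C[n.+1]}) (v : 'rV[C]_n.+1) :
  (map_mpoly sigma p).@[(map_mx sigma v) 0] = sigma p.@[v 0].
Proof.
rewrite mevalE [in RHS]mevalE rmorph_sum /= (perm_big _ (msupp_map_mpoly p (fmorph_inj sigma))) /=.
apply: eq_bigr => m _; rewrite mcoeff_map_mpoly rmorphM rmorph_prod /=; congr (_ * _).
by apply: eq_bigr => i _; rewrite mxE rmorphXn.
Qed.

Lemma map_mxK n (v : 'rV[C]_n.+1) : map_mx sigma (map_mx tau v) = v.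
Proof. by apply/rowP => i; rewrite !mxE tK. Qed.

Lemma map_mxK' n (v : 'rV[C]_n.+1) : map_mx tau (map_mx sigma v) = v.
Proof. by apply/rowP => i; rewrite !mxE sK. Qed.

Lemma map_mx_eq0' n (v : 'rV[C]_n.+1) : (map_mx sigma v == 0) = (v == 0).
Proof.
apply/eqP/eqP => [/rowP h|->]; last by rewrite map_mx0.
by apply/rowP => i; have := h i; rewrite !mxE => /eqP; rewrite fmorph_eq0 => /eqP.
Qed.

Lemma on_locus_map n (X : seq {mpoly C[n.+1]}) v :
  on_locus (conj_curve sigma X) (map_mx sigma v) = on_locus X v.
Proof.
rewrite /on_locus map_mx_eq0' all_map; congr (_ && _).
by apply: eq_all => p /=; rewrite meval_map fmorph_eq0.
Qed.

Lemma proj_eq_map n (u v : 'rV[C]_n.+1) : proj_eq u v -> proj_eq (map_mx sigma u) (map_mx sigma v).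
Proof. by move=> [c c0 ->]; exists (sigma c); rewrite ?fmorph_eq0 // map_mxZ. Qed.

Lemma map_dhomog n d (p : {mpoly C[n.+1]}) : p \is d.-homog -> map_mpoly sigma p \is d.-homog.
Proof.
move=> hp; apply/dhomogP => m; rewrite (perm_mem (msupp_map_mpoly p (fmorph_inj sigma))).
exact: (dhomog_mf hp).
Qed.

Lemma morphism_map n m (X : seq {mpoly C[n.+1]}) (Y : seq {mpoly C[m.+1]}) phi :
  morphism X Y phi ->
  morphism (conj_curve sigma X) (conj_curve sigma Y) (map_mx sigma \o phi \o map_mx tau).
Proof.
move=> [XY loc]; split=> [v|v]; rewrite -{1}(map_mxK v) on_locus_map => Xv.
  by rewrite /= on_locus_map; apply: XY.
have [d [P [hP Pv H]]] := loc _ Xv.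
have eE w : eval_forms (fun i => map_mpoly sigma (P i)) (map_mx sigma w) = map_mx sigma (eval_forms P w).
  by apply/rowP => i; rewrite !mxE meval_map.
exists d, (fun i => map_mpoly sigma (P i)); split.
- by move=> i; apply: map_dhomog.
- by rewrite -(map_mxK v) eE map_mx_eq0'.
move=> w; rewrite -{1 2 4}(map_mxK w) on_locus_map eE map_mx_eq0' => Xw Pw.
by rewrite /=; apply: proj_eq_map; apply: H.
Qed.

Lemma isomorphic_map n m (X : seq {mpoly C[n.+1]}) (Y : seq {mpoly C[m.+1]}) :
  isomorphic X Y -> isomorphic (conj_curve sigma X) (conj_curve sigma Y).
Proof.
move=> [phi [mphi [psi [mpsi e1 e2]]]]; exists (map_mx sigma \o phi \o map_mx tau).
split; first exact: morphism_map.
exists (map_mx sigma \o psi \o map_mx tau); split; first exact: morphism_map.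
  move=> v; rewrite -{1 3}(map_mxK v) on_locus_map /= map_mxK' => Xv.
  by apply: proj_eq_map; apply: e1.
move=> w; rewrite -{1 3}(map_mxK w) on_locus_map /= map_mxK' => Yw.
by apply: proj_eq_map; apply: e2.
Qed.

End Conjugation.

(** * Points and forms on the model in P^5 *)

Section HyperellipticModel.

Variable C : numClosedFieldType.
Implicit Types (f g : {poly C}) (s t x y c : C) (v w : 'rV[C]_6).

Local Notation model := (@hyperelliptic_model C 3).

(* The point [x : y] = [s/t : y/t^4] of the curve [y^2 = f(x)]. *)
Definition pt s t y : 'rV[C]_6 :=
  \row_(k < 6) if (k < 5)%N then s ^+ k * t ^+ (4 - k) else y.

Lemma pt_lt s t y k : (k < 5)%N -> pt s t y 0 (inord k) = s ^+ k * t ^+ (4 - k).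
Proof. by move=> k5; rewrite mxE inordK ?k5 // (ltn_trans k5). Qed.

Lemma pt_last s t y : pt s t y 0 ord_max = y.
Proof. by rewrite mxE. Qed.

Lemma eq_row6 v w : (forall k, (k < 5)%N -> v 0 (inord k) = w 0 (inord k)) ->
  v 0 ord_max = w 0 ord_max -> v = w.
Proof.
move=> h hm; apply/rowP => k; case: (ltnP k 5) => k5.
  by rewrite -[k]inord_val h.
have -> : k = ord_max by apply/val_inj/eqP; rewrite eqn_leq -ltnS ltn_ord.
exact: hm.
Qed.

Lemma pt_scale c s t y : pt (c * s) (c * t) (c ^+ 4 * y) = c ^+ 4 *: pt s t y.
Proof.
apply: eq_row6 => [k k5|]; last by rewrite [RHS]mxE !pt_last.
by rewrite [RHS]mxE !pt_lt // !exprMn mulrACA -exprD subnKC.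
Qed.

Lemma on_modelP f v : reflect
  [/\ v != 0, v 0 ord_max ^+ 2 = \sum_(k < 9) f`_k * (v 0 (inord k./2) * v 0 (inord (uphalf k))) &
    forall i j, (i < 4)%N -> (j < 4)%N ->
      v 0 (inord i) * v 0 (inord j.+1) = v 0 (inord i.+1) * v 0 (inord j)]
  (on_locus (model f) v).
Proof.
have e1 : ('X_ord_max ^+ 2 - \sum_(k < 9) f`_k *: ('X_(inord k./2) * 'X_(inord (uphalf k))) : {mpoly C[6]}).@[v 0]
   = v 0 ord_max ^+ 2 - \sum_(k < 9) f`_k * (v 0 (inord k./2) * v 0 (inord (uphalf k))).
  rewrite mevalB !expr2 mevalM mevalXU (raddf_sum (meval (v 0))) /=; congr (_ - _).
  by apply: eq_bigr => k _; rewrite mevalZ mevalM !mevalXU.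
rewrite /on_locus /hyperelliptic_model; set l := (X in _ :: X).
have el : l = [seq 'X_(inord i) * 'X_(inord j.+1) - 'X_(inord i.+1) * 'X_(inord j)
  | i <- iota 0 4, j <- iota 0 4] by [].
clearbody l => /=.
apply: (iffP and3P) => -[v0 h1 h2]; split=> //.
- by move: h1; rewrite e1 subr_eq0 => /eqP.
- move=> i j i4 j4; move/allP: h2 => /(_ ('X_(inord i) * 'X_(inord j.+1) - 'X_(inord i.+1) * 'X_(inord j))).
  rewrite mevalB !mevalM !mevalXU subr_eq0 => h; apply/eqP; apply: h.
  by rewrite el; apply/allpairsP; exists (i, j); rewrite !mem_iota.
- by rewrite e1 h1 subrr.
rewrite el; apply/allP => _ /allpairsP[[i j] [hi hj ->]]; rewrite !mem_iota in hi hj.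
by rewrite mevalB !mevalM !mevalXU h2 // subrr.
Qed.

Lemma half9 k : (k < 9)%N -> (k./2 < 5)%N /\ (uphalf k < 5)%N.
Proof. by case: k => [|[|[|[|[|[|[|[|[|//]]]]]]]]]. Qed.

Lemma hev_halves f s t : hev f s t =
  \sum_(k < 9) f`_k * ((s ^+ k./2 * t ^+ (4 - k./2)) * (s ^+ (uphalf k) * t ^+ (4 - uphalf k))).
Proof.
apply: eq_bigr => k _; rewrite mulrACA -!exprD mulrA.
have e : (k./2 + uphalf k = k)%N by rewrite uphalf_half addnCA addnn odd_double_half.
have [h1 h2] := half9 (ltn_ord k).
congr (_ * _ ^+ _ * _ ^+ _); first by rewrite e.
by rewrite addnBA // addnC addnBA // -subnDA e.
Qed.

Lemma pt_on_model f s t y : (s != 0) || (t != 0) -> y ^+ 2 = hev f s t ->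
  on_locus (model f) (pt s t y).
Proof.
move=> st hy; apply/on_modelP; split.
- apply/negP => /eqP /rowP h; case/orP: st => [s0|t0].
    have := h (inord 4); rewrite pt_lt // mxE subnn expr0 mulr1 => /eqP.
    by rewrite expf_eq0 (negPf s0).
  have := h (inord 0); rewrite pt_lt // mxE expr0 mul1r => /eqP.
  by rewrite expf_eq0 (negPf t0).
- rewrite pt_last hy hev_halves; apply: eq_bigr => k _.
  by have [h1 h2] := half9 (ltn_ord k); rewrite !pt_lt.
move=> i j i4 j4; rewrite !pt_lt ?ltnS ?(ltnW i4) ?(ltnW j4) //.
rewrite mulrACA -!exprD [RHS]mulrACA -!exprD addSnnS; congr (_ * _ ^+ _).
by rewrite -subSS subSn ?(ltnW i4) // [(4 - j)%N]subSn -1?ltnS // addSnnS subSS.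
Qed.

(** The quadrics make the first five coordinates a geometric progression, or leave only the last of
    these five nonzero. The vertex of the cone is excluded because y^2 is a combination of products
    of these coordinates. *)
Lemma model_param f v : on_locus (model f) v -> exists2 c, c != 0 &
  (exists x y, v = c *: pt x 1 y /\ y ^+ 2 = hev f x 1) \/
  (exists y, v = c *: pt 1 0 y /\ y ^+ 2 = f`_8).
Proof.
case/on_modelP => v0 hy hq.
case: (eqVneq (v 0 (inord 0)) 0) => [x0|x0].
  have sq (x z : C) : x * x = z -> z = 0 -> x = 0.
    by move=> <- /eqP; rewrite mulf_eq0 orbb => /eqP.
  have x1 : v 0 (inord 1) = 0 by apply: sq (esym (hq 0%N 1%N isT isT)) _; rewrite x0 mul0r.
  have x2 : v 0 (inord 2) = 0 by apply: sq (esym (hq 1%N 2%N isT isT)) _; rewrite x1 mul0r.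
  have x3 : v 0 (inord 3) = 0 by apply: sq (esym (hq 2%N 3%N isT isT)) _; rewrite x2 mul0r.
  have hy4 : v 0 ord_max ^+ 2 = f`_8 * v 0 (inord 4) ^+ 2.
    rewrite hy (bigD1 ord_max) //= big1 ?addr0 ?expr2 // => k k8.
    suff -> : v 0 (inord k./2) = 0 by rewrite mul0r mulr0.
    by case: k k8 => -[|[|[|[|[|[|[|[|[|//]]]]]]]]] //= ? _; rewrite ?x0 ?x1 ?x2 ?x3.
  have x4 : v 0 (inord 4) != 0.
    apply: contraNneq v0 => x4; apply/eqP/eq_row6 => [k k5|].
      by rewrite mxE; case: k k5 => [|[|[|[|[|//]]]]] _.
    by move/eqP: hy4; rewrite x4 expr0n mulr0 expf_eq0 mxE /= => /eqP.
  exists (v 0 (inord 4)) => //; right; exists (v 0 ord_max / v 0 (inord 4)); split.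
    apply: eq_row6 => [k k5|]; rewrite [RHS]mxE ?pt_last; last by rewrite mulrC divfK.
    rewrite pt_lt // expr1n mul1r; case: k k5 => [|[|[|[|[|//]]]]] _.
    - by rewrite x0 expr0n mulr0.
    - by rewrite x1 expr0n mulr0.
    - by rewrite x2 expr0n mulr0.
    - by rewrite x3 expr0n mulr0.
    - by rewrite expr0 mulr1.
  by rewrite expr_div_n hy4 mulfK // expf_neq0.
pose x := v 0 (inord 1) / v 0 (inord 0).
have hk k : (k < 5)%N -> v 0 (inord k) = v 0 (inord 0) * x ^+ k.
  elim: k => [|k IH] k5; first by rewrite expr0 mulr1.
  apply: (mulfI x0); rewrite (hq 0%N k isT) ?IH //; last exact: ltnW.
  by rewrite exprS /x; field.
exists (v 0 (inord 0)) => //; left; exists x, (v 0 ord_max / v 0 (inord 0)); split.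
  apply: eq_row6 => [k k5|]; rewrite [RHS]mxE ?pt_last; last by rewrite mulrC divfK.
  by rewrite pt_lt // expr1n mulr1 hk.
rewrite expr_div_n hy hev_halves mulr_suml; apply: eq_bigr => k _.
have [h1 h2] := half9 (ltn_ord k); rewrite (hk _ h1) (hk _ h2) !expr1n !mulr1.
by move: (x ^+ k./2) (x ^+ uphalf k) => a b; field.
Qed.

(** Powers of y are reduced by y^2 = h(x). Two polynomials S and T serve both charts, (x : 1) and (1
    : x). *)
Lemma form_restrict (S T h : {poly C}) (p : {mpoly C[6]}) : exists A B : {poly C},
  forall x y, y ^+ 2 = h.[x] -> p.@[(pt S.[x] T.[x] y) 0] = A.[x] + B.[x] * y.
Proof.
elim/mpolyind: p => [|c m p _ _ [A [B hAB]]].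
  by exists 0, 0 => x y _; rewrite meval0 !horner0 mul0r addr0.
suff [A' [B' h']] : exists A B : {poly C}, forall x y, y ^+ 2 = h.[x] ->
    ('X_[m] : {mpoly C[6]}).@[(pt S.[x] T.[x] y) 0] = A.[x] + B.[x] * y.
  exists (c *: A' + A), (c *: B' + B) => x y hy.
  by rewrite mevalD mevalZ h' // hAB // !hornerD !hornerZ; ring.
have mono (i : 'I_6) : exists A B : {poly C}, forall x y, y ^+ 2 = h.[x] ->
   pt S.[x] T.[x] y 0 i = A.[x] + B.[x] * y.
  case: (ltnP i 5) => i5.
    exists (S ^+ i * T ^+ (4 - i)), 0 => x y _.
    by rewrite mxE i5 horner0 mul0r addr0 hornerM !horner_exp.
  exists 0, 1 => x y _; rewrite mxE ltnNge i5 /= horner0 hornerC mul1r add0r //.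
have mulc (F G : C -> C -> C) : (exists A B : {poly C}, forall x y, y ^+ 2 = h.[x] -> F x y = A.[x] + B.[x] * y) ->
  (exists A B : {poly C}, forall x y, y ^+ 2 = h.[x] -> G x y = A.[x] + B.[x] * y) ->
  exists A B : {poly C}, forall x y, y ^+ 2 = h.[x] -> F x y * G x y = A.[x] + B.[x] * y.
  move=> [A1 [B1 h1]] [A2 [B2 h2]]; exists (A1 * A2 + B1 * B2 * h), (A1 * B2 + A2 * B1) => x y hy.
  by rewrite h1 // h2 // !(hornerD, hornerM) -hy; ring.
have one : exists A B : {poly C}, forall x y, y ^+ 2 = h.[x] -> 1 = A.[x] + B.[x] * y.
  by exists 1, 0 => x y _; rewrite hornerC horner0 mul0r addr0.
suff : forall r : seq 'I_6, exists A B : {poly C}, forall x y, y ^+ 2 = h.[x] ->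
    \prod_(i <- r) pt S.[x] T.[x] y 0 i ^+ m i = A.[x] + B.[x] * y.
  by move=> /(_ (index_enum _)) [A' [B' h']]; exists A', B' => x y hy; rewrite mevalX h'.
elim=> [|i r IH].
  by have [A1 [B1 h1]] := one; exists A1, B1 => x y hy; rewrite big_nil -h1.
have [|A1 [B1 h1]] := mulc (fun x y => pt S.[x] T.[x] y 0 i ^+ m i) _ _ IH.
  elim: (m i) => [|k [A1 [B1 h1]]].
    by have [A1 [B1 h1]] := one; exists A1, B1 => x y hy; rewrite expr0 -h1.
  have [|A2 [B2 h2]] := mulc _ (fun x y => pt S.[x] T.[x] y 0 i ^+ k) (mono i); first by exists A1, B1.
  by exists A2, B2 => x y hy; rewrite exprS h2.
by exists A1, B1 => x y hy; rewrite big_cons h1.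
Qed.

(** A simple root of f has odd multiplicity in B^2 f and even multiplicity in A^2. *)
Lemma norm_eq0 f A B : octic f -> A ^+ 2 - B ^+ 2 * f = 0 -> A = 0 /\ B = 0.
Proof.
move=> oF /eqP; rewrite subr_eq0 => /eqP e.
have B0 : B = 0.
  apply/eqP/negPn/negP => B0; have sf : separable_poly f by case/andP: oF.
  have f0 := octic_neq0 oF.
  have [x fx] := octic_root oF.
  have A0 : A != 0.
    by apply: contraTneq (expf_neq0 2 B0) => A0; move: e; rewrite A0 expr0n => /esym/eqP; rewrite mulf_eq0 (negPf f0) orbF => ->.
  have := congr1 (fun p => odd (mup x p)) e.
  by rewrite mup_sqr // mupM ?expf_neq0 // oddD mup_sqr // (mup_separable sf fx).
by split=> //; move/eqP: e; rewrite B0 expr0n mul0r expf_eq0 => /eqP.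
Qed.

Lemma generic_zero f A B W : W != 0 -> f != 0 ->
  (forall x y, W.[x] != 0 -> y ^+ 2 = f.[x] -> A.[x] + B.[x] * y = 0) -> A = 0 /\ B = 0.
Proof.
move=> W0 f0 H.
have key x : (W * f).[x] != 0 -> A.[x] = 0 /\ B.[x] = 0.
  rewrite hornerM mulf_eq0 negb_or => /andP[Wx fx].
  have y2 := sqrtCK f.[x]; have y2' := y2; rewrite -sqrrN in y2'.
  have h1 := H x _ Wx y2; have h2 := H x _ Wx y2'.
  have y0 : sqrtC f.[x] != 0 by rewrite sqrtC_eq0.
  have n2 : (2 : C) != 0 by rewrite pnatr_eq0.
  have Ax : A.[x] = 0.
    apply: (mulfI n2); rewrite mulr0 -[RHS](addr0 0) -{1}h1 -h2; ring.
  split=> //; apply: (mulIf y0); rewrite mul0r -[RHS]h1 Ax add0r //.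
have Wf : W * f != 0 by rewrite mulf_neq0.
by split; apply: (poly_eq0_generic Wf) => x /key[].
Qed.

(** On the affine chart the form restricts to A + B y, which vanishes generically, so A = B = 0. The
    points at infinity are reached through the chart (1 : x), where the curve is y^2 = h(x) with h
    the reversed octic. *)
Lemma form_vanishes f W d (p : {mpoly C[6]}) : octic f -> W != 0 -> p \is d.-homog ->
  (forall x y, W.[x] != 0 -> y ^+ 2 = f.[x] -> p.@[(pt x 1 y) 0] = 0) ->
  forall v, on_locus (model f) v -> p.@[v 0] = 0.
Proof.
move=> oF W0 hp H; have f9 := octic_size oF; have f0 := octic_neq0 oF.
have aff x y : y ^+ 2 = f.[x] -> p.@[(pt x 1 y) 0] = 0.
  have [A [B hAB]] := form_restrict 'X 1%:P f p.
  have [|A0 B0] := @generic_zero f A B W W0 f0.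
    by move=> x' y' Wx hy; rewrite -hAB // hornerX hornerC H.
  by move=> hy; have := hAB x y hy; rewrite hornerX hornerC A0 B0 !horner0 mul0r addr0.
pose h : {poly C} := \poly_(k < 9) f`_(8 - k).
have hE x : h.[x] = hev f 1 x.
  rewrite horner_poly [RHS](reindex_inj rev_ord_inj) /=; apply: eq_bigr => k _.
  by rewrite subSS expr1n mulr1 subKn // -ltnS.
have h0 : h != 0.
  apply: contraNneq f0 => h0; apply/eqP; apply: (@eq_octic _ f 0 f9); rewrite ?size_poly0 // => k k9.
  have := congr1 (fun q : {poly C} => q`_(8 - k)) h0.
  by rewrite coef_poly ltnS leq_subr subKn // !coef0.
have inf y : y ^+ 2 = f`_8 -> p.@[(pt 1 0 y) 0] = 0.
  have [A [B hAB]] := form_restrict 1%:P 'X h p.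
  have [||A0 B0] := @generic_zero h A B 'X _ h0; first by rewrite polyX_eq0.
    move=> x y'; rewrite hornerX => x0 hy; rewrite -hAB // hornerX hornerC.
    have -> : pt 1 x y' = x ^+ 4 *: pt x^-1 1 (y' / x ^+ 4).
      by rewrite -pt_scale mulfV // mulr1 mulrCA mulfV ?expf_neq0 // mulr1.
    rewrite (meval_homog _ _ hp) aff ?mulr0 // horner_hev // expr_div_n hy hE.
    have := hevZ f x^-1 1 x; rewrite mulfV // mulr1 => ->; rewrite -exprM mulrC mulKf ?expf_neq0 //.
  move=> hy; have := hAB 0 y; rewrite hE hev0 expr1n mulr1 => /(_ hy).
  by rewrite hornerX hornerC A0 B0 !horner0 mul0r addr0.
move=> v /model_param[c c0 [[x [y [-> hy]]]|[y [-> hy]]]]; rewrite (meval_homog _ _ hp).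
  by rewrite aff ?mulr0 // horner_hev.
by rewrite inf ?mulr0.
Qed.

(** The norm A^2 - B^2 f of the restriction A + B y is either zero, and then the form vanishes on
    the curve, or a polynomial W bounding the zeros. This is irreducibility of the curve in usable
    form. *)
Lemma form_dichotomy f d (p : {mpoly C[6]}) : octic f -> p \is d.-homog ->
  (forall v, on_locus (model f) v -> p.@[v 0] = 0) \/
  exists2 W : {poly C}, W != 0 & forall x y, W.[x] != 0 -> y ^+ 2 = f.[x] -> p.@[(pt x 1 y) 0] != 0.
Proof.
move=> oF hp; have [A [B hAB]] := form_restrict 'X 1%:P f p.
case: (eqVneq (A ^+ 2 - B ^+ 2 * f) 0) => [/(norm_eq0 oF)[A0 B0]|N0].
  left; apply: (form_vanishes oF (oner_neq0 _) hp) => x y _ hy.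
  by have := hAB x y hy; rewrite hornerX hornerC A0 B0 !horner0 mul0r addr0.
right; exists (A ^+ 2 - B ^+ 2 * f) => // x y Nx hy.
apply: contraNneq Nx; have := hAB x y hy; rewrite hornerX hornerC => -> /eqP.
rewrite addr_eq0 => /eqP eA.
by rewrite !hornerE eA -hy; apply/eqP; ring.
Qed.

End HyperellipticModel.

(** * Injectivity of isomorphisms and transport of automorphisms *)

Section Rigidity.

Variable C : closedFieldType.

Lemma isomorphism_inj n m (X : seq {mpoly C[n.+1]}) (Y : seq {mpoly C[m.+1]}) phi v w :
  isomorphism X Y phi -> on_locus X v -> on_locus X w ->
  proj_eq (phi v) (phi w) -> proj_eq v w.
Proof.
move=> [[XY _] [psi [mpsi e1 _]]] Xv Xw e.
apply: proj_eq_trans (proj_eq_sym (e1 _ Xv)) _; apply: proj_eq_trans (e1 _ Xw).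
by apply: (morphism_proj mpsi) e; apply: XY.
Qed.

Lemma card_Aut_gt_isomorphic n m (X : seq {mpoly C[n.+1]}) (Y : seq {mpoly C[m.+1]}) k :
  isomorphic X Y -> card_Aut_gt X k -> card_Aut_gt Y k.
Proof.
move=> [phi iphi] [a [ia da]]; have [mphi [psi [mpsi e1 e2]]] := iphi.
have ipsi : isomorphism Y X psi by split=> //; exists phi.
exists (fun i => phi \o (a i \o psi)); split=> [i|i j ij H].
  exact: isomorphism_comp (isomorphism_comp ipsi (ia i)) iphi.
apply: (da i j ij) => v Xv; have Yv := mphi.1 _ Xv; have Xv' := mpsi.1 _ Yv.
have mv l : proj_eq (a l (psi (phi v))) (a l v).
  by apply: (morphism_proj (ia l).1) (e1 _ Xv).
apply: proj_eq_trans (proj_eq_sym (mv i)) _; apply: proj_eq_trans (mv j).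
by apply: (isomorphism_inj iphi) (H _ Yv); apply: (ia _).1.1.
Qed.

Lemma proj_eq_minors n (u w : 'rV[C]_n.+1) : u != 0 -> w != 0 ->
  (forall i j, u 0 i * w 0 j = u 0 j * w 0 i) -> proj_eq u w.
Proof.
move=> u0 w0 h; have [i wi] : exists i, w 0 i != 0.
  apply/existsP; apply: contraNT w0; rewrite negb_exists => /forallP w0.
  by apply/eqP/rowP => i; rewrite mxE; apply/eqP; have := w0 i; rewrite negbK.
have e : u = (u 0 i / w 0 i) *: w.
  by apply/rowP => j; rewrite mxE mulrAC h mulfK.
exists (u 0 i / w 0 i) => //; apply: contraNneq u0 => c0.
by rewrite e c0 scale0r.
Qed.

End Rigidity.

(** * Isomorphisms between models are Moebius maps *)

Section ModelMorphisms.

Variable C : numClosedFieldType.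
Implicit Types (f : {poly C}) (x y : C).

Local Notation model := (@hyperelliptic_model C 3).

Lemma scale_rowE n (c : C) (v : 'rV[C]_n) i : (c *: v) 0 i = c * v 0 i.
Proof. exact: mxE. Qed.

Lemma affine_pt_inj x y x' y' :
  proj_eq (pt x 1 y) (pt x' 1 y') -> x = x' /\ y = y'.
Proof.
move=> [c c0 /rowP e]; have e0 := e (inord 0); have e1 := e (inord 1).
have e5 := e ord_max; move: e0 e1 e5; rewrite !scale_rowE !pt_lt // !pt_last.
by rewrite !expr1n expr0 !expr1 !mulr1 => <-; rewrite !mul1r.
Qed.

Lemma hornerM_neq0 (p q : {poly C}) x : ((p * q).[x] != 0) = (p.[x] != 0) && (q.[x] != 0).
Proof. by rewrite hornerM mulf_eq0 negb_or. Qed.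

Lemma affine_on_model f x y : octic f -> y ^+ 2 = f.[x] -> on_locus (model f) (pt x 1 y).
Proof.
by move=> /octic_size f9 hy; apply: pt_on_model; rewrite ?oner_neq0 ?orbT // hy horner_hev.
Qed.

Lemma affine_param f v : octic f -> on_locus (model f) v -> v 0 (inord 0) != 0 ->
  let u := v 0 (inord 1) / v 0 (inord 0) in let w := v 0 ord_max / v 0 (inord 0) in
  v = v 0 (inord 0) *: pt u 1 w /\ w ^+ 2 = f.[u].
Proof.
move=> /octic_size f9 /model_param[c c0 [[x [y [-> hy]]]|[y [-> _]]]]; last first.
  by rewrite mxE pt_lt // expr0n !mulr0 eqxx.
rewrite !scale_rowE !pt_lt // pt_last !expr1n expr0 expr1 !mulr1 => _ /=.
by rewrite -!mulrA ![c * (_ / c)]mulrCA mulfV // !mulr1 horner_hev.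
Qed.

(** Two morphisms agree at a point when the minors of their local expressions vanish there; these
    minors are forms that vanish generically, hence on the whole model. *)
Lemma morphism_generic_eq f m (Y : seq {mpoly C[m.+1]}) phi psi (W : {poly C}) :
  octic f -> morphism (model f) Y phi -> morphism (model f) Y psi -> W != 0 ->
  (forall x y, W.[x] != 0 -> y ^+ 2 = f.[x] -> proj_eq (phi (pt x 1 y)) (psi (pt x 1 y))) ->
  forall v, on_locus (model f) v -> proj_eq (phi v) (psi v).
Proof.
move=> oF [_ lphi] [_ lpsi] W0 H v Xv.
have [d [P [hP Pv HP]]] := lphi _ Xv; have [e [Q [hQ Qv HQ]]] := lpsi _ Xv.
apply: proj_eq_trans (HP _ Xv Pv) _; apply: proj_eq_trans (proj_eq_sym (HQ _ Xv Qv)).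
apply: proj_eq_minors => // i j.
have hp : P i * Q j - P j * Q i \is (d + e).-homog by rewrite rpredB ?dhomogM.
have := form_vanishes oF W0 hp _ Xv.
rewrite mevalB !mevalM !mxE => h; apply/eqP; rewrite -subr_eq0 h // => x y Wx hy.
have Xw := affine_on_model oF hy; set w := pt x 1 y in Xw *.
have eP k : (P k).@[w 0] = eval_forms P w 0 k by rewrite mxE.
have eQ k : (Q k).@[w 0] = eval_forms Q w 0 k by rewrite mxE.
rewrite mevalB !mevalM !eP !eQ.
case: (eqVneq (eval_forms P w) 0) => [->|Pw]; first by rewrite !mxE !mul0r subrr.
case: (eqVneq (eval_forms Q w) 0) => [->|Qw]; first by rewrite !mxE !mulr0 subrr.
have [c c0 ->] : proj_eq (eval_forms P w) (eval_forms Q w).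
  apply: proj_eq_trans (proj_eq_sym (HP _ Xw Pw)) _; apply: proj_eq_trans (HQ _ Xw Qw).
  exact: H.
by rewrite !scale_rowE; apply/eqP; rewrite subr_eq0; apply/eqP; ring.
Qed.

Lemma pigeon_sqrt (a y1 y2 y3 : C) : y1 ^+ 2 = a -> y2 ^+ 2 = a -> y3 ^+ 2 = a ->
  [\/ y1 = y2, y1 = y3 | y2 = y3].
Proof.
move=> <- /eqP; rewrite eqf_sqr => /orP[]/eqP->; first by constructor 1.
by move=> /eqP; rewrite eqf_sqr => /orP[]/eqP->; [constructor 2|constructor 3].
Qed.

(** The target has at most two points at infinity, while three points with distinct x would have to
    go there injectively. *)
Lemma affine_at_infinity f f' phi (W : {poly C}) : octic f -> W != 0 ->
  isomorphism (model f) (model f') phi ->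
  ~ (forall x y, W.[x] != 0 -> y ^+ 2 = f.[x] -> phi (pt x 1 y) 0 (inord 0) = 0).
Proof.
move=> oF W0 iphi H; have mphi := iphi.1.
have key x : W.[x] != 0 -> exists y y', [/\ y ^+ 2 = f.[x], y' ^+ 2 = f'`_8 & proj_eq (phi (pt x 1 y)) (pt 1 0 y')].
  move=> Wx; have hy := sqrtCK f.[x]; have h0 := H _ _ Wx hy.
  have := mphi.1 _ (affine_on_model oF hy) => /model_param[c c0 [[u [w [e _]]]|[w [e hw]]]].
    by move: h0 c0; rewrite e mxE pt_lt // expr0 expr1n !mulr1 => ->; rewrite eqxx.
  by exists (sqrtC f.[x]), w; split=> //; exists c.
have [x1 Wx1] := generic_point W0.
have [|x2] := @generic_point _ (W * ('X - x1%:P)); first by rewrite mulf_neq0 ?polyXsubC_eq0.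
rewrite hornerM_neq0 !hornerE subr_eq0 => /andP[Wx2 x21].
have [|x3] := @generic_point _ (W * (('X - x1%:P) * ('X - x2%:P))).
  by rewrite !mulf_neq0 ?polyXsubC_eq0.
rewrite !hornerM_neq0 !hornerXsubC !subr_eq0 => /and3P[Wx3 x31 x32].
have [y1 [z1 [h1 k1 p1]]] := key _ Wx1; have [y2 [z2 [h2 k2 p2]]] := key _ Wx2.
have [y3 [z3 [h3 k3 p3]]] := key _ Wx3.
have sep x y x' y' z z' : x' != x -> y ^+ 2 = f.[x] -> y' ^+ 2 = f.[x'] -> z = z' ->
   proj_eq (phi (pt x 1 y)) (pt 1 0 z) -> proj_eq (phi (pt x' 1 y')) (pt 1 0 z') -> False.
  move=> ne hy hy' <- p p'; case/eqP: ne.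
  suff /affine_pt_inj[] : proj_eq (pt x' 1 y') (pt x 1 y) by [].
  apply: (isomorphism_inj iphi); rewrite ?affine_on_model //.
  exact: proj_eq_trans p' (proj_eq_sym p).
case: (pigeon_sqrt k1 k2 k3) => e.
- exact: (sep _ _ _ _ _ _ x21 h1 h2 e).
- exact: (sep _ _ _ _ _ _ x31 h1 h3 e).
- exact: (sep _ _ _ _ _ _ x32 h2 h3 e).
Qed.

(** A local expression at a single point is valid generically by [form_dichotomy]. Its coordinates
    0, 1 and last give the affine map (x, y) -> (u, w) to which [curve_map_mobius] applies. *)
Lemma isomorphism_mobius f f' phi : octic f -> octic f' ->
  isomorphism (model f) (model f') phi ->
  exists (M : 'M[C]_2) (e : C), [/\ det2 M != 0, e != 0, act M f' = e ^+ 2 *: f &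
    exists2 W : {poly C}, W != 0 & forall x y, W.[x] != 0 -> y ^+ 2 = f.[x] ->
      proj_eq (phi (pt x 1 y)) (pt (M 0 0 * x + M 0 1) (M 1 0 * x + M 1 1) (e * y))].
Proof.
move=> oF oF' iphi; have [XY loc] := iphi.1.
have hy0 := sqrtCK f.[0]; set y0 := sqrtC _ in hy0.
have Xv0 := affine_on_model oF hy0.
have [d [P [hP Pv HP]]] := loc _ Xv0.
have [i0 Pi0] : exists i, (P i).@[(pt 0 1 y0) 0] != 0.
  apply/existsP; apply: contraNT Pv; rewrite negb_exists => /forallP h.
  by apply/eqP/rowP => i; rewrite !mxE; apply/eqP; have := h i; rewrite negbK.
have [h|[W1 W10 hW1]] := form_dichotomy oF (hP i0).
  by move: Pi0; rewrite (h _ Xv0) eqxx.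
have phiP x y : W1.[x] != 0 -> y ^+ 2 = f.[x] ->
    proj_eq (phi (pt x 1 y)) (eval_forms P (pt x 1 y)).
  move=> Wx hy; apply: HP; first exact: affine_on_model.
  by apply: contraNneq (hW1 _ _ Wx hy) => /rowP/(_ i0); rewrite !mxE => ->.
have [h|[W2 W20 hW2]] := form_dichotomy oF (hP (inord 0)).
  case: (@affine_at_infinity f f' phi W1 oF W10 iphi) => x y Wx hy.
  have [c c0 ->] := phiP _ _ Wx hy.
  by rewrite 2!mxE h ?mulr0 //; apply: affine_on_model.
have [a0 [b0 h0]] := form_restrict 'X 1%:P f (P (inord 0)).
have [a1 [b1 h1]] := form_restrict 'X 1%:P f (P (inord 1)).
have [a5 [b5 h5]] := form_restrict 'X 1%:P f (P ord_max).
(* D is the norm of the denominator a0 + b0 y; multiplying by the conjugate a0 - b0 y leaves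
   denominators in x alone. *)
pose D := a0 ^+ 2 - b0 ^+ 2 * f.
pose A := a1 * a0 - b1 * b0 * f; pose B := b1 * a0 - a1 * b0.
pose A' := a5 * a0 - b5 * b0 * f; pose B' := b5 * a0 - a5 * b0.
have W12 : W1 * W2 != 0 by rewrite mulf_neq0.
have key x y : (W1 * W2).[x] != 0 -> D.[x] != 0 -> y ^+ 2 = f.[x] ->
   ((A'.[x] + B'.[x] * y) / D.[x]) ^+ 2 = f'.[(A.[x] + B.[x] * y) / D.[x]] /\
   proj_eq (phi (pt x 1 y)) (pt ((A.[x] + B.[x] * y) / D.[x]) 1 ((A'.[x] + B'.[x] * y) / D.[x])).
  rewrite hornerM_neq0 => /andP[Wx1 Wx2] Dx hy.
  have Xw := affine_on_model oF hy.
  have [c c0 ec] := phiP _ _ Wx1 hy.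
  have Ew0 : eval_forms P (pt x 1 y) 0 (inord 0) = a0.[x] + b0.[x] * y.
    by rewrite mxE -h0 // hornerX hornerC.
  have Ew1 : eval_forms P (pt x 1 y) 0 (inord 1) = a1.[x] + b1.[x] * y.
    by rewrite mxE -h1 // hornerX hornerC.
  have Ew5 : eval_forms P (pt x 1 y) 0 ord_max = a5.[x] + b5.[x] * y.
    by rewrite mxE -h5 // hornerX hornerC.
  have w0 : a0.[x] + b0.[x] * y != 0.
    by rewrite -Ew0 mxE; apply: hW2.
  have eD : D.[x] = (a0.[x] + b0.[x] * y) * (a0.[x] - b0.[x] * y).
    by rewrite /D !hornerE -hy; ring.
  have w0' : a0.[x] - b0.[x] * y != 0 by apply: contraNneq Dx => e; rewrite eD e mulr0.
  have eA : (A.[x] + B.[x] * y) / D.[x] = (a1.[x] + b1.[x] * y) / (a0.[x] + b0.[x] * y).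
    by rewrite eD /A /B !hornerE -hy; field; rewrite w0.
  have eA' : (A'.[x] + B'.[x] * y) / D.[x] = (a5.[x] + b5.[x] * y) / (a0.[x] + b0.[x] * y).
    by rewrite eD /A' /B' !hornerE -hy; field; rewrite w0.
  have phi0 : phi (pt x 1 y) 0 (inord 0) != 0.
    by rewrite ec [X in X != 0]mxE Ew0 mulf_neq0.
  have [e1 e2] := affine_param oF' (XY _ Xw) phi0.
  move: e1 e2; rewrite ec !scale_rowE Ew0 Ew1 Ew5 -!mulf_div mulfV // !mul1r -eA -eA' => e1 e2.
  split=> //; exists (c * (a0.[x] + b0.[x] * y)); rewrite ?mulf_neq0 // -e1 //.
have D0 : D != 0.
  apply/eqP => /(norm_eq0 oF)[A0 B0]; have [x] := generic_point W20 => Wx.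
  have hy := sqrtCK f.[x]; have := hW2 _ _ Wx hy; have := h0 _ _ hy.
  by rewrite hornerX hornerC A0 B0 !horner0 mul0r addr0 => ->; rewrite eqxx.
have [|||M [e [detM e0 actM [W W0 HW]]]] := @curve_map_mobius _ f f' A B A' B' D _ oF D0 W12.
- by move=> x y Zx Dx hy; have [] := key _ _ Zx Dx hy.
- exact: octic_size.
- move=> x1 y1 x2 y2 Z1 D1 hy1 Z2 D2 hy2 eu ev.
  have [_ p1] := key _ _ Z1 D1 hy1; have [_ p2] := key _ _ Z2 D2 hy2.
  apply: affine_pt_inj; apply: (isomorphism_inj iphi); rewrite ?affine_on_model //.
  by apply: proj_eq_trans p1 _; rewrite eu ev; apply: proj_eq_sym.
exists M, e; split=> //; exists (W * (W1 * W2 * D)); first by rewrite !mulf_neq0.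
move=> x y; rewrite hornerM_neq0 [X in _ && X]hornerM_neq0 => /and3P[Wx Zx Dx] hy.
have [_ p] := key _ _ Zx Dx hy; have [q0 eu ev] := HW _ _ Wx hy.
apply: proj_eq_trans p _; rewrite eu ev; set q := M 1 0 * x + M 1 1 in q0 *.
apply: proj_eq_sym; exists (q ^+ 4); first by rewrite expf_neq0.
by rewrite -pt_scale mulr1; congr pt; field.
Qed.

End ModelMorphisms.

(** * From five automorphisms to two stabilisers *)

Section AutomorphismsAndStabilizers.

Variable C : numClosedFieldType.

Local Notation model := (@hyperelliptic_model C 3).

(** A matrix up to scalars determines the factor of y up to sign, so at most two automorphisms share
    it. Of five, at most two are scalar and at most two share the class of a chosen nonscalar one,
    which leaves another. *)
Lemma stab_of_automorphisms (f : {poly C}) : octic f -> card_Aut_gt (model f) 4 ->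
  exists M N, [/\ stab f M, stab f N, nonscalar M, nonscalar N & forall k, N <> k *: M].
Proof.
move=> oF [a [ia da]].
pose lifts i (p : 'M[C]_2 * C) := [/\ det2 p.1 != 0, p.2 != 0, act p.1 f = p.2 ^+ 2 *: f &
  exists2 W : {poly C}, W != 0 & forall x y, W.[x] != 0 -> y ^+ 2 = f.[x] ->
    proj_eq (a i (pt x 1 y)) (pt (p.1 0 0 * x + p.1 0 1) (p.1 1 0 * x + p.1 1 1) (p.2 * y))].
have [Me hMe] : {Me & forall i, lifts i (Me i)}.
  apply: (@boolp.choice _ _ lifts) => i.
  by have [M [e h]] := isomorphism_mobius oF oF (ia i); exists (M, e).
pose r i j := exists2 k, k != 0 & (Me i).1 = k *: (Me j).1.
have rs i j : r i j -> r j i.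
  by move=> [k k0 e]; exists k^-1; rewrite ?invr_eq0 // e scalerA mulVf ?scale1r.
have rt i j l : r i j -> r j l -> r i l.
  by move=> [k k0 e] [k' k0' e']; exists (k * k'); rewrite ?mulf_neq0 // e e' scalerA.
have sgn i j : r i j -> exists2 k, k != 0 & (Me i).1 = k *: (Me j).1 /\
    ((Me i).2 = k ^+ 4 * (Me j).2 \/ (Me i).2 = - (k ^+ 4 * (Me j).2)).
  move=> [k k0 e]; exists k => //; split=> //.
  have [_ _ ai _] := hMe i; have [_ _ aj _] := hMe j.
  have : (Me i).2 ^+ 2 *: f = (k ^+ 4 * (Me j).2) ^+ 2 *: f.
    by rewrite -ai e act_scale aj scalerA; congr (_ *: _); ring.
  move=> /eqP; rewrite -subr_eq0 -scalerBl scaler_eq0 (negPf (octic_neq0 oF)) orbF subr_eq0 eqf_sqr.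
  by case/orP => /eqP; [left|right].
have same i j k : k != 0 -> (Me i).1 = k *: (Me j).1 -> (Me i).2 = k ^+ 4 * (Me j).2 -> i = j.
  move=> k0 eM ee; apply/eqP/negPn/negP => ij; apply: (da i j ij).
  have [_ _ _ [Wi Wi0 Hi]] := hMe i; have [_ _ _ [Wj Wj0 Hj]] := hMe j.
  apply: (morphism_generic_eq oF (ia i).1 (ia j).1 (mulf_neq0 Wi0 Wj0)) => x y.
  rewrite hornerM_neq0 => /andP[Wix Wjx] hy.
  apply: proj_eq_trans (Hi _ _ Wix hy) _; apply: proj_eq_trans (proj_eq_sym (Hj _ _ Wjx hy)).
  exists (k ^+ 4); rewrite ?expf_neq0 // -pt_scale eM ee !scale2E; congr pt; ring.
(* Relative to the automorphism i, both j and l must carry the sign -1; but then they coincide. *)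
have three i j l : i != j -> i != l -> j != l -> r j i -> r l i -> False.
  move=> ij il jl /sgn[k k0 [ek sk]] /sgn[k' k0' [ek' sk']].
  case: sk => sk; first by case/eqP: ij; rewrite (same j i k).
  case: sk' => sk'; first by case/eqP: il; rewrite (same l i k').
  case/eqP: jl; apply: (same j l (k / k')); rewrite ?mulf_neq0 ?invr_eq0 //.
    by rewrite ek ek' scalerA divfK.
  by rewrite sk sk' expr_div_n mulrN mulrA divfK ?expf_neq0.
pose scal := [set i | boolp.asbool (exists c, (Me i).1 = c%:M)].
have scalP i : reflect (exists c, (Me i).1 = c%:M) (i \in scal).
  by rewrite inE; apply: boolp.asboolP.
have scal_r i j : i \in scal -> j \in scal -> r i j.
  move=> /scalP[c ec] /scalP[d ed].
  have nz (l : 'I_5) b : (Me l).1 = b%:M -> b != 0.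
    move=> e; have [+ _ _ _] := hMe l; apply: contraNneq => b0.
    by rewrite e b0 /det2 !mxE; apply/eqP; rewrite !mul0rn; ring.
  have c0 := nz _ _ ec; have d0 := nz _ _ ed.
  exists (c / d); first by rewrite mulf_neq0 ?invr_eq0.
  by rewrite ec ed scale_scalar_mx divfK.
have card_scal : (#|scal| <= 2)%N.
  rewrite leqNgt; apply/negP => /card_gt2P[i [j [l [[hi hj hl] [ij jl li]]]]].
  by apply: (three i j l) => //; rewrite 1?eq_sym //; apply: scal_r.
have [i0 hi0] : exists i, i \notin scal.
  apply/existsP; apply: contraTT card_scal; rewrite negb_exists -ltnNge => /forallP h.
  suff -> : scal = setT by rewrite cardsT card_ord.
  by apply/setP => i; rewrite [RHS]inE; have := h i; rewrite negbK.
pose T := [set i | boolp.asbool (r i i0)].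
have TP i : reflect (r i i0) (i \in T) by rewrite inE; apply: boolp.asboolP.
have card_T : (#|T| <= 2)%N.
  rewrite leqNgt; apply/negP => /card_gt2P[i [j [l [[/TP hi /TP hj /TP hl] [ij jl li]]]]].
  by apply: (three i j l) => //; rewrite 1?eq_sym //; apply: (rt _ i0) => //; apply: rs.
have [k0] : exists k, k \notin scal :|: T.
  apply/existsP; have : (#|scal :|: T| < 5)%N.
    by rewrite cardsU (leq_ltn_trans (leq_subr _ _)) // ltnS (leq_add card_scal).
  apply: contraTT; rewrite negb_exists -leqNgt => /forallP h.
  suff -> : scal :|: T = setT by rewrite cardsT card_ord.
  by apply/setP => i; rewrite [RHS]inE; have := h i; rewrite negbK.
rewrite inE negb_or => /andP[hk0 /TP nr].
have [di ei ai _] := hMe i0; have [dk ek ak _] := hMe k0.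
exists (Me i0).1, (Me k0).1; split.
- by split=> //; exists ((Me i0).2 ^+ 2).
- by split=> //; exists ((Me k0).2 ^+ 2).
- by move=> c e; case/scalP: hi0; exists c.
- by move=> c e; case/scalP: hk0; exists c.
move=> k e; apply: nr; exists k => //; apply: contraNneq dk => kz.
by rewrite e kz scale0r /det2 !mxE; apply/eqP; ring.
Qed.

End AutomorphismsAndStabilizers.

(** * Equivalent octics have isomorphic models *)

Section EquivalentOctics.

Variable C : numClosedFieldType.
Implicit Types (f g : {poly C}) (M N : 'M[C]_2) (s t y r c : C) (v w : 'rV[C]_6).

Local Notation model := (@hyperelliptic_model C 3).

Lemma model_dhomog f p : p \in model f -> p \is 2.-homog.
Proof.
rewrite in_cons => /orP[/eqP->|/allpairsP[[i j] [_ _ ->]]]; last first.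
  by apply: rpredB; exact: (dhomogM (dhomogXU _ _) (dhomogXU _ _)).
apply: rpredB; first exact: (dhomogMn 2 (dhomogXU _ _)).
by apply: rpred_sum => k _; apply: rpredZ; exact: (dhomogM (dhomogXU _ _) (dhomogXU _ _)).
Qed.

(* The linear forms in the coordinates of P^5 which extend the substitution
   [M] of the binary forms [s^k t^(4-k)]. *)
Definition lift_forms M r (i : 'I_6) : {mpoly C[6]} :=
  if (i < 5)%N then
    \sum_(l < 5) (lin (M 0 0) (M 0 1) ^+ i * lin (M 1 0) (M 1 1) ^+ (4 - i))`_l *: 'X_(inord l)
  else r *: 'X_ord_max.

Lemma lift_forms_dhomog M r i : lift_forms M r i \is 1.-homog.
Proof.
rewrite /lift_forms; case: ifP => _; last by apply: rpredZ; apply: dhomogXU.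
by apply: rpred_sum => k _; apply: rpredZ; apply: dhomogXU.
Qed.

Lemma lift_forms_pt M r s t y : t != 0 -> eval_forms (lift_forms M r) (pt s t y) =
  pt (M 0 0 * s + M 0 1 * t) (M 1 0 * s + M 1 1 * t) (r * y).
Proof.
move=> t0; apply: eq_row6 => [k k5|]; rewrite ?pt_lt // ?pt_last mxE /lift_forms ltnNge /=; last first.
  by rewrite mevalZ mevalXU pt_last.
rewrite inordK ?(ltn_trans k5) // -ltnNge k5 (raddf_sum (meval (pt s t y 0))) /=.
set q := _ * _; have q5 : (size q <= 5)%N.
  apply: leq_trans (size_polyMleq _ _) _.
  rewrite -subn1 leq_subLR; apply: leq_trans (leq_add (size_lin_exp _ _ _) (size_lin_exp _ _ _)) _.
  by rewrite addSn addnS subnKC // -ltnS.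
transitivity (t ^+ 4 * q.[s / t]).
  rewrite (horner_coef_wide _ q5) mulr_sumr; apply: eq_bigr => l _.
  rewrite mevalZ mevalXU pt_lt // expr_div_n.
  have -> : t ^+ 4 = t ^+ (4 - l) * t ^+ l by rewrite -exprD subnK // -ltnS.
  by have tl := expf_neq0 l t0; move: (t ^+ _) (t ^+ l) (s ^+ l) tl => a b d b0; field.
have -> : t ^+ 4 = t ^+ k * t ^+ (4 - k) by rewrite -exprD subnKC.
rewrite hornerM !horner_exp !horner_lin mulrACA -!exprMn.
by congr (_ ^+ _ * _ ^+ _); field.
Qed.

Lemma eval_lift_forms0 M r : eval_forms (lift_forms M r) 0 = 0.
Proof.
by have := eval_forms_scale 0 0 (lift_forms_dhomog M r); rewrite expr1 !scale0r.
Qed.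

(** [lift_forms_pt] asks for a nonzero second parameter, so the identity is checked away from the
    zero of M_10 x + M_11. It extends to the model as the vanishing of linear forms. *)
Lemma lift_formsK f M N r r' c v : octic f -> det2 M != 0 -> N *m M = c%:M -> r' * r = c ^+ 4 ->
  on_locus (model f) v ->
  eval_forms (lift_forms N r') (eval_forms (lift_forms M r) v) = c ^+ 4 *: v.
Proof.
move=> oF dM NM rr Xv; rewrite -eval_forms_comp; apply/rowP => i; rewrite mxE [RHS]mxE.
have W0 : lin (M 1 0) (M 1 1) != 0.
  apply: contraNneq dM => e; have := congr1 (horner^~ 0) e; have := congr1 (horner^~ 1) e.
  rewrite /= !horner_lin !horner0 mulr0 mulr1 add0r => + e1; rewrite e1 addr0 => e2.
  by rewrite /det2 e1 e2 !mulr0 subrr.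
have hp : lift_forms N r' i \mPo [tuple lift_forms M r j | j < 6] - c ^+ 4 *: 'X_i \is 1.-homog.
  apply: rpredB; last by apply: rpredZ; apply: dhomogXU.
  by apply: (@dhomog_comp _ _ _ 1 1); apply: lift_forms_dhomog.
have := form_vanishes oF W0 hp _ Xv; rewrite mevalB mevalZ mevalXU => h.
apply/eqP; rewrite -subr_eq0 h // => x y; rewrite horner_lin => Wx _ {h}.
rewrite mevalB mevalZ mevalXU; apply/eqP; rewrite subr_eq0; apply/eqP.
transitivity ((c ^+ 4 *: pt x 1 y) 0 i); last by rewrite mxE.
transitivity (eval_forms (fun k => lift_forms N r' k \mPo [tuple lift_forms M r j | j < 6]) (pt x 1 y) 0 i).
  by rewrite mxE.
rewrite eval_forms_comp lift_forms_pt ?oner_neq0 // lift_forms_pt ?mulr1 // -pt_scale mulrA rr.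
have [e1 e2 e3 e4] := scalar2E c; rewrite -NM !mul2E in e1 e2 e3 e4.
congr (pt _ _ _ 0 i).
- have -> : c * x = (N 0 0 * M 0 0 + N 0 1 * M 1 0) * x + 0 by rewrite e1 addr0.
  by rewrite -e2; ring.
have -> : c * 1 = 0 * x + c by rewrite mul0r add0r mulr1.
by rewrite -[in X in _ = _ + X]e4 -e3; ring.
Qed.

(** The equations of the target, pulled back, are forms vanishing at the affine points, hence
    everywhere. The image vector is nonzero because of the inverse in [lift_formsK]. *)
Lemma lift_forms_on_model f g M N r r' c v : octic f -> octic g ->
  det2 M != 0 -> N *m M = c%:M -> c != 0 -> r' * r = c ^+ 4 -> act M f = r ^+ 2 *: g ->
  on_locus (model g) v -> on_locus (model f) (eval_forms (lift_forms M r) v).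
Proof.
move=> oF oG dM NM c0 rr e Xv; rewrite /on_locus; apply/andP; split.
  apply: contraTneq Xv => L0; have K := lift_formsK oG dM NM rr; rewrite /on_locus.
  case: (boolP (on_locus (model g) v)) => [Xv|]; last by rewrite /on_locus.
  have := K _ Xv; rewrite L0 eval_lift_forms0 => /esym/eqP.
  by rewrite scaler_eq0 expf_eq0 (negPf c0) /= => ->.
apply/allP => p hp; apply/eqP.
have hq : p \mPo [tuple lift_forms M r j | j < 6] \is (1 * 2).-homog.
  by apply: dhomog_comp (model_dhomog hp); apply: lift_forms_dhomog.
have ev w : (p \mPo [tuple lift_forms M r j | j < 6]).@[w 0] = p.@[(eval_forms (lift_forms M r) w) 0].
  by rewrite comp_mpoly_meval; apply: meval_eq => j; rewrite tnth_mktuple mxE.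
rewrite -ev; apply: (form_vanishes oG (oner_neq0 _) hq _ Xv) => x y _ hy.
rewrite ev lift_forms_pt ?oner_neq0 // !mulr1.
have : on_locus (model f) (pt (M 0 0 * x + M 0 1) (M 1 0 * x + M 1 1) (r * y)).
  apply: pt_on_model.
    rewrite -negb_and; apply: contra dM => /andP[/eqP h1 /eqP h2]; apply/eqP.
    have -> : det2 M = (M 0 0 * x + M 0 1) * - M 1 0 + M 0 0 * (M 1 0 * x + M 1 1) by rewrite /det2; ring.
    by rewrite h1 h2 mul0r mulr0 addr0.
  have := hev_act M f x 1; rewrite !mulr1 => <-; rewrite e -horner_hev; last first.
    by rewrite (leq_trans (size_scale_leq _ _)) ?octic_size.
  by rewrite hornerZ -hy exprMn.
by case/andP => _ /allP/(_ _ hp)/eqP.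
Qed.

Lemma lift_morphism f g M N r r' c : octic f -> octic g ->
  det2 M != 0 -> N *m M = c%:M -> c != 0 -> r' * r = c ^+ 4 -> act M f = r ^+ 2 *: g ->
  morphism (model g) (model f) (eval_forms (lift_forms M r)).
Proof.
move=> oF oG dM NM c0 rr e; have H := lift_forms_on_model oF oG dM NM c0 rr e.
split=> // v Xv; exists 1%N, (lift_forms M r); split.
- exact: lift_forms_dhomog.
- by case/andP: (H _ Xv).
by move=> w _ _; apply: proj_eq_refl.
Qed.

(** The coordinate y is multiplied by a square root r of k. The inverse uses the adjugate and c^4 /
    r: the other coordinates have degree 4 in (s, t), so the scalar matrix c multiplies them by
    c^4. *)
Lemma equiv_isomorphic f g : octic f -> octic g -> equiv f g -> isomorphic (model g) (model f).
Proof.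
move=> oF oG [M [k [dM k0 e]]]; pose r := sqrtC k; pose c := det2 M.
have r0 : r != 0 by rewrite sqrtC_eq0.
have rr : (c ^+ 4 / r) * r = c ^+ 4 by rewrite divfK.
have rr' : r * (c ^+ 4 / r) = c ^+ 4 by rewrite mulrC.
have er : act M f = r ^+ 2 *: g by rewrite sqrtCK.
have dN : det2 (adj2 M) != 0 by rewrite det2_adj.
have er' : act (adj2 M) g = (c ^+ 4 / r) ^+ 2 *: f.
  have -> : g = (r ^+ 2)^-1 *: act M f by rewrite er scalerA mulVf ?scale1r ?expf_neq0.
  rewrite actZ act_comp mul_adj2 act_scalar ?octic_size // scalerA; congr (_ *: _).
  by rewrite expr_div_n -exprM mulrC.
have c4 : c ^+ 4 != 0 by rewrite expf_neq0.
exists (eval_forms (lift_forms M r)); split.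
  exact: (lift_morphism oF oG dM (adj_mul2 M) dM rr er).
exists (eval_forms (lift_forms (adj2 M) (c ^+ 4 / r))); split.
- exact: (lift_morphism oG oF dN (mul_adj2 M) dM rr' er').
- by move=> v Xv; exists (c ^+ 4); rewrite // (lift_formsK oG dM (adj_mul2 M) rr Xv).
by move=> v Xv; exists (c ^+ 4); rewrite // (lift_formsK oF dN (mul_adj2 M) rr' Xv).
Qed.

End EquivalentOctics.

(** * Smoothness, irreducibility and field of definition of the model *)

Section SmoothModel.

Variable C : numClosedFieldType.
Implicit Types (f g : {poly C}) (u v : 'rV[C]_6).

Local Notation model := (@hyperelliptic_model C 3).

Lemma conj_model (sigma : {rmorphism C -> C}) f :
  conj_curve sigma (model f) = model (map_poly sigma f).
Proof.
rewrite /conj_curve /hyperelliptic_model map_cons; congr (_ :: _).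
  rewrite rmorphB rmorphXn /= map_mpolyX rmorph_sum; congr (_ - _); apply: eq_bigr => k _.
  by rewrite /= map_mpolyZ rmorphM /= !map_mpolyX coef_map.
by rewrite /= !(rmorphB, rmorphM) /= !map_mpolyX.
Qed.

Lemma model_defined_over (F : divringClosed C) f : f \is a polyOver F ->
  defined_over F (model f).
Proof.
move=> /polyOverP Ff; apply/allP => p; rewrite in_cons => /orP[/eqP->|/allpairsP[[i j] [_ _ ->]]]; last first.
  by rewrite rpredB ?rpredM ?mpolyOverX.
rewrite rpredB ?rpredX ?mpolyOverX // rpred_sum // => k _.
by rewrite mpolyOverZ ?Ff // rpredM ?mpolyOverX.
Qed.

Lemma model_homogeneous f : homogeneous (model f).
Proof. by apply/allP => p /model_dhomog/homogE. Qed.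

Lemma model_irreducible f : octic f -> locus_irreducible (model f).
Proof.
move=> oF; split; first by exists (pt 0 1 (sqrtC f.[0])); rewrite affine_on_model ?sqrtCK.
move=> Z1 Z2 hZ1 hZ2 H.
have avoid Z : homogeneous Z -> ~ (forall v, on_locus (model f) v -> on_locus Z v) ->
    exists2 W : {poly C}, W != 0 & forall x y, W.[x] != 0 -> y ^+ 2 = f.[x] -> ~~ on_locus Z (pt x 1 y).
  move=> hZ nZ; case: (boolp.pselect (exists2 p, p \in Z & exists2 v, on_locus (model f) v & p.@[v 0] != 0)).
    move=> [p pZ [v Xv pv]]; have /allP/(_ _ pZ)/homogP[d hp] := hZ.
    have [h|[W W0 hW]] := form_dichotomy oF hp; first by rewrite h ?eqxx in pv.
    exists W => // x y Wx hy; rewrite negb_and; apply/orP; right; apply/allPn; exists p => //.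
    exact: hW.
  move=> h; case: nZ => v Xv; apply/andP; split; first by case/andP: Xv.
  by apply/allP => p pZ; apply/negPn/negP => pv; case: h; exists p => //; exists v.
case: (boolp.pselect (forall v, on_locus (model f) v -> on_locus Z1 v)) => [|n1]; first by left.
case: (boolp.pselect (forall v, on_locus (model f) v -> on_locus Z2 v)) => [|n2]; first by right.
have [W1 W10 h1] := avoid _ hZ1 n1; have [W2 W20 h2] := avoid _ hZ2 n2.
have [x] := generic_point (mulf_neq0 W10 W20); rewrite hornerM_neq0 => /andP[Wx1 Wx2].
have hy := sqrtCK f.[x].
by have [h|h] := H _ (affine_on_model oF hy); [have := h1 _ _ Wx1 hy|have := h2 _ _ Wx2 hy]; rewrite h.
Qed.

Lemma comb_rowE (z0 z1 z2 : C) (a b c : 'rV[C]_6) j :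
  (z0 *: a + z1 *: b + z2 *: c) 0 j = z0 * a 0 j + z1 * b 0 j + z2 * c 0 j.
Proof. by rewrite !mxE. Qed.

Lemma row0E j : (0 : 'rV[C]_6) 0 j = 0.
Proof. by rewrite mxE. Qed.

(** The kernel is a hyperplane in the span of three independent vectors, hence of dimension 2 in
    dimension 6. In the application the span is tangent to the cone over the rational normal curve,
    and (q0, q1, q2) is the differential of the equation in y. *)
Lemma rank_of_kernel m (A : 'M[C]_(6, m)) (a b c : 'rV[C]_6) (q0 q1 q2 : C) :
  (forall z0 z1 z2, z0 *: a + z1 *: b + z2 *: c = 0 -> [/\ z0 = 0, z1 = 0 & z2 = 0]) ->
  [|| q0 != 0, q1 != 0 | q2 != 0] ->
  (forall u, u *m A = 0 <-> exists z0 z1 z2,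
     u = z0 *: a + z1 *: b + z2 *: c /\ z0 * q0 + z1 * q1 + z2 * q2 = 0) ->
  \rank A = 4.
Proof.
move=> indep q0_neq ker.
pose T : 'M[C]_(3, 6) := \matrix_(i < 3, j < 6) nth 0 [:: a 0 j; b 0 j; c 0 j] i.
pose q : 'cV[C]_3 := \col_(i < 3) nth 0 [:: q0; q1; q2] i.
have zT (z : 'rV_3) : z *m T = z 0 0 *: a + z 0 1 *: b + z 0 2 *: c.
  by apply/rowP => j; rewrite mxE sum3 !mxE.
have zq (z : 'rV_3) : z *m q = 0 <-> z 0 0 * q0 + z 0 1 * q1 + z 0 2 * q2 = 0.
  have -> : z 0 0 * q0 + z 0 1 * q1 + z 0 2 * q2 = (z *m q) 0 0.
    by rewrite mxE sum3 !mxE.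
  by split=> [->|h]; [rewrite mxE|apply/rowP => i; rewrite !ord1 h mxE].
have freeT : row_free T.
  apply: inj_row_free => z; rewrite zT => /indep[z0 z1 z2].
  by apply/rowP => i; rewrite [RHS]mxE; case: (ord3 i) => ->.
have rq : \rank q = 1%N.
  apply/eqP; rewrite eqn_leq rank_leq_col lt0n mxrank_eq0.
  apply: contraTneq q0_neq => /colP h.
  have := h 0; have := h 1; have := h 2; rewrite !mxE /= => -> -> ->.
  by rewrite eqxx.
have e : (kermx A :=: kermx q *m T)%MS.
  apply/eqmxP/andP; split.
    apply/row_subP => i; have /ker[z0 [z1 [z2 [-> hq]]]] : row i (kermx A) *m A = 0.
      by apply/sub_kermxP/row_sub.
    pose z : 'rV[C]_3 := \row_j nth 0 [:: z0; z1; z2] j.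
    have -> : z0 *: a + z1 *: b + z2 *: c = z *m T by rewrite zT 3!mxE.
    by apply/submxMr/sub_kermxP/zq; rewrite !mxE.
  apply/sub_kermxP/row_matrixP => i; rewrite row_mul row0; apply/ker.
  rewrite row_mul; set z := row i (kermx q).
  exists (z 0 0), (z 0 1), (z 0 2); split; first exact: zT.
  by apply/zq; rewrite /z -row_mul mulmx_ker row0.
have := mxrank_ker A; rewrite e mxrankMfree // mxrank_ker rq => h.
by rewrite -[LHS](subKn (rank_leq_row A)) -h.
Qed.

Definition deriv_along v u (p : {mpoly C[6]}) := \sum_(j < 6) p^`M(j).@[v 0] * u 0 j.

Lemma deriv_alongB v u p q : deriv_along v u (p - q) = deriv_along v u p - deriv_along v u q.
Proof.
by rewrite /deriv_along -sumrB; apply: eq_bigr => j _; rewrite mderivB mevalB mulrBl.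
Qed.

Lemma deriv_alongZ v u c p : deriv_along v u (c *: p) = c * deriv_along v u p.
Proof.
by rewrite /deriv_along mulr_sumr; apply: eq_bigr => j _; rewrite mderivZ mevalZ mulrA.
Qed.

Lemma deriv_alongM v u p q :
  deriv_along v u (p * q) = deriv_along v u p * q.@[v 0] + p.@[v 0] * deriv_along v u q.
Proof.
rewrite /deriv_along mulr_suml mulr_sumr -big_split; apply: eq_bigr => j _ /=.
by rewrite mderivM mevalD !mevalM; ring.
Qed.

Lemma deriv_along_sum v u n (P : 'I_n -> {mpoly C[6]}) :
  deriv_along v u (\sum_k P k) = \sum_k deriv_along v u (P k).
Proof.
rewrite /deriv_along exchange_big; apply: eq_bigr => j _ /=.
by rewrite (raddf_sum (mderiv j)) (raddf_sum (meval (v 0))) mulr_suml.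
Qed.

Lemma deriv_alongX v u i : deriv_along v u 'X_i = u 0 i.
Proof.
rewrite /deriv_along (bigD1 i) //= big1 ?addr0 => [|j ji]; rewrite mderivX mnmE mevalZ.
  by rewrite eqxx (_ : (U_(i) - U_(i))%MM = 0%MM) ?mpolyX0 ?meval1 ?mul1r //; apply/mnmP => l; rewrite mnmBE mnm0E subnn.
by rewrite eq_sym (negPf ji) !mul0r.
Qed.

Lemma jacobian_kerP f v u : u *m (jacobian (model f) v)^T = 0 <->
  2 * v 0 ord_max * u 0 ord_max = \sum_(k < 9) f`_k *
     (u 0 (inord k./2) * v 0 (inord (uphalf k)) + v 0 (inord k./2) * u 0 (inord (uphalf k))) /\
  forall i j, (i < 4)%N -> (j < 4)%N ->
    u 0 (inord i) * v 0 (inord j.+1) + v 0 (inord i) * u 0 (inord j.+1) =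
    u 0 (inord i.+1) * v 0 (inord j) + v 0 (inord i.+1) * u 0 (inord j).
Proof.
have jE : u *m (jacobian (model f) v)^T = 0 <-> forall p, p \in model f -> deriv_along v u p = 0.
  have e i : (u *m (jacobian (model f) v)^T) 0 i = deriv_along v u (model f)`_i.
    by rewrite mxE; apply: eq_bigr => j _; rewrite !mxE mulrC.
  split=> [/rowP h p /(nthP 0)[i hi <-]|h].
    by have := h (Ordinal hi); rewrite e mxE.
  by apply/rowP => i; rewrite e h ?mxE // mem_nth.
rewrite jE; split=> [h|[h1 h2] p].
  split=> [|i j i4 j4].
    have := h _ (mem_head _ _); rewrite deriv_alongB deriv_along_sum deriv_alongM deriv_alongX mevalXU.
    move/eqP; rewrite subr_eq0 => /eqP; rewrite -mulrA mulrDl !mul1r mulrC => ->.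
    by apply: eq_bigr => k _; rewrite deriv_alongZ deriv_alongM !deriv_alongX !mevalXU.
  have /h : 'X_(inord i) * 'X_(inord j.+1) - 'X_(inord i.+1) * 'X_(inord j) \in model f.
    rewrite in_cons; apply/orP; right; apply/allpairsP; exists (i, j).
    by rewrite !mem_iota.
  rewrite deriv_alongB !deriv_alongM !deriv_alongX !mevalXU => /eqP.
  by rewrite subr_eq0 => /eqP.
rewrite in_cons => /orP[/eqP->|/allpairsP[[i j] [hi hj ->]]].
  rewrite deriv_alongB deriv_along_sum deriv_alongM deriv_alongX mevalXU.
  apply/eqP; rewrite subr_eq0; apply/eqP; transitivity (2 * v 0 ord_max * u 0 ord_max); first by ring.
  rewrite h1; apply: eq_bigr => k _.
  by rewrite deriv_alongZ deriv_alongM !deriv_alongX !mevalXU.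
rewrite !mem_iota in hi hj.
by rewrite deriv_alongB !deriv_alongM !deriv_alongX !mevalXU /= h2 // subrr.
Qed.

Lemma jacobian_kerZ f v u c : c != 0 ->
  u *m (jacobian (model f) (c *: v))^T = 0 <-> u *m (jacobian (model f) v)^T = 0.
Proof.
have key v' b : u *m (jacobian (model f) v')^T = 0 -> u *m (jacobian (model f) (b *: v'))^T = 0.
  move=> /jacobian_kerP[h1 h2]; apply/jacobian_kerP; rewrite !scale_rowE; split.
    have -> : 2 * (b * v' 0 ord_max) * u 0 ord_max = b * (2 * v' 0 ord_max * u 0 ord_max) by ring.
    by rewrite h1 mulr_sumr; apply: eq_bigr => k _; rewrite !scale_rowE; ring.
  move=> i j i4 j4; rewrite !scale_rowE; transitivity (b * (u 0 (inord i) * v' 0 (inord j.+1) + v' 0 (inord i) * u 0 (inord j.+1))).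
    by ring.
  by rewrite h2 //; ring.
by move=> c0; split=> [/(key _ c^-1)|/(key _ c)//]; rewrite scalerA mulVf // scale1r.
Qed.

(** The derivative of [pt x 1 y] in x; for k = 0 the factor [k%:R] vanishes, whatever the
    exponent. *)
Definition tangent_x x : 'rV[C]_6 := \row_k if (k < 5)%N then k%:R * x ^+ k.-1 else 0.

Lemma tangent_x_lt x k : (k < 5)%N -> tangent_x x 0 (inord k) = k%:R * x ^+ k.-1.
Proof. by move=> k5; rewrite mxE inordK ?k5 // (ltn_trans k5). Qed.

Lemma tangent_x_last x : tangent_x x 0 ord_max = 0.
Proof. by rewrite mxE. Qed.

Lemma horner_deriv_wide f x : (size f <= 9)%N ->
  f^`().[x] = \sum_(k < 9) f`_k * (k%:R * x ^+ k.-1).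
Proof.
move=> f9; rewrite [RHS]big_ord_recl mul0r mulr0 add0r (@horner_coef_wide _ 8); last first.
  by apply: leq_trans (size_poly _ _) _; case: (size f) f9.
by apply: eq_bigr => k _; rewrite coef_deriv lift0 /= !mulrnAl mulrnAr mul1r.
Qed.

(** The quadrics of the cone leave the directions of scaling, of x and of y, and y^2 = f cuts them
    by 2 f z0 + f' z1 - 2 y z2 = 0. This is a nontrivial condition: if y = 0 then x is a root of f,
    and f' does not vanish there. *)
Lemma jacobian_rank_affine f x y : octic f -> y ^+ 2 = f.[x] ->
  \rank (jacobian (model f) (pt x 1 y)) = 4.
Proof.
move=> oF hy; have f9 := octic_size oF; rewrite -mxrank_tr.
apply: (@rank_of_kernel _ _ (pt x 1 0) (tangent_x x) (pt 0 0 1) (2 * f.[x]) f^`().[x] (- (2 * y))).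
- move=> z0 z1 z2 /rowP h; have := h (inord 0); have := h (inord 1); have := h ord_max.
  rewrite !comb_rowE !row0E !pt_last !pt_lt // !tangent_x_lt // tangent_x_last /=.
  rewrite !(expr0, expr1, expr1n, expr0n, mulr0, mulr1, mul0r, addr0, add0r) => -> + e0.
  by rewrite e0 mul0r add0r => ->.
- have n2 : (2 : C) != 0 by rewrite pnatr_eq0.
  case: (eqVneq y 0) => [y0|y0]; last by rewrite (oppr_eq0 (2 * y)) (mulf_neq0 n2 y0) !orbT.
  have fx : root f x by rewrite /root -hy y0 expr0n.
  suff -> : f^`().[x] != 0 by rewrite orbT.
  have /and3P[sf _ _] := oF; rewrite -/(root _ _).
  by apply: (coprimep_root _ fx); move: sf; rewrite separable_poly.unlock.
move=> u; rewrite jacobian_kerP pt_last.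
have V k : (k < 5)%N -> pt x 1 y 0 (inord k) = x ^+ k by move=> k5; rewrite pt_lt // expr1n mulr1.
have quad z0 z1 : (forall k, (k < 5)%N -> u 0 (inord k) = z0 * x ^+ k + z1 * (k%:R * x ^+ k.-1)) ->
  \sum_(k < 9) f`_k * (u 0 (inord k./2) * pt x 1 y 0 (inord (uphalf k)) + pt x 1 y 0 (inord k./2) * u 0 (inord (uphalf k)))
  = z0 * (2 * f.[x]) + z1 * f^`().[x].
  move=> hu; rewrite horner_deriv_wide // (horner_coef_wide _ f9) !mulr_sumr -big_split; apply: eq_bigr => -[k k9] _ /=.
  have [k1 k2] := half9 k9; rewrite !hu // !V //.
  by case: k k9 {k1 k2} => [|[|[|[|[|[|[|[|[|//]]]]]]]]] _ /=; ring.
have coordE z0 z1 z2 : u = z0 *: pt x 1 0 + z1 *: tangent_x x + z2 *: pt 0 0 1 <->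
   u 0 ord_max = z2 /\ forall k, (k < 5)%N -> u 0 (inord k) = z0 * x ^+ k + z1 * (k%:R * x ^+ k.-1).
  have E : (forall k, (k < 5)%N -> (z0 *: pt x 1 0 + z1 *: tangent_x x + z2 *: pt 0 0 1) 0 (inord k) = z0 * x ^+ k + z1 * (k%:R * x ^+ k.-1)) /\ (z0 *: pt x 1 0 + z1 *: tangent_x x + z2 *: pt 0 0 1) 0 ord_max = z2.
    split=> [k k5|]; rewrite comb_rowE ?pt_last ?pt_lt ?tangent_x_lt ?tangent_x_last //; last by ring.
    by rewrite expr1n; case: k k5 => [|[|[|[|[|//]]]]] _ /=; ring.
  split=> [->|[h5 h]]; first by case: E.
  by case: E => E E5; apply: eq_row6 => [k k5|]; rewrite ?E ?E5 ?h.
split=> [[h5 h]|[z0 [z1 [z2 [/coordE[h5 h] hz]]]]].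
  (* The quadrics with i = 0 determine each coordinate of u from the first two. *)
  pose z0 := u 0 (inord 0); pose z1 := u 0 (inord 1) - x * z0.
  have hu k : (k < 5)%N -> u 0 (inord k) = z0 * x ^+ k + z1 * (k%:R * x ^+ k.-1).
    elim: k => [|k IH] k5; first by rewrite /z0 /=; ring.
    have := h 0%N k isT k5; rewrite !V ?(ltnW k5) // IH ?(ltnW k5) // -/z0 => e.
    have -> : u 0 (inord k.+1) = u 0 (inord 1) * x ^+ k + x ^+ 1 * (z0 * x ^+ k + z1 * (k%:R * x ^+ k.-1)) - z0 * x ^+ k.+1.
      by rewrite -e; ring.
    by rewrite /z1; case: k {IH e} k5 => [|[|[|[|//]]]] _ /=; ring.
  exists z0, z1, (u 0 ord_max); split; first by apply/coordE.
  by move: h5; rewrite (quad z0 z1) // => <-; ring.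
split=> [|i j i4 j4].
  by rewrite (quad z0 z1) // h5; apply/eqP; rewrite -subr_eq0 -oppr_eq0 -hz; apply/eqP; ring.
rewrite !V ?ltnS ?(ltnW i4) ?(ltnW j4) // !h ?ltnS ?(ltnW i4) ?(ltnW j4) //.
by case: i i4 => [|[|[|[|//]]]] _; case: j j4 => [|[|[|[|//]]]] _ /=; ring.
Qed.

(** Here the condition is f_7 z0 + 2 f_8 z1 - 2 y z2 = 0. Its nontriviality is the simplicity of a
    root at infinity: f_7 and f_8 are not both zero. *)
Lemma jacobian_rank_infinity f y : octic f -> y ^+ 2 = f`_8 ->
  \rank (jacobian (model f) (pt 1 0 y)) = 4.
Proof.
move=> oF hy; have /and3P[_ f7 f9] := oF; rewrite -mxrank_tr.
have V k : (k < 5)%N -> pt 1 0 y 0 (inord k) = (k == 4)%:R.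
  by case: k => [|[|[|[|[|//]]]]] _; rewrite pt_lt //= expr1n mul1r ?expr0n ?expr0.
pose e k : 'rV[C]_6 := \row_i (i == k :> nat)%:R.
have ek k l : (l < 5)%N -> e k 0 (inord l) = (l == k)%:R.
  by move=> l5; rewrite mxE inordK // (ltn_trans l5).
apply: (@rank_of_kernel _ _ (e 3%N) (e 4%N) (e 5%N) f`_7 (2 * f`_8) (- (2 * y))).
- move=> z0 z1 z2 /rowP h; have := h (inord 3); have := h (inord 4); have := h ord_max.
  rewrite !comb_rowE !row0E !ek // ![e _ _ ord_max]mxE /=.
  by rewrite !(mulr0, mulr1, addr0, add0r) => -> -> ->.
- have n2 : (2 : C) != 0 by rewrite pnatr_eq0.
  case: (eqVneq f`_8 0) => [f80|f80]; last by rewrite (mulf_neq0 n2 f80) orbT.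
  case: (eqVneq f`_7 0) => [f70|//].
  have : (size f <= 7)%N.
    apply/leq_sizeP => -[|[|[|[|[|[|[|[|[|l]]]]]]]]] //= _.
    by apply: (leq_sizeP _ _ f9).
  by rewrite leqNgt f7.
move=> u; rewrite jacobian_kerP pt_last.
have quad : \sum_(k < 9) f`_k * (u 0 (inord k./2) * pt 1 0 y 0 (inord (uphalf k)) + pt 1 0 y 0 (inord k./2) * u 0 (inord (uphalf k)))
  = u 0 (inord 3) * f`_7 + u 0 (inord 4) * (2 * f`_8).
  by rewrite !big_ord_recl big_ord0 /= !V //=; ring.
have coordE z0 z1 z2 : u = z0 *: e 3%N + z1 *: e 4%N + z2 *: e 5%N <->
   [/\ u 0 ord_max = z2, u 0 (inord 3) = z0, u 0 (inord 4) = z1 & forall k, (k < 3)%N -> u 0 (inord k) = 0].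
  split=> [->|[h5 h3 h4 h]].
    rewrite !comb_rowE !ek // ![e _ _ ord_max]mxE /= !(mulr0, mulr1, addr0, add0r).
    by split=> // k k3; rewrite comb_rowE !ek ?(ltn_trans k3) //; case: k k3 => [|[|[|//]]] //= _; ring.
  apply: eq_row6 => [k k5|]; rewrite comb_rowE; last by rewrite ![e _ _ ord_max]mxE h5 /=; ring.
  by rewrite !ek //; case: k k5 => [|[|[|[|[|//]]]]] _; rewrite ?h3 ?h4 ?h //=; ring.
rewrite quad; split=> [[h5 h]|[z0 [z1 [z2 [/coordE[h5 h3 h4 h] hz]]]]].
  exists (u 0 (inord 3)), (u 0 (inord 4)), (u 0 ord_max); split; last first.
    by apply/eqP; rewrite mulrN subr_eq0 -h5; apply/eqP; ring.
  apply/coordE; split=> // k k3; have := h k 3%N (ltnW k3) isT.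
  by rewrite !V //; case: k k3 => [|[|[|//]]] //= _; rewrite !(mulr0, mulr1, mul0r, addr0).
rewrite h3 h4 h5; split=> [|i j i4 j4].
  by apply/eqP; rewrite -subr_eq0 -oppr_eq0; apply/eqP; rewrite -[RHS]hz; ring.
rewrite !V ?ltnS ?(ltnW i4) ?(ltnW j4) //.
case: i i4 => [|[|[|[|//]]]] _; case: j j4 => [|[|[|[|//]]]] _ //=;
  rewrite ?(h 0%N) ?(h 1%N) ?(h 2%N) //; ring.
Qed.

Lemma smooth_model f : octic f -> smooth_projective_curve (model f).
Proof.
move=> oF; split; [exact: model_homogeneous|exact: model_irreducible|].
have scale v c : c != 0 -> \rank (jacobian (model f) (c *: v)) = \rank (jacobian (model f) v).
  move=> c0; rewrite -mxrank_tr -[RHS]mxrank_tr.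
  have : (kermx (jacobian (model f) (c *: v))^T :=: kermx (jacobian (model f) v)^T)%MS.
    apply/eqmxP/andP; split; apply/row_subP => i; apply/sub_kermxP.
      by apply/(jacobian_kerZ _ _ _ c0)/sub_kermxP/row_sub.
    by apply/jacobian_kerZ => //; apply/sub_kermxP/row_sub.
  move=> e; have := mxrank_ker (jacobian (model f) (c *: v))^T; rewrite e mxrank_ker => h.
  by rewrite -[LHS](subKn (rank_leq_row _)) -h subKn ?rank_leq_row.
move=> v /model_param[c c0 [[x [y [-> hy]]]|[y [-> hy]]]]; rewrite scale //.
  by rewrite jacobian_rank_affine // hy horner_hev ?octic_size.
by rewrite jacobian_rank_infinity.
Qed.

End SmoothModel.

(** For sigma fixing F, the model of the conjugate of f is isomorphic to the conjugate of X, hence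
    to X and to the model of f; so f is equivalent to its conjugate. The model of the octic g over F
    is the curve sought. *)
Lemma hyperelliptic_field_of_moduli (C : numClosedFieldType) (n : nat) (X : seq {mpoly C[n.+1]})
    (F : divringClosed C) :
  hyperelliptic_curve 3 X -> card_Aut_gt X 4 -> field_of_moduli F X -> field_of_definition F X.
Proof.
move=> [_ [f [sf sizef iX]]] hAut hF.
have oF : octic f by rewrite /octic sf; case: sizef => ->.
have [M [N [sM sN nM nN MN]]] := stab_of_automorphisms oF (card_Aut_gt_isomorphic iX hAut).
pose S (sigma : {rmorphism C -> C}) := bijective sigma /\ {in F, forall x, sigma x = x}.
have fixF z : (forall sigma, S sigma -> sigma z = z) -> z \in F.
  move=> h; apply/negPn/negP => Fz; have [||sigma [bs sF]] := @automorphism_moving C (fun x => x \in F) z.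
  - by split=> [|x y|x y]; [exact: rpred1|exact: rpredB|exact: rpred_div].
  - exact/negP.
  by rewrite h ?eqxx.
have H : conj_equiv S f.
  move=> sigma [bs sF]; have [tau sK tK] := bs.
  have of' : octic (map_poly sigma f) by apply: octic_map.
  have : isomorphic (hyperelliptic_model 3 (map_poly sigma f)) (hyperelliptic_model 3 f).
    rewrite -conj_model; apply: isomorphic_trans (isomorphic_sym (isomorphic_map sK tK iX)) _.
    by apply: isomorphic_trans (isomorphic_sym _) iX; apply/hF.
  move=> [phi /(isomorphism_mobius of' oF)[A [e [dA e0 eA _]]]].
  by exists A, (e ^+ 2); split=> //; rewrite expf_neq0.
have [g [og fg Fg]] := octic_descends fixF oF H sM sN nM nN MN.
exists 5%N, (hyperelliptic_model 3 g); split.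
- exact: smooth_model.
- exact: model_defined_over.
exact: isomorphic_trans (equiv_isomorphic oF og fg) (isomorphic_sym iX).
Qed.

Local Open Scope complex_scope.

Theorem corollary3 (R : realType) (n : nat) (X : seq {mpoly R[i][n.+1]})
    (hX : hyperelliptic_curve 3 X) (hAut : card_Aut_gt X 4)
    (F : divringClosed R[i]) (hF : field_of_moduli F X) :
  field_of_definition F X.
Proof. exact: (@hyperelliptic_field_of_moduli R[i] n X F hX hAut hF). Qed.
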